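(* For every positive integer $k$ there is a constant $C_k>0$ depending only on $k$ such that the following holds. Let $\mathbb{F}_q$ be a finite field with $q$ elements, let $\mathcal{A}\subset \mathbb{F}_q^*$ with cardinality $A=|\mathcal{A}|\ge 2$, and let $f\in\mathbb{F}_q(X)$ be a rational function of degree $k$ which is not of the form $f(X)=r\,g(X)^d X^{\lambda}$ with $r\in\mathbb{F}_q$, $g\in\mathbb{F}_q(X)$, $\lambda\in\mathbb{Z}$, and $d$ an integer with $d\mid q-1$ and $d\ge 2$. Then there exist disjoint sets $\mathcal{S},\mathcal{T}\subset\mathcal{A}$ such that $\mathcal{A}=\mathcal{S}\cup\mathcal{T}$ and $$\max\{E^\times(\mathcal{S}),\,E^\times(f(\mathcal{T}))\}\le C_k\,\frac{A^3}{M(\mathcal{A})},$$ where $$M(\mathcal{A})=\min\left\{\frac{q^{1/2}}{A^{1/2}(\log A)^{11/4}},\ \frac{A^{4/5}}{q^{2/5}(\log A)^{31/10}}\right\}.$$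
   Context: For a finite set $\mathcal{U}\subset\mathbb{F}_q$, the multiplicative energy is $E^\times(\mathcal{U})=\#\{(u_1,u_2,u_3,u_4)\in\mathcal{U}^4: u_1u_2=u_3u_4\}$. For a rational function $f$ and a set $\mathcal{T}\subset\mathbb{F}_q$, $f(\mathcal{T})=\{f(t): t\in\mathcal{T},\ t \text{ not a pole of } f\}$. The degree of a rational function is the maximum of the degrees of its numerator and denominator in lowest terms. $\log$ is the natural logarithm. *)

(* Defs.v *)
From mathcomp Require Import all_boot all_order all_algebra.
From mathcomp Require Import reals exp.

Set Implicit Arguments.
Unset Strict Implicit.
Unset Printing Implicit Defensive.

Import Order.TTheory GRing.Theory Num.Theory.
Local Open Scope ring_scope.

Section RationalFunctions.
Variable F : fieldType.
Implicit Types f : {fraction {poly F}}.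

(* [repr f] is an arbitrary, possibly unreduced, representative of the class
   [f]; dividing by the gcd makes it reduced, so the two polynomials below are
   determined by [f] up to a common nonzero constant factor (and for f = 0
   they are 0 and a nonzero constant). *)
Definition rf_num f : {poly F} :=
  \n_(repr f) %/ gcdp \n_(repr f) \d_(repr f).

Definition rf_den f : {poly F} :=
  \d_(repr f) %/ gcdp \n_(repr f) \d_(repr f).

Lemma rf_gcd_neq0 f : gcdp \n_(repr f) \d_(repr f) != 0.
Proof. by rewrite gcdp_eq0 negb_and (denom_ratioP (repr f)) orbT. Qed.

Lemma rf_den_neq0 f : rf_den f != 0.
Proof. by rewrite dvdp_div_eq0 ?dvdp_gcdr // denom_ratioP. Qed.

Lemma rf_coprime f : coprimep (rf_num f) (rf_den f).
Proof. by apply: coprimep_div_gcd; rewrite (denom_ratioP (repr f)) orbT. Qed.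

Lemma rf_num_den f :
  f = FracField.tofrac (rf_num f) / FracField.tofrac (rf_den f).
Proof.
have nz := rf_gcd_neq0 f.
have d0 := rf_den_neq0 f.
have e0 : FracField.tofrac (rf_den f) != 0 by rewrite tofrac_eq0.
apply: (mulIf e0); rewrite mulfVK //.
rewrite -{1}[f]reprK.
have : \n_(repr f) * rf_den f = \d_(repr f) * rf_num f.
  apply: (mulIf nz); rewrite -!mulrA !divpK ?dvdp_gcdl ?dvdp_gcdr //.
  by rewrite mulrC.
move: (rf_num f) (rf_den f) d0 => n d d0 eqnd.
rewrite !piE; apply/eqmodP; rewrite /= FracField.equivfE.
rewrite /FracField.mulf !numden_Ratio ?mulf_neq0 ?oner_neq0 ?denom_ratioP //.
by rewrite !mulr1 eqnd.
Qed.

Definition rf_deg f : nat := maxn (size (rf_num f)).-1 (size (rf_den f)).-1.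

Definition rf_pole f (t : F) : bool := root (rf_den f) t.

Definition rf_eval f (t : F) : F := (rf_num f).[t] / (rf_den f).[t].

(* The negation of this is the nondegeneracy hypothesis; 0 is allowed for
   [r] and [g], and [lambda] may be negative. *)
Definition rf_power_form (q : nat) f : Prop :=
  exists (r : F) (g : {fraction {poly F}}) (d : nat) (lambda : int),
    [/\ (2 <= d)%N, (d %| q - 1)%N &
        f = FracField.tofrac r%:P * g ^+ d * FracField.tofrac 'X ^ lambda].

End RationalFunctions.

Section FiniteFields.
Variable F : finFieldType.

Definition rf_image (f : {fraction {poly F}}) (T : {set F}) : {set F} :=
  [set rf_eval f t | t in T & ~~ rf_pole f t].

Definition mul_energy (U : {set F}) : nat :=
  #|[set u in setX (setX U U) (setX U U) | u.1.1 * u.1.2 == u.2.1 * u.2.2]|.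

Definition bound_M (R : realType) (A : {set F}) : R :=
  let q : R := #|F|%:R in
  let a : R := #|A|%:R in
  Num.min (q `^ (1 / 2) / (a `^ (1 / 2) * ln a `^ (11 / 4)))
          (a `^ (4 / 5) / (q `^ (2 / 5) * ln a `^ (31 / 10))).

End FiniteFields.

(* Main.v *)
Require Import Defs.
From HB Require Import structures.
From mathcomp Require Import all_boot all_order all_algebra all_fingroup all_solvable all_field.
From mathcomp Require Import zify ring lra.
From mathcomp Require Import reals exp.

(** The decomposition follows the Balog-Wooley strategy, with Weil's bound for
    multiplicative character sums as arithmetic input.

    Let [a] be the size of the given set and let a subset [B] have energy larger
    than [a^3 / kap].  Pigeonholing the representation counts of products yields
    a set [P] of popular products of [B], and then a nonempty set [A'] of
    elements of [B] that are quotients [p / b], with [p] in [P] and [b] in [B],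
    in many ways.  Such an [A'] is [equidistributed]: for all [Y] and [W], few
    pairs [(x, y)] in [A' * Y] satisfy [f x * y \in W].  Indeed each such pair
    lifts to many solutions of [f (p / b) * y = w]; expanding the equations in
    multiplicative characters, the trivial characters give the expected main
    term, and the others are at most a multiple of [sqrt q] by Weil, on average
    over the characters by Cauchy-Schwarz and Parseval ([mixing]).
    The defining inequality of equidistribution is additive over disjoint
    unions, so such pieces can be removed one after another until a set [S] of
    small energy is left, and the union [T] of the pieces is still
    equidistributed ([equidistributed_decomposition]).  Equidistribution of [T],
    tested on [Y = f T] without 0 and on the popular products [W] of [Y], bounds
    the energy of [f T] ([mul_energy_rf_image]).  The choice [kap = M] balances
    the bounds for [S] and for [f T]; for [a ^ 2 <= q] the quantity [M] is
    bounded, and the trivial bound [a ^ 3] for the energy is enough.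

    The nonprincipal character sums are sums of [chi (h x)] for a polynomial [h]
    which, over an algebraic closure, has a root whose multiplicity is not
    divisible by [q - 1]: failure of this for some nontrivial pair of characters
    means precisely that [f] is a constant times a power times a monomial
    ([exists_nonmultiple_multiplicity]).  For such [h], Weil's bound is obtained
    in two steps.

    Stepanov's method, over the extensions of degree [2 * nu], gives
    [|S_(2 nu)| <= C * q ^ nu] for the sums over the extensions, with an unknown
    constant [C] ([stepanov_char_sum]).  The norms of the nonzero values of [h]
    lie in one coset of the group of [d]-th roots of unity, for some divisor
    [d > 1] of [q - 1].  An auxiliary polynomial vanishing to high order wherever
    the norm takes a prescribed value shows that each value in the coset is
    taken at most [q ^ (2 nu) / d + O (q ^ nu)] times; since these counts add up
    to about [q ^ (2 nu)], they are all nearly equal and the twisted sum is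
    small.

    The constant is removed by the L-function.  Its coefficients [coefL n] are
    sums of a completely multiplicative function over the monic polynomials of
    degree [n]; they vanish for large [n], because the function depends only on a
    residue, and they are tied to the sums over the extensions by Newton's
    identities, which here come from counting the prime power divisors of a
    polynomial by Frobenius orbits of its roots ([newton_coefL]).  Hence
    [S_j = - \sum_i w_i ^ j] with a bounded number of [w_i], and Lagrange
    interpolation turns [|S_(2 nu)| <= C * q ^ nu] into [|w_i| <= sqrt q]
    ([power_sums_bound]); the case [j = 1] is [weil_bound]. *)

Set Implicit Arguments.
Unset Strict Implicit.
Unset Printing Implicit Defensive.

Import Order.TTheory GRing.Theory Num.Theory.
Local Open Scope ring_scope.

(** * Linear algebra, determinants and roots of polynomials *)

Lemma underdetermined_system (K : fieldType) (I J : finType) (A : I -> J -> K) :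
  (#|J| < #|I|)%N ->
  exists2 v : I -> K, exists i, v i != 0 & forall j, \sum_i v i * A i j = 0.
Proof.
move=> ltJI; pose M := \matrix_(i < #|I|, j < #|J|) A (enum_val i) (enum_val j).
have /rowV0Pn[u /sub_kermxP uM0 u_neq0] : kermx M != 0.
  rewrite -mxrank_eq0 mxrank_ker subn_eq0 -ltnNge.
  exact: leq_ltn_trans (rank_leq_col _) ltJI.
exists (fun i => u 0 (enum_rank i)) => [|j].
  have /rV0Pn[i ui] := u_neq0.
  by exists (enum_val i); rewrite enum_valK.
have uMj : (u *m M) 0 (enum_rank j) = 0 by rewrite uM0 mxE.
rewrite -[RHS]uMj mxE.
rewrite [RHS](reindex_onto enum_rank enum_val) /=; last by move=> i _; rewrite enum_valK.
symmetry; apply: eq_big => [i|i _]; first by rewrite enum_rankK eqxx.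
by rewrite !mxE !enum_rankK.
Qed.

Lemma size_det_leq (R : comNzRingType) n (M : 'M[{poly R}]_n) (e : 'I_n -> nat) :
  (forall i j, size (M i j) <= (e i).+1)%N ->
  (size (\det M) <= (\sum_i e i).+1)%N.
Proof.
move=> Me; apply: (leq_trans (size_sum _ _ _)); apply/bigmax_leqP => s _.
rewrite mulr_sign; apply: (@leq_trans (size (\prod_i M i (s i)))).
  by case: ifP => _ //; rewrite size_polyN.
elim/big_rec2: _ => [|i m p _ IH]; first by rewrite size_poly1.
apply: (leq_trans (size_polyMleq _ _)).
have := Me i (s i); move: IH; lia.
Qed.

(** The companion matrix of [D] is a matrix [C] with [a C^n = b], by Cayley-Hamilton;
    the element [u] is its determinant. It plays the role of a norm from the
    extension that [D] would define if it were irreducible. *)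
Lemma det_of_dvdp_binomial (L : fieldType) (D : {poly L}) (m n : nat) (a b : L) :
  D \is monic -> size D = m.+2 -> D %| a *: 'X^n - b%:P ->
  exists u, a ^+ m.+1 * u ^+ n = b ^+ m.+1.
Proof.
move=> mD szD dvdD.
have [C charC] : exists C : 'M[L]_m.+1, char_poly C = D.
  have := companionmxK mD; move: (companionmx D).
  by rewrite szD /= => C <-; exists C.
have : horner_mx C (a *: 'X^n - b%:P) = 0.
  case/dvdpP: dvdD => r ->.
  by rewrite rmorphM /= -charC Cayley_Hamilton mulr0.
rewrite rmorphB /= horner_mxZ rmorphXn /= horner_mx_X horner_mx_C => /eqP.
rewrite subr_eq0 => /eqP /(congr1 determinant).
rewrite detZ det_scalar => <-; exists (\det C); congr (_ * _).
by elim: n {dvdD} => [|n IH]; rewrite ?expr0 ?det1 // !exprS IH -det_mulmx.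
Qed.

Lemma mupX (F : fieldType) (x : F) (p : {poly F}) n :
  p != 0 -> mup x (p ^+ n) = (n * mup x p)%N.
Proof.
move=> p0; elim: n => [|n IH].
  by rewrite expr0 mul0n mupNroot // root1.
by rewrite exprS mupM ?expf_neq0 // IH mulSn.
Qed.

Lemma mupZ (F : fieldType) (x c : F) (p : {poly F}) :
  c != 0 -> mup x (c *: p) = mup x p.
Proof.
move=> c0; rewrite -mul_polyC mupMr // rootC //.
Qed.

Lemma monic_exp_inj (F : fieldType) (p r : {poly F}) n :
  (0 < n)%N -> p \is monic -> r \is monic -> p ^+ n = r ^+ n -> p = r.
Proof.
move=> n0 mp mr e; apply/eqP; rewrite -eqp_monic // /eqp.
by rewrite -(dvdp_pexp2r p r n0) -(dvdp_pexp2r r p n0) e dvdpp.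
Qed.

Lemma root_extraction (K : closedFieldType) (p : {poly K}) (e : nat) :
  p != 0 -> (forall b, e %| mup b p)%N ->
  exists2 w : {poly K}, w \is monic & p = lead_coef p *: w ^+ e.
Proof.
move=> p0 ep; have [rs Dp] := closed_field_poly_normal p.
have lp0 : lead_coef p != 0 by rewrite lead_coef_eq0.
have ers b : (e %| count_mem b rs)%N.
  by have := ep b; rewrite [in mup _ p]Dp mupZ // mu_prod_XsubC.
exists (\prod_(b <- undup rs) ('X - b%:P) ^+ (count_mem b rs %/ e)).
  by apply: monic_prod => b _; rewrite monic_exp // monicXsubC.
rewrite {1}Dp; congr (_ *: _).
rewrite -prodrXl -[LHS]prodr_undup_exp_count; apply: eq_bigr => b _.
by rewrite -exprM divnK.
Qed.

(** * Linear independence of powers of a radical *)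

Lemma size_resultant_leq (R : comNzRingType) (P G : {poly {poly R}}) a b :
  (forall i, size (P`_i)%R <= a.+1)%N -> (forall i, size (G`_i)%R <= b.+1)%N ->
  (size (resultant P G) <= ((size G).-1 * a + (size P).-1 * b).+1)%N.
Proof.
move=> Pa Gb.
pose e (i : 'I_((size G).-1 + (size P).-1)) :=
  match split i with inl _ => a | inr _ => b end.
have -> : ((size G).-1 * a + (size P).-1 * b = \sum_i e i)%N.
  rewrite big_split_ord /=; congr (_ + _)%N.
    rewrite (eq_bigr (fun=> a)) ?sum_nat_const ?card_ord // => i _.
    by rewrite /e; case: splitP => // j /= eij; have := ltn_ord i; lia.
  rewrite (eq_bigr (fun=> b)) ?sum_nat_const ?card_ord // => i _.
  rewrite /e; case: splitP => // j /= eij.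
  by have := ltn_ord j; rewrite -eij ltnNge leq_addr.
apply: size_det_leq => i j; rewrite Sylvester_mxE /e.
by case: (split i) => k; case: (k <= j)%N; rewrite ?mulr1n ?mulr0n ?size_poly0 ?Pa ?Gb.
Qed.

Lemma clear_denominators (K : fieldType) (x y a b : K) n :
  b != 0 -> x * (a / b) ^+ n = y -> x * a ^+ n = y * b ^+ n.
Proof. by move=> b0 <-; rewrite expr_div_n mulrA divfK // expf_neq0. Qed.

(** If a factor of degree [m < d] divides [h Y^r - k] over the field of rational
    functions, taking determinants gives [h^m u^r = k^m] with [u] rational, so [r]
    divides every multiplicity of [h^m], against the hypothesis. Thus [1, Y, ...,
    Y^(d-1)] are linearly independent as soon as [h Y^r = k]. *)
Lemma binomial_common_factor (K : fieldType) (h : {poly K}) (k : K) r d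
    (G : {poly {poly K}}) :
  h != 0 -> k != 0 -> (0 < r)%N ->
  (forall m, (0 < m < d)%N -> exists b, ~~ (r %| m * mup b h)%N) ->
  G != 0 -> (size G <= d)%N ->
  ~~ (1 < size (gcdp (h *: 'X^r - (k%:P)%:P) G))%N.
Proof.
move=> h0 k0 r0 kum G0 szG; set P := _ - _; apply/negP => gt1.
pose L : fieldType := {fraction {poly K}}.
pose toF : {rmorphism {poly K} -> L} := @FracField.tofrac {poly K}.
have toF_inj : injective toF by move=> x y /eqP; rewrite tofrac_eq => /eqP.
have P0 : P != 0.
  apply/eqP => /(congr1 (fun p : {poly {poly K}} => p`_r)).
  rewrite coefB coefZ coefXn eqxx mulr1 coefC coef0 eqn0Ngt r0 /= subr0.
  by apply/eqP.
pose D0 := map_poly toF (gcdp P G).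
have dvdD (Z : {poly {poly K}}) : gcdp P G %| Z -> D0 %| map_poly toF Z.
  move=> dv; have [[c r1] /= c0 /(congr1 (map_poly toF))] := @Pdiv.Idomain.dvdpP _ _ _ dv.
  rewrite rmorphM /= map_polyZ /= => e.
  have c0' : toF c != 0 by rewrite -(rmorph0 toF) (inj_eq toF_inj).
  by rewrite -(dvdpZr _ _ c0') e dvdp_mull.
have szD0 : size D0 = size (gcdp P G) by rewrite size_map_inj_poly ?rmorph0.
have D00 : D0 != 0 by rewrite -size_poly_gt0 szD0 ltnW.
have dG : D0 %| map_poly toF G by apply: dvdD; rewrite dvdp_gcdr.
have dP : D0 %| map_poly toF P by apply: dvdD; rewrite dvdp_gcdl.
have szDG : (size D0 <= size G)%N.
  have szG' : size (map_poly toF G) = size G by rewrite size_map_inj_poly ?rmorph0.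
  by rewrite -szG' dvdp_leq // -size_poly_gt0 szG' size_poly_gt0.
pose D := (lead_coef D0)^-1 *: D0.
have mD : D \is monic by rewrite monicE lead_coefZ mulVf // lead_coef_eq0.
have szD : size D = size D0 by rewrite size_scale // invr_eq0 lead_coef_eq0.
have [m szDm] : exists m, size D = m.+2.
  by exists (size D).-2; rewrite szD szD0; move: gt1; lia.
have dDP : D %| toF h *: 'X^r - (toF k%:P)%:P.
  rewrite dvdpZl ?invr_eq0 ?lead_coef_eq0 //; move: dP.
  by rewrite /P rmorphB /= map_polyZ /= map_polyXn map_polyC.
have [u Du] := det_of_dvdp_binomial mD szDm dDP.
have [a [b [b0 Dab]]] : exists a b : {poly K}, b != 0 /\ u = toF a / toF b.
  exists (rf_num u), (rf_den u); split; first exact: rf_den_neq0.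
  exact: rf_num_den.
have b0' : toF b != 0 by rewrite -(rmorph0 toF) (inj_eq toF_inj).
have E : h ^+ m.+1 * a ^+ r = (k ^+ m.+1)%:P * b ^+ r.
  apply: toF_inj; rewrite polyC_exp !rmorphM /= !rmorphXn /=.
  by apply: clear_denominators b0' _; rewrite -Dab.
have a0 : a != 0.
  apply: contra_eq_neq E => ->; rewrite expr0n eqn0Ngt r0 mulr0 eq_sym.
  by rewrite mulf_neq0 ?expf_neq0 // polyC_eq0 expf_neq0.
have [|b1] := kum m.+1; first by rewrite /= -szDm szD (leq_trans szDG szG).
apply/negP/negPn.
have := congr1 (mup b1) E; rewrite mul_polyC mupZ ?expf_neq0 //.
rewrite mupM ?expf_neq0 // !mupX // => e.
by rewrite -(dvdn_addl (n := (r * mup b1 a)%N)) ?e ?dvdn_mulr.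
Qed.

(** A quantitative form of the independence above, where [h Y^r = k] and [G(Y) = 0]
    hold only modulo [V]. Then [V] divides the resultant of [h Y^r - k] and [G],
    whose degree is too small unless it is 0; and if it is 0 the two polynomials have
    a common factor. *)
Lemma kummer_nonvanishing (K : fieldType) (h V Y0 : {poly K}) (k : K) r d B
    (G : {poly {poly K}}) :
  h != 0 -> k != 0 -> (0 < r)%N ->
  (forall m, (0 < m < d)%N -> exists b, ~~ (r %| m * mup b h)%N) ->
  (size G <= d)%N -> (forall i, size (G`_i)%R <= B.+1)%N ->
  V %| h * Y0 ^+ r - k%:P -> V %| G.[Y0] ->
  (d * size h + r * B < (size V).-1)%N -> G = 0.
Proof.
move=> h0 k0 r0 kum szG GB VP VG szV; apply/eqP/negPn/negP => G0.
set P := h *: 'X^r - (k%:P)%:P.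
have szP : size P = r.+1.
  rewrite size_polyDl ?size_scale ?size_polyXn //.
  by rewrite size_polyN size_polyC; case: eqP => //; lia.
have [szG1 | szG1] := leqP (size G) 1.
  have cG : G = (G`_0)%:P by exact: size1_polyC.
  have g0 : G`_0 != 0 by apply: contraNneq G0 => g0; rewrite cG g0.
  have := GB 0%N; move: VG; rewrite cG hornerC coefC /= => /(dvdp_leq g0) l1 l2.
  move: szV l1 l2; case: r r0 {kum VP P szP} => // r _; rewrite mulSn.
  by move: (size V) (size (G`_0)%R) (d * _)%N (r * B)%N => x1 x2 x3 x4; lia.
have [[u v] /= _ Dr] := @resultant_in_ideal _ P G (ltac:(by rewrite szP; lia)) szG1.
have Vres : V %| resultant P G.
  have := congr1 (horner^~ Y0) Dr; rewrite hornerC hornerD !hornerM => ->.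
  rewrite dvdp_add // dvdp_mull //.
  by rewrite hornerD hornerN hornerZ hornerXn hornerC.
have res0 : resultant P G = 0.
  apply/eqP/negPn/negP => /dvdp_leq /(_ Vres).
  have := @size_resultant_leq _ P G (size h) B _ GB.
  rewrite szP /= => /(_ _) szR le1.
  have {}szR : (size (resultant P G) <= ((size G).-1 * size h + r * B).+1)%N.
    apply: szR => i; rewrite coefB coefZ coefXn coefC.
    apply: (leq_trans (size_polyD _ _)); rewrite size_polyN geq_max.
    apply/andP; split; first by case: eqP => _; rewrite ?mulr1 ?mulr0 ?size_poly0.
    by case: eqP; rewrite ?size_poly0 // size_polyC; case: eqP.
  have l3 : ((size G).-1 * size h <= d * size h)%N by rewrite leq_mul2r; lia.
  move: szV le1 szR l3; move: (size V) (size (resultant P G : {poly K})) ((size G).-1 * _)%N.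
  by move: (d * _)%N (r * B)%N => x1 x2 x3 x4 x5; lia.
have := binomial_common_factor h0 k0 r0 kum G0 szG.
by rewrite -resultant_eq0 -/P res0 eqxx.
Qed.

(** * Truncation, multiplicity and inner degree of polynomials *)

Section Truncation.
Variable K : fieldType.
Implicit Types P S : {poly K}.

Lemma dvdp_Xn_coef M P : (forall k, (k < M)%N -> P`_k = 0) -> 'X^M %| P.
Proof.
move=> P0; rewrite -(poly_take_drop M P) dvdp_add ?dvdp_mull //.
suff -> : take_poly M P = 0 by rewrite dvdp0.
by apply/polyP=> k; rewrite coef_take_poly coef0; case: ifP => // /P0.
Qed.

Lemma dvdp_subM D P P' S S' : D %| P - P' -> D %| S - S' -> D %| P * S - P' * S'.
Proof.
move=> dP dS; have -> : P * S - P' * S' = (P - P') * S + P' * (S - S') by ring.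
apply: dvdp_add; [exact: dvdp_mulr | exact: dvdp_mull].
Qed.

Lemma dvdp_subX D P P' n : D %| P - P' -> D %| P ^+ n - P' ^+ n.
Proof.
by move=> dP; elim: n => [|n IH]; rewrite ?subrr ?dvdp0 // !exprS dvdp_subM.
Qed.

(** Modulo [X^M], the power [M + e] of a polynomial with constant term [a] is
    [a^(e+1)] times an expression in which [a] occurs with exponents below [M] only.
    In the application [a^e] is known in advance, so that only these small powers
    contribute to degrees; the extra exponent [M] keeps all exponents of [a]
    nonnegative. *)
Lemma binomial_truncation (a : K) (g : {poly K}) M e :
  'X^M %| (a%:P + 'X * g) ^+ (M + e) -
   (a ^+ e.+1)%:P * \sum_(i < M) ((a ^+ (M.-1 - i))%:P * ('X * g) ^+ i *+ 'C(M + e, i)).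
Proof.
rewrite exprDn -addnS big_split_ord /= mulr_sumr addrAC -sumrB.
rewrite big1 ?add0r => [|i _].
  elim/big_rec: _ => [|i P _ IH]; rewrite ?dvdp0 // dvdp_add //.
  rewrite -mulrnAl dvdp_mull // exprMn exprD -mulrA dvdp_mulr //.
rewrite mulrnAr mulrA -polyC_exp -polyCM -exprD.
have -> : (e.+1 + (M.-1 - i) = M + e - i)%N by have := ltn_ord i; lia.
by rewrite subrr.
Qed.

Lemma dvdp_prod_XsubC_exp M (s : seq K) P :
  uniq s -> (forall x, x \in s -> ('X - x%:P) ^+ M %| P) ->
  \prod_(x <- s) ('X - x%:P) ^+ M %| P.
Proof.
elim: s => [|x s IH] /=; first by rewrite big_nil dvd1p.
case/andP=> xs us Ps; rewrite big_cons Gauss_dvdp.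
  by rewrite Ps ?mem_head // IH // => y ys; rewrite Ps // inE ys orbT.
rewrite coprimep_expl // prodrXl coprimep_expr //.
by rewrite coprimep_sym coprimep_XsubC root_prod_XsubC.
Qed.

Lemma size_leq_of_high_multiplicity M (s : seq K) P :
  P != 0 -> uniq s -> (forall x, x \in s -> ('X - x%:P) ^+ M %| P) ->
  (M * size s < size P)%N.
Proof.
move=> P0 us Ps; have := dvdp_leq P0 (dvdp_prod_XsubC_exp us Ps).
rewrite prodrXl.
have mp : \prod_(x <- s) ('X - x%:P) \is monic by rewrite monic_prod_XsubC.
have := size_exp (\prod_(x <- s) ('X - x%:P)) M.
rewrite size_prod_XsubC /= => e.
move: e; case E: (size _) => [|n] /= e.
  by move/eqP: E; rewrite size_poly_eq0 expf_eq0 (negPf (monic_neq0 mp)) andbF.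
by rewrite e mulnC.
Qed.

(** Expansion in the base [U]: an identity [\sum_j S_j U^j = 0] forces [U] to divide
    [S_0]. The hypothesis that this implies [S_0 = 0] takes the place of a degree
    bound on the digits. *)
Lemma lowest_coefficient J (U : {poly K}) (S : nat -> {poly K}) :
  U != 0 -> (forall j, U %| S j -> S j = 0) -> \sum_(j < J) S j * U ^+ j = 0 ->
  forall j, (j < J)%N -> S j = 0.
Proof.
elim: J S => // J IH S U0 US; rewrite big_ord_recl expr0 mulr1.
have -> : \sum_(i < J) S (lift ord0 i) * U ^+ (lift ord0 i) =
          U * \sum_(i < J) S i.+1 * U ^+ i.
  by rewrite mulr_sumr; apply: eq_bigr => i _; rewrite /= exprS mulrCA.
move=> sum0.
have S0 : S 0%N = 0.
  by apply: US; rewrite (_ : S 0%N = - (U * \sum_(i < J) S i.+1 * U ^+ i));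
    [rewrite dvdpNr dvdp_mulr | apply/eqP; rewrite -addr_eq0 sum0].
case=> // j; rewrite ltnS; apply: (IH (fun j => S j.+1)) => //.
  by move=> i; exact: US.
by move/eqP: sum0; rewrite S0 add0r mulf_eq0 (negPf U0) => /eqP.
Qed.

End Truncation.

Section InnerDegree.
Variable R : comNzRingType.
Implicit Types P S : {poly {poly R}}.

(** A bound on the degree in the inner variable of a polynomial in two variables, in
    the form in which it is stable under products and sums. *)
Definition inner_size_le n P := forall k, (size (P`_k)%R <= n.+1)%N.

Lemma inner_size_leW a b P : (a <= b)%N -> inner_size_le a P -> inner_size_le b P.
Proof. by move=> ab Pa k; apply: leq_trans (Pa k) _. Qed.

Lemma inner_size_leM a b P S :
  inner_size_le a P -> inner_size_le b S -> inner_size_le (a + b) (P * S).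
Proof.
move=> Pa Sb k; rewrite coefM; apply: (leq_trans (size_sum _ _ _)).
apply/bigmax_leqP => i _; apply: (leq_trans (size_polyMleq _ _)).
have := Pa i; have := Sb (k - i)%N.
by move: (size (P`_i)%R) (size (S`_(k - i))%R) => x y; lia.
Qed.

Lemma inner_size_leX a P n : inner_size_le a P -> inner_size_le (n * a) (P ^+ n).
Proof.
move=> Pa; elim: n => [|n IH]; last by rewrite exprS mulSn; exact: inner_size_leM.
by move=> k; rewrite expr0 coefC; case: ifP => _; rewrite ?size_poly1 ?size_poly0.
Qed.

Lemma inner_size_leC a (p : {poly R}) : (size p <= a.+1)%N -> inner_size_le a p%:P.
Proof. by move=> pa k; rewrite coefC; case: ifP; rewrite ?size_poly0. Qed.

Lemma inner_size_leXvar a : inner_size_le a 'X.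
Proof.
by move=> k; rewrite coefX; case: eqP => _; rewrite ?size_poly1 ?size_poly0.
Qed.

Lemma inner_size_leD a P S :
  inner_size_le a P -> inner_size_le a S -> inner_size_le a (P + S).
Proof.
by move=> Pa Sa k; rewrite coefD (leq_trans (size_polyD _ _)) // geq_max Pa Sa.
Qed.

Lemma inner_size_leMn a P n : inner_size_le a P -> inner_size_le a (P *+ n).
Proof.
move=> Pa; elim: n => [|n IH]; last by rewrite mulrS; exact: inner_size_leD.
by move=> k; rewrite mulr0n coef0 size_poly0.
Qed.

Lemma inner_size_le_sum a (I : finType) (F : I -> {poly {poly R}}) :
  (forall i, inner_size_le a (F i)) -> inner_size_le a (\sum_i F i).
Proof.
move=> Fa; elim/big_rec: _ => [k|i P _ Pa]; first by rewrite coef0 size_poly0.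
exact: inner_size_leD.
Qed.

End InnerDegree.

(** * Stepanov's auxiliary polynomial *)

Section Taylor.
Variables (K : fieldType) (h : {poly K}).

(** The polynomial [t(x, T)] such that [h(x + T) = h(x) + T t(x, T)]. The order of
    vanishing at [x] is read off from this expansion modulo [T^M]; ordinary
    derivatives would only detect orders up to the characteristic. *)
Definition taylor_tail : {poly {poly K}} := \poly_(i < size h) (poly_XaY h)`_i.+1.

Lemma poly_XaY_taylor : poly_XaY h = h%:P + 'X * taylor_tail.
Proof.
apply/polyP=> -[|i]; rewrite coefD coefC coefXM /= ?addr0 ?add0r.
  by rewrite -horner_coef0 horner_poly_XaY add0r comp_polyXr.
rewrite coef_poly; case: ltnP => // le_i.
by rewrite nth_default // size_poly_XaY; apply: leqW.
Qed.

Lemma inner_size_taylor_tail : inner_size_le (size h) taylor_tail.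
Proof.
move=> k; rewrite coef_poly; case: ifP => _; last by rewrite size_poly0.
have <- : sizeY (poly_XaY h) = size h by rewrite sizeYE swapXY_poly_XaY size_poly_XaY.
exact/leqW/max_size_coefXY.
Qed.

Lemma comp_poly_taylor (x : K) :
  h \Po (x%:P + 'X) = (h.[x])%:P + 'X * map_poly (horner_eval x) taylor_tail.
Proof.
have -> : h \Po (x%:P + 'X) = map_poly (horner_eval x) (poly_XaY h).
  rewrite -horner_poly_XaY horner_polyC swapXY_poly_XaY.
  by apply: eq_map_poly.
by rewrite poly_XaY_taylor rmorphD rmorphM /= map_polyC map_polyX.
Qed.

End Taylor.

Section Frobenius.
Variables (K : fieldType) (Q : nat).
Hypothesis Qchar : [pchar K].-nat Q.

Lemma frobenius_polyD (P S : {poly K}) : (P + S) ^+ Q = P ^+ Q + S ^+ Q.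
Proof. by apply: exprDn_pchar; rewrite (eq_pnat _ (pchar_poly _)). Qed.

Lemma frobenius_polyN (P : {poly K}) : (- P) ^+ Q = - P ^+ Q.
Proof.
apply/eqP; rewrite -addr_eq0 -frobenius_polyD addNr.
by case: Q Qchar => // n _; rewrite expr0n.
Qed.

Lemma frobenius_polyB (P S : {poly K}) : (P - S) ^+ Q = P ^+ Q - S ^+ Q.
Proof. by rewrite frobenius_polyD frobenius_polyN. Qed.

End Frobenius.

Section StepanovPolynomial.
Variables (K : fieldType) (h : {poly K}) (x0 c : K) (r d E J B M Q : nat).
Hypothesis Qchar : [pchar K].-nat Q.
Hypothesis rE : (r * E).+1 = Q.
Hypothesis hx0 : h.[x0] != 0.
Hypothesis r0 : (0 < r)%N.
Hypothesis kum : forall m, (0 < m < d)%N -> exists b, ~~ (r %| m * mup b h)%N.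
Hypothesis M0 : (0 < M)%N.
Hypothesis MQ : (M <= Q)%N.
Hypothesis B_small : (d * size h + r * B.-1 < Q)%N.
Hypothesis J0 : (0 < J)%N.
Hypothesis B0 : (0 < B)%N.

Notation idx := ('I_d * 'I_J * 'I_B)%type.
Implicit Types i : idx.

(** Up to a power of [h], the coefficients of [V i] are the Taylor coefficients, at a
    variable point, of the part [X^b h^(M + l E)] of a monomial of the auxiliary
    polynomial. *)
Let V i : {poly {poly K}} :=
  ('X%:P + 'X) ^+ i.2 *
  \sum_(k < M) (((h ^+ (M.-1 - k))%:P * ('X * taylor_tail h) ^+ k) *+ 'C(M + i.1.1 * E, k)).

(** The powers of [(X - x0)^Q], rather than those of [X^Q], separate the digits of
    the auxiliary polynomial: on the fixed points of the [Q]-power map both are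
    polynomials of low degree in the point, but the nonvanishing argument needs a
    point where [h] does not vanish, and [h] may vanish at 0. *)
Definition stepanov_poly (v : idx -> K) : {poly K} :=
  \sum_i v i *: ('X ^+ i.2 * h ^+ (M + i.1.1 * E) * (('X - x0%:P) ^+ Q) ^+ i.1.2).

(** At a point [x] fixed by the [Q]-power map and with [h(x)^E = c], the [k]-th
    Taylor coefficient of the auxiliary polynomial at [x] is [h(x)] times the value
    of [W v k], for [k < M]. Its degree is far smaller than that of the auxiliary
    polynomial, since [h(x)^E] and [x^Q] have been replaced by [c] and [x]. *)
Let W (v : idx -> K) k : {poly K} :=
  \sum_i v i *: (c ^+ i.1.1 *: (('X - (x0 ^+ Q)%:P) ^+ i.1.2 * (V i)`_k)).

Lemma inner_size_V i : inner_size_le (i.2 + M * size h) (V i).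
Proof.
apply: inner_size_leM.
  apply: (@inner_size_leW _ (i.2 * 1)); first by rewrite muln1.
  apply: inner_size_leX; apply: inner_size_leD.
    by apply: inner_size_leC; rewrite size_polyX.
  exact: inner_size_leXvar.
apply: inner_size_le_sum => k; apply: inner_size_leMn.
have hX := size_poly_exp_leq h (M.-1 - k).
apply: (@inner_size_leW _ ((M.-1 - k) * size h + k * (0 + size h))).
  by rewrite add0n -mulnDl leq_mul2r; have := ltn_ord k; lia.
apply: inner_size_leM; last first.
  apply: inner_size_leX; apply: inner_size_leM; first exact: inner_size_leXvar.
  exact: inner_size_taylor_tail.
apply: inner_size_leC; apply: (leq_trans hX).
by rewrite ltnS mulnC leq_mul2l leq_pred orbT.
Qed.

Lemma stepanov_poly_vanish v x : x ^+ Q = x -> h.[x] ^+ E = c ->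
  (forall k, (k < M)%N -> W v k = 0) -> ('X - x%:P) ^+ M %| stepanov_poly v.
Proof.
move=> xQ hc W0.
suff : 'X^M %| stepanov_poly v \Po (x%:P + 'X).
  move=> /(dvdp_comp_poly ('X - x%:P)).
  by rewrite [x%:P + 'X]addrC comp_polyXaddC_K rmorphXn /= comp_polyX.
pose ev := map_poly (horner_eval x) : {poly {poly K}} -> {poly K}.
pose T i := (x%:P + 'X) ^+ i.2 * ((h.[x] ^+ (i.1.1 * E).+1)%:P *
   \sum_(k < M) ((h.[x] ^+ (M.-1 - k))%:P * ('X * ev (taylor_tail h)) ^+ k
      *+ 'C(M + i.1.1 * E, k))) * ((x - x0 ^+ Q)%:P) ^+ i.1.2.
have evV i : ev (V i) = (x%:P + 'X) ^+ i.2 * \sum_(k < M)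
   ((h.[x] ^+ (M.-1 - k))%:P * ('X * ev (taylor_tail h)) ^+ k *+ 'C(M + i.1.1 * E, k)).
  rewrite /ev /V rmorphM rmorphXn rmorphD rmorph_sum /= map_polyC map_polyX /=.
  rewrite {1}/horner_eval hornerX; congr (_ * _); apply: eq_bigr => k _.
  rewrite rmorphMn rmorphM !rmorphXn rmorphM /= map_polyC map_polyX.
  by [].
have -> : stepanov_poly v \Po (x%:P + 'X) =
  \sum_i v i *: ((x%:P + 'X) ^+ i.2 * (h \Po (x%:P + 'X)) ^+ (M + i.1.1 * E) *
     (('X ^+ Q + (x - x0 ^+ Q)%:P)) ^+ i.1.2).
  rewrite rmorph_sum /=; apply: eq_bigr => i _.
  rewrite comp_polyZ !rmorphM !rmorphXn /= rmorphB /= !comp_polyX comp_polyC.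
  congr (_ *: (_ * _ ^+ _)).
  rewrite addrAC addrC -polyCB frobenius_polyD // -polyC_exp; congr (_ + _%:P).
  by rewrite exprDn_pchar // exprNn_pchar // xQ.
suff [D1 D2] : 'X^M %| \sum_i v i *: T i /\ forall i, 'X^M %| 
   ((x%:P + 'X) ^+ i.2 * (h \Po (x%:P + 'X)) ^+ (M + i.1.1 * E) *
     (('X ^+ Q + (x - x0 ^+ Q)%:P)) ^+ i.1.2) - T i.
  set S := (X in _ %| X).
  have -> : S = \sum_i v i *: T i + (S - \sum_i v i *: T i) by ring.
  rewrite dvdp_add // /S -sumrB.
  elim/big_rec: _ => [|i P _ IH]; rewrite ?dvdp0 // dvdp_add //.
  by rewrite -scalerBr -mul_polyC dvdp_mull.
split=> [|i]; last first.
  apply: dvdp_subM; last first.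
    by apply: dvdp_subX; rewrite addrK dvdp_exp2l.
  apply: dvdp_subM; first by rewrite subrr dvdp0.
  by rewrite comp_poly_taylor; exact: binomial_truncation.
apply: dvdp_Xn_coef => k kM.
have -> : \sum_i v i *: T i = h.[x] *: \sum_i v i *: (c ^+ i.1.1 *:
     (((x - x0 ^+ Q) ^+ i.1.2)%:P * ev (V i))).
  rewrite scaler_sumr; apply: eq_bigr => i _; rewrite evV /T.
  have -> : h.[x] ^+ (i.1.1 * E).+1 = c ^+ i.1.1 * h.[x] by rewrite exprSr mulnC exprM hc.
  by rewrite -!mul_polyC !polyCM !polyC_exp; ring.
rewrite coefZ coef_sum.
have -> : \sum_i (v i *: (c ^+ i.1.1 *: (((x - x0 ^+ Q) ^+ i.1.2)%:P * ev (V i))))`_k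
   = (W v k).[x].
  rewrite /W -horner_evalE rmorph_sum /=; apply: eq_bigr => i _.
  rewrite /horner_eval !hornerE !coefZ coefCM coef_map /= /horner_eval.
  by rewrite !mulrA.
by rewrite W0 // horner0 mulr0.
Qed.

Lemma size_W v k : (size (W v k) <= B + J + M * size h)%N.
Proof.
apply: (leq_trans (size_sum _ _ _)); apply/bigmax_leqP => i _.
apply: (leq_trans (size_scale_leq _ _)); apply: (leq_trans (size_scale_leq _ _)).
apply: (leq_trans (size_polyMleq _ _)); rewrite size_exp_XsubC.
have := inner_size_V i k; have := ltn_ord i.2; have := ltn_ord i.1.2.
move: (size ((V i)`_k)%R) (M * size h)%N (nat_of_ord i.1.2) (nat_of_ord i.2).
move=> a b x y; lia.
Qed.

(** The coefficients of all [W v k] with [k < M] are linear forms in [v], and the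
    assumption is that there are fewer of them than unknowns. *)
Lemma exists_vanishing_coefficients :
  (M * (B + J + M * size h) < d * J * B)%N ->
  exists2 v : idx -> K, exists i, v i != 0 & forall k, (k < M)%N -> W v k = 0.
Proof.
move=> lt; pose D := (B + J + M * size h)%N.
have [|v vn0 vA] := @underdetermined_system K idx ('I_M * 'I_D)%type
  (fun i ke => (c ^+ i.1.1 *: (('X - (x0 ^+ Q)%:P) ^+ i.1.2 * (V i)`_ke.1))`_ke.2).
  by rewrite !card_prod !card_ord.
exists v => // k kM; apply/polyP => e; rewrite coef0.
have [le_e | lt_e] := leqP D e.
  by rewrite nth_default // (leq_trans (size_W _ _)).
rewrite coef_sum -[RHS](vA (Ordinal kM, Ordinal lt_e)) /=.
by apply: eq_bigr => i _; rewrite coefZ.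
Qed.

(** Raising to the power [Q] is additive, so [Y = h^E] satisfies [h Y^r = h^Q =
    h(x0)^Q] modulo [(X - x0)^Q]. By the independence of the powers of [Y] below [d],
    a digit that is divisible by [(X - x0)^Q] is zero, and the digits are recovered
    one after another. *)
Lemma stepanov_poly_neq0 v : (exists i, v i != 0) -> stepanov_poly v != 0.
Proof.
case=> -[[l0 j0] b0] v0; apply: contra_neqN v0 => R0.
have h_neq0 : h != 0 by apply: contraNneq hx0 => ->; rewrite horner0.
(* The coefficients [v] are extended by 0 to arguments that are natural numbers. *)
pose co l j b := if insub l is Some l' then if insub j is Some j' then
  if insub b is Some b' then v (l', j', b') else 0 else 0 else 0.
pose G j : {poly {poly K}} := \poly_(l < d) \poly_(b < B) co l j b.
pose U := ('X - x0%:P) ^+ Q.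
have U0 : U != 0 by rewrite expf_neq0 // polyXsubC_eq0.
have US j : U %| (G j).[h ^+ E] -> G j = 0.
  move=> UG; apply: (@kummer_nonvanishing _ h U (h ^+ E) (h.[x0] ^+ Q) r d B.-1) => //.
  - exact: expf_neq0.
  - exact: size_poly.
  - move=> l; rewrite coef_poly prednK //; case: ifP => _; last by rewrite size_poly0.
    exact: size_poly.
  - rewrite -exprM mulnC -exprS rE polyC_exp -frobenius_polyB //.
    by rewrite dvdp_exp2r // dvdp_XsubCl /root !hornerE subrr.
  - by rewrite size_exp_XsubC.
have sum0 : \sum_(j < J) (G j).[h ^+ E] * U ^+ j = 0.
  have : h ^+ M * \sum_(j < J) (G j).[h ^+ E] * U ^+ j = stepanov_poly v.
    pose t l j b := v (l, j, b) *: ('X ^+ b * h ^+ (M + l * E) * U ^+ j).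
    have -> : stepanov_poly v = \sum_i t i.1.1 i.1.2 i.2 by apply: eq_bigr => -[[]].
    rewrite -(pair_bigA _ (fun lj b => t lj.1 lj.2 b)) /=.
    rewrite -(pair_bigA _ (fun l j => \sum_b t l j b)) /= exchange_big mulr_sumr.
    apply: eq_bigr => j _; rewrite horner_poly mulr_suml mulr_sumr.
    apply: eq_bigr => l _; rewrite poly_def !mulr_suml mulr_sumr.
    apply: eq_bigr => b _; rewrite /co /t !valK -!mul_polyC mulnC !exprD exprM.
    ring.
  by rewrite (eqP R0) => /eqP; rewrite mulf_eq0 expf_eq0 (negPf h_neq0) andbF => /eqP.
have G0 : G j0 = 0.
  apply: (US); rewrite (@lowest_coefficient _ J U (fun j => (G j).[h ^+ E]) U0 _ sum0) ?dvdp0 //.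
  move=> j /US ->.
  by rewrite horner0.
have := congr1 (fun P : {poly {poly K}} => (P`_l0)`_b0) G0.
rewrite !coef0 coef_poly ltn_ord coef_poly ltn_ord /co !valK => ->.
by [].
Qed.

Lemma size_stepanov_poly v :
  (size (stepanov_poly v) <= B + (M + d * E) * size h + Q * J)%N.
Proof.
apply: (leq_trans (size_sum _ _ _)); apply/bigmax_leqP => i _.
apply: (leq_trans (size_scale_leq _ _)).
apply: (leq_trans (size_polyMleq _ _)).
have s1 := size_polyMleq ('X^(i.2) : {poly K}) (h ^+ (M + i.1.1 * E)).
rewrite size_polyXn in s1.
have s2 := size_poly_exp_leq h (M + i.1.1 * E).
have s3 : ((size h).-1 * (M + i.1.1 * E) <= (M + d * E) * size h)%N.
  rewrite mulnC leq_mul ?leq_pred // leq_add2l leq_mul2r.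
  by rewrite (ltnW (ltn_ord i.1.1)) orbT.
have s4 : (Q * i.1.2 <= Q * J)%N by rewrite leq_mul2l (ltnW (ltn_ord i.1.2)) orbT.
rewrite -exprM size_exp_XsubC.
have := ltn_ord i.2; move: s1 s2 s3 s4.
move: (size ('X^(i.2) * _)) (size (h ^+ _)) ((size h).-1 * _)%N (_ * size h)%N.
move: (Q * _)%N (Q * _)%N (nat_of_ord i.2) => a b x e f g k; lia.
Qed.

Lemma exists_auxiliary_poly :
  (M * (B + J + M * size h) < d * J * B)%N ->
  exists R : {poly K}, [/\ R != 0, (size R <= B + (M + d * E) * size h + Q * J)%N &
    forall x, x ^+ Q = x -> h.[x] ^+ E = c -> ('X - x%:P) ^+ M %| R].
Proof.
move=> /exists_vanishing_coefficients[v vn0 vW]; exists (stepanov_poly v).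
split=> [||x xQ hc]; [exact: stepanov_poly_neq0 | exact: size_stepanov_poly |].
exact: stepanov_poly_vanish vW.
Qed.

End StepanovPolynomial.

(** Comparing the degree of the auxiliary polynomial with its number of zeros, for [M
    = d J - s] and [J^2 = Q], and dividing by [J]. *)
Lemma stepanov_arithmetic J Q d m s N M E B :
  Q = (J * J)%N -> (0 < J)%N -> (s < d * J)%N -> M = (d * J - s)%N ->
  (E <= Q)%N -> (B <= Q)%N -> (N <= Q)%N ->
  (M * N < B + (M + d * E) * m + Q * J)%N ->
  (d * N <= Q + (d * s + (1 + 2 * (d * m)) + s) * J)%N.
Proof.
move=> QJ J0 sdJ MdJ EQ BQ NQ lt.
have JQ : (J <= Q)%N by rewrite QJ leq_pmulr.
have b1 : ((M + d * E) * m <= 2 * (d * m) * Q)%N.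
  have -> : (2 * (d * m) * Q = (d * Q + d * Q) * m)%N by rewrite mulSn mul1n !mulnDl; lia.
  rewrite leq_mul2r leq_add ?orbT //; last by rewrite leq_mul2l EQ orbT.
  by rewrite MdJ; apply: leq_trans (leq_subr _ _) _; rewrite leq_mul2l JQ orbT.
have b2 : (s * N <= s * Q)%N by rewrite leq_mul2l NQ orbT.
rewrite -(leq_pmul2l J0).
have e1 : (J * (d * N) = M * N + s * N)%N.
  by rewrite -mulnDl MdJ subnK 1?ltnW // mulnA [(J * d)%N]mulnC.
have -> : (J * (Q + (d * s + (1 + 2 * (d * m)) + s) * J) =
   Q * J + d * s * Q + Q + 2 * (d * m) * Q + s * Q)%N.
  rewrite mulnDr mulnCA -QJ [(J * Q)%N]mulnC !mulnDl mul1n; lia.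
rewrite e1; move: lt b1 b2 BQ.
move: (M * N)%N ((M + _) * m)%N (Q * J)%N (s * N)%N (s * Q)%N.
move: (2 * (d * m) * Q)%N (d * s * Q)%N => *; lia.
Qed.

(** Optimising the parameters of the auxiliary polynomial. Among the [Q = J^2] fixed
    points, a given value of [h^E] occurs at most [Q / d + O (J)] times, with a
    constant independent of [nu]. The order of vanishing is [d J - s]; the loss [s]
    makes the linear system underdetermined for every [nu]. *)
Theorem stepanov_count (K : fieldType) (h : {poly K}) (x0 c : K)
    (r d E nu : nat) (X : seq K) (Q := (r.+1 ^ nu * r.+1 ^ nu)%N)
    (s := (r.+1 * d * (1 + d * size h) + 1 + d * size h)%N) :
  [pchar K].-nat r.+1 -> (0 < r)%N -> (0 < nu)%N -> (0 < d)%N ->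
  (r * E).+1 = Q -> h.[x0] != 0 ->
  (forall m, (0 < m < d)%N -> exists b, ~~ (r %| m * mup b h)%N) ->
  uniq X -> (forall x, x \in X -> x ^+ Q = x /\ h.[x] ^+ E = c) ->
  (d * size X <= Q + (d * s + (1 + 2 * (d * size h)) + s) * r.+1 ^ nu)%N.
Proof.
move=> rchar r0 nu0 d0 rE hx0 kum uX XP.
set J := (r.+1 ^ nu)%N in Q XP rE *; set m := size h in s *.
have J0 : (0 < J)%N by rewrite expn_gt0.
have Q1 : (1 < Q)%N by rewrite /Q /J -(prednK nu0) expnS; nia.
have Qchar : [pchar K].-nat Q by rewrite /Q pnatM /J pnatX rchar.
have XQ : (size X <= Q)%N.
  have szP : size ('X^Q - 'X : {poly K}) = Q.+1.
    by rewrite size_polyDl ?size_polyXn // size_polyN size_polyX.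
  rewrite -ltnS -szP; apply: max_poly_roots uX.
    by rewrite -size_poly_gt0 szP.
  apply/allP => x /XP[xQ _].
  by rewrite /root !hornerE xQ subrr.
have [Js | sJ] := leqP J s.
  have : (d * size X <= d * (s * J))%N by rewrite leq_mul2l (leq_trans XQ) ?leq_mul2r ?Js !orbT.
  by nia.
(* The number [B] of powers of [X] is [Q / q], so that the degree of the resultant in
   the nonvanishing argument, about [r * B], stays below [Q]. *)
pose J' := (r.+1 ^ nu.-1)%N; have JE : J = (r.+1 * J')%N by rewrite -expnS prednK.
have J'0 : (0 < J')%N by rewrite expn_gt0.
pose B := (J * J')%N; have QB : Q = (r.+1 * B)%N by rewrite /Q {2}JE /B; nia.
have JB : (J <= B)%N by rewrite leq_pmulr.
pose M := (d * J - s)%N.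
have sdJ : (s < d * J)%N by apply: leq_trans sJ _; rewrite leq_pmull.
have M0 : (0 < M)%N by rewrite subn_gt0.
have dJ : (d <= J)%N by apply: leq_trans (ltnW sJ); rewrite /s; nia.
have MdJ : (M <= d * J)%N by rewrite leq_subr.
have MQ : (M <= Q)%N by apply: leq_trans MdJ _; rewrite leq_mul2r dJ orbT.
have B0 : (0 < B)%N by rewrite muln_gt0 J0.
have Bsmall : (d * m + r * B.-1 < Q)%N.
  have : (d * m < J)%N by apply: leq_trans sJ; rewrite /s ltnS leq_addl.
  have : (r * B.-1 <= r * B)%N by rewrite leq_mul2l leq_pred orbT.
  by rewrite QB mulSn; move: JB; lia.
have big : (M * (B + J + M * m) < d * J * B)%N.
  have e1 : (M * (J + M * m) <= d * J * (J + d * J * m))%N.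
    by rewrite leq_mul // leq_add2l leq_mul2r MdJ orbT.
  have e2 : (d * J * (J + d * J * m) = d * (1 + d * m) * r.+1 * B)%N.
    have -> : (d * (1 + d * m) * r.+1 * B = d * (1 + d * m) * Q)%N by rewrite QB; ring.
    by rewrite /Q; ring.
  have e3 : (d * (1 + d * m) * r.+1 * B < s * B)%N.
    by rewrite ltn_mul2r B0 /s [(_ * r.+1)%N]mulnC [(r.+1 * _)%N]mulnA -addnA
      -[X in (X < _)%N]addn0 ltn_add2l.
  have e4 : (M * B + s * B = d * J * B)%N by rewrite -mulnDl subnK // ltnW.
  rewrite -addnA mulnDr; lia.
have [R [R0 szR Rx]] := @exists_auxiliary_poly K h x0 c r d E J B M Q
  Qchar rE hx0 r0 kum M0 MQ Bsmall J0 B0 big.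
have lt : (M * size X < size R)%N.
  by apply: size_leq_of_high_multiplicity => // x /XP[xQ hc]; exact: Rx.
move: lt => /leq_trans /(_ szR) lt.
have EQ : (E <= Q)%N by rewrite -rE; apply: leqW; rewrite leq_pmull.
have BQ : (B <= Q)%N by rewrite QB leq_pmull.
exact: (@stepanov_arithmetic J Q d m s (size X) M E B).
Qed.

(** * A finite field inside an algebraically closed field *)

Lemma frobenius_rmorphism (R : comNzRingType) Q : [pchar R].-nat Q ->
  exists phi : {rmorphism R -> R}, forall x, phi x = x ^+ Q.
Proof.
(* The hypothesis means that [Q] is 1 or a power of the characteristic. *)
move=> Qchar; have [Q1 | Q1] := leqP Q 1.
  exists idfun => x /=; have -> : Q = 1%N by case: Q Qchar Q1 => [|[]].
  by rewrite expr1.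
have pcharRp : pdiv Q \in [pchar R] by rewrite (pnatPpi Qchar) ?pi_pdiv.
have /p_natP[e ->] : (pdiv Q).-nat Q by rewrite -(eq_pnat _ (pcharf_eq pcharRp)).
elim: e => [|e [phi phiE]]; first by exists idfun => x; rewrite expn0 expr1.
exists (phi \o pFrobenius_aut pcharRp) => x /=.
by rewrite phiE pFrobenius_autE -exprM expnS.
Qed.

Lemma card_finField_pnat (F : finFieldType) : [pchar F].-nat #|F|.
Proof.
have [p p_pr pcharFp] := finPcharP F.
rewrite (eq_pnat _ (pcharf_eq pcharFp)).
have := pprimeChar_pgroup pcharFp; rewrite /pgroup cardsT.
by [].
Qed.

Section ClosedOverFinite.
Variables (F : finFieldType) (K : closedFieldType) (iota : {rmorphism F -> K}).
Notation q := #|F|.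
Notation r := (#|F|.-1).

Lemma card_gt1 : (1 < q)%N. Proof. exact: finNzRing_gt1. Qed.

Lemma card_exp_gt1 j : (0 < j)%N -> (1 < q ^ j)%N.
Proof. by move=> j0; rewrite -{1}(exp1n j) ltn_exp2r // card_gt1. Qed.

Lemma card_r : r.+1 = q. Proof. by rewrite prednK // ltnW // card_gt1. Qed.

Lemma r_gt0 : (0 < r)%N. Proof. by have := card_gt1; case: q => [|[]]. Qed.

Lemma closure_pnat : [pchar K].-nat q.
Proof.
by rewrite (eq_pnat _ (fmorph_pchar iota)) card_finField_pnat.
Qed.

Lemma closure_pnatX j : [pchar K].-nat (q ^ j)%N.
Proof. by rewrite pnatX closure_pnat. Qed.


Lemma image_of_fixed y : y ^+ q = y -> exists a, y = iota a.
Proof.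
move=> yq; have := congr1 (fun p => (map_poly iota p).[y]) (finField_genPoly F).
rewrite rmorphB rmorphXn rmorph_prod /= map_polyX !hornerE yq subrr horner_prod.
move=> /esym/eqP; rewrite prodf_seq_eq0 => /hasP[a _].
rewrite rmorphB /= map_polyX map_polyC hornerXsubC subr_eq0 => /eqP ->.
by exists a.
Qed.

Lemma iota_fixed a : iota a ^+ q = iota a.
Proof. by rewrite -rmorphXn /= expf_card. Qed.

Lemma poly_of_fixed (g : {poly K}) : (forall i, g`_i ^+ q = g`_i) ->
  exists g0 : {poly F}, g = map_poly iota g0.
Proof.
elim/poly_ind: g => [|g c IH] gq; first by exists 0; rewrite rmorph0.
have [i|g0 Dg] := IH.
  by have := gq i.+1; rewrite coefD coefMX coefC /= addr0.
have [|a Dc] := image_of_fixed (y := c).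
  by have := gq 0%N; rewrite coefD coefMX coefC /= add0r.
by exists (g0 * 'X + a%:P); rewrite rmorphD rmorphM /= map_polyX map_polyC Dg Dc.
Qed.

(** The elements of [K] fixed by the [q^j]-power map, that is, the field with [q^j]
    elements, as the list of the roots of [X^(q^j) - X]. *)
Definition fixs j : seq K := sval (closed_field_poly_normal ('X^(q ^ j) - 'X : {poly K})).

Lemma prod_fixs j : (0 < j)%N -> 'X^(q ^ j) - 'X = \prod_(x <- fixs j) ('X - x%:P).
Proof.
move=> j0; rewrite /fixs; case: closed_field_poly_normal => rs /= {1}->.
have lt1 := card_exp_gt1 j0.
rewrite (monicP _) ?scale1r // monicE lead_coefDl ?lead_coefXn //.
by rewrite size_polyN size_polyX size_polyXn.
Qed.

Lemma mem_fixs j x : (0 < j)%N -> (x \in fixs j) = (x ^+ (q ^ j) == x).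
Proof.
move=> j0; rewrite -root_prod_XsubC -prod_fixs // /root !hornerE.
by rewrite subr_eq0.
Qed.

Lemma fixsP j x : (0 < j)%N -> x \in fixs j -> x ^+ (q ^ j) = x.
Proof. by move=> j0; rewrite mem_fixs // => /eqP. Qed.

Lemma uniq_fixs j : (0 < j)%N -> uniq (fixs j).
Proof.
move=> j0; rewrite -separable_prod_XsubC -prod_fixs // unlock derivB derivXn derivX
  -mulr_natr -polyC_natr.
have -> : (q ^ j)%:R = 0 :> K.
  have [p p_pr pF] := finPcharP F.
  have pK : p \in [pchar K] by rewrite (fmorph_pchar iota).
  apply/eqP; rewrite -(dvdn_pcharf pK).
  have := closure_pnatX j; rewrite (eq_pnat _ (pcharf_eq pK)) => /p_natP[[|e] Dq].
    by have := card_gt1; rewrite -(ltn_exp2r _ _ j0) exp1n Dq.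
  by rewrite Dq expnS dvdn_mulr.
by rewrite mulr0 sub0r -[X in coprimep _ X]scaleN1r coprimepZr ?oppr_eq0 ?oner_eq0 // coprimep1.
Qed.

Lemma size_fixs j : (0 < j)%N -> size (fixs j) = (q ^ j)%N.
Proof.
move=> j0; have := congr1 (fun p : {poly K} => size p) (prod_fixs j0).
rewrite size_prod_XsubC size_polyDl ?size_polyXn; first by case.
by rewrite size_polyN size_polyX ltnS card_exp_gt1.
Qed.

Lemma perm_fixs1 : perm_eq (fixs 1) (map iota (enum F)).
Proof.
rewrite perm_sym; apply: uniq_perm => [||x].
- by rewrite map_inj_uniq ?enum_uniq //; exact: fmorph_inj.
- exact: uniq_fixs.
rewrite mem_fixs // expn1; apply/mapP/eqP => [[a _ ->]|/image_of_fixed[a ->]].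
  exact: iota_fixed.
by exists a; rewrite ?mem_enum.
Qed.

End ClosedOverFinite.

(** * Multiplicative characters and twisted sums *)

Section DiscreteLogCharacter.
Variables (K : fieldType) (r : nat) (z : K) (w : algC).
Hypotheses (r0 : (0 < r)%N) (prim_z : r.-primitive_root z) (prim_w : r.-primitive_root w).

(** The multiplicative character of the group of [r]-th roots of unity in [K] that
    sends the generator [z] to [w]. It is defined on all of [K], by 0 elsewhere, so
    that norms and values of polynomials need no casts to a smaller type. *)
Definition chi (y : K) : algC := if [pick i : 'I_r | y == z ^+ i] is Some i then w ^+ i else 0.

Lemma chi_zX i : chi (z ^+ i) = w ^+ i.
Proof.
rewrite /chi; case: pickP => [j|/(_ (Ordinal (ltn_pmod i r0)))].
  by rewrite (eq_prim_root_expr prim_z) -(eq_prim_root_expr prim_w) => /eqP.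
by rewrite /= (prim_expr_mod prim_z) eqxx.
Qed.

Lemma unity_root_z y : y ^+ r = 1 -> exists i, y = z ^+ i.
Proof. by case/(prim_rootP prim_z) => i ->; exists i. Qed.

Lemma chi0 : chi 0 = 0.
Proof.
rewrite /chi; case: pickP => // i; rewrite eq_sym expf_eq0 (prim_root_eq0 prim_z).
by rewrite eqn0Ngt r0 andbF.
Qed.

Lemma chi1 : chi 1 = 1.
Proof. by rewrite -(expr0 z) chi_zX expr0. Qed.

Lemma chiM y y' : y ^+ r.+1 = y -> y' ^+ r.+1 = y' -> chi (y * y') = chi y * chi y'.
Proof.
have [-> _ _|y0] := eqVneq y 0; first by rewrite mul0r chi0 mul0r.
have [-> _ _|y'0] := eqVneq y' 0; first by rewrite mulr0 chi0 mulr0.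
have unit_r (x : K) : x != 0 -> x ^+ r.+1 = x -> x ^+ r = 1.
  by move=> x0 xr; apply: (mulfI x0); rewrite -exprS xr mulr1.
move=> /(unit_r _ y0)/unity_root_z[i ->] /(unit_r _ y'0)/unity_root_z[j ->].
by rewrite -exprD !chi_zX exprD.
Qed.

Lemma chiX y n : y ^+ r.+1 = y -> chi (y ^+ n) = chi y ^+ n.
Proof.
move=> yr; elim: n => [|n IH]; first by rewrite !expr0 chi1.
by rewrite exprS chiM //; [rewrite IH exprS | rewrite -exprM mulnC exprM yr].
Qed.

Lemma chi_norm y : y ^+ r = 1 -> `|chi y| = 1.
Proof.
move=> /unity_root_z[i ->]; rewrite chi_zX normrX.
apply/eqP; rewrite -(@pexpr_eq1 _ _ r) ?exprn_ge0 ?normr_ge0 //.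
by rewrite -exprM mulnC exprM -normrX (prim_expr_order prim_w) normr1 expr1n.
Qed.

Lemma chi_eq1 y : y ^+ r = 1 -> chi y = 1 -> y = 1.
Proof.
move=> /unity_root_z[i ->]; rewrite chi_zX => /eqP; rewrite -(prim_order_dvd prim_w).
by rewrite (prim_order_dvd prim_z) => /eqP.
Qed.

Lemma chi_primitive d y : d.-primitive_root y -> y ^+ r = 1 -> d.-primitive_root (chi y).
Proof.
move=> prim_y yr; have yr1 : y ^+ r.+1 = y by rewrite exprS yr mulr1.
apply/andP; split; first exact: prim_order_gt0 prim_y.
apply/forallP=> i; apply/eqP; rewrite unity_rootE -chiX //.
have yir : (y ^+ i.+1) ^+ r = 1 by rewrite -exprM mulnC exprM yr expr1n.
have [iN|iN] := eqVneq i.+1 d.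
  by rewrite iN (prim_expr_order prim_y) chi1 eqxx.
apply/negbTE/negP => e; have /eqP := chi_eq1 yir (eqP e).
rewrite -(prim_order_dvd prim_y) => /dvdn_leq - /(_ isT) le.
by case/negP: iN; rewrite eqn_leq le ltn_ord.
Qed.

End DiscreteLogCharacter.

Lemma sum_prim_root_expr (C : idomainType) d (t : C) : (1 < d)%N -> d.-primitive_root t ->
  \sum_(i < d) t ^+ i = 0.
Proof.
move=> d1 prim_t; have t1 : t - 1 != 0.
  rewrite subr_eq0; apply: contraTneq d1 => t1.
  rewrite -leqNgt dvdn_leq // (prim_order_dvd prim_t) t1 expr1n //.
by apply: (mulfI t1); rewrite -subrX1 (prim_expr_order prim_t) subrr mulr0.
Qed.

(** Since the powers of [t] add up to 0, the counts [N i] may be replaced by their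
    deviations from the mean [Q / d]. An upper bound for each count together with a
    lower bound for the total controls the sum of the absolute values of the
    deviations. *)
Lemma twisted_sum_small d (t : algC) (N : 'I_d -> nat) (Q a b : nat) :
  (1 < d)%N -> d.-primitive_root t -> (forall i, d * N i <= Q + a)%N ->
  (Q <= \sum_i N i + b)%N ->
  `|\sum_(i < d) t ^+ i * (N i)%:R| <= (2 * a + b)%:R.
Proof.
move=> d1 prim_t Na Nb; have d0 : (0 < d)%N by exact: ltnW.
have t1 i : `|t ^+ i| = 1.
  apply/eqP; rewrite -(@pexpr_eq1 _ _ d) ?normr_ge0 //.
  by rewrite -normrX -exprM mulnC exprM (prim_expr_order prim_t) expr1n normr1.
have -> : \sum_(i < d) t ^+ i * (N i)%:R =
    d%:R^-1 * \sum_(i < d) t ^+ i * ((d * N i)%:R - Q%:R).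
  under [in RHS]eq_bigr do rewrite mulrBr natrM.
  rewrite sumrB -mulr_suml sum_prim_root_expr // mul0r subr0 mulr_sumr.
  apply: eq_bigr => i _; rewrite [RHS]mulrCA; congr (_ * _).
  by rewrite mulKf // pnatr_eq0 -lt0n.
rewrite normrM normfV normr_nat ler_pdivrMl ?ltr0n //.
apply: (le_trans (ler_norm_sum _ _ _)).
apply: (@le_trans _ _ (\sum_(i < d) ((2 * a + Q)%:R - (d * N i)%:R))).
  apply: ler_sum => i _; rewrite normrM t1 mul1r.
  have := Na i; have [le|lt] := leqP Q (d * N i).
    rewrite -natrB // normr_nat => le2; rewrite lerBrDr -natrD ler_nat; lia.
  have -> : `|(d * N i)%:R - Q%:R| = (Q - d * N i)%:R :> algC.
    by rewrite distrC natrB 1?ltnW // ger0_norm // subr_ge0 ler_nat ltnW.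
  move=> le2; rewrite lerBrDr -natrD ler_nat; lia.
rewrite sumrB sumr_const card_ord -natr_sum -big_distrr /= lerBlDr -natrM -natrD.
rewrite -mulrnA ler_nat mulnC -mulnDr leq_mul2l; apply/orP; right.
by move: Nb; move: (\sum_i N i)%N => S; lia.
Qed.

(** * Character sums over extensions by Stepanov's method *)

(** The least positive [d] such that [h^d] is, up to a constant, an [r]-th power. It
    divides [r] because the set of these exponents is closed under remainders. *)
Lemma kummer_order (K : closedFieldType) (h : {poly K}) r b : h != 0 ->
  (0 < r)%N -> ~~ (r %| mup b h)%N ->
  exists d, [/\ (1 < d)%N, (d %| r)%N, forall b, (r %| d * mup b h)%N &
    forall m, (0 < m < d)%N -> exists b, ~~ (r %| m * mup b h)%N].
Proof.
move=> h0 r0 rb; have [rs Dh] := closed_field_poly_normal h.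
pose P d := (0 < d)%N && all (fun b => r %| d * mup b h)%N rs.
have PP d : (0 < d)%N -> reflect (forall b, r %| d * mup b h)%N (P d).
  move=> d0; rewrite /P d0; apply: (iffP allP) => rd b' //.
  have [/rd //|b'rs] := boolP (b' \in rs).
  rewrite mupNroot ?muln0 ?dvdn0 //.
  by rewrite Dh rootZ ?lead_coef_eq0 // root_prod_XsubC.
have exP : exists d, P d by exists r; apply/(PP r r0) => b'; exact: dvdn_mulr.
case: (ex_minnP exP) => d Pd min_d; have d0 : (0 < d)%N by case/andP: Pd.
have rd := elimT (PP d d0) Pd.
have minP m : (0 < m < d)%N -> exists b, ~~ (r %| m * mup b h)%N.
  case/andP=> m0 md; have : ~~ P m by apply/negP => /min_d; rewrite leqNgt md.
  by rewrite /P m0 /= => /allPn[b' _]; exists b'.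
exists d; split=> //.
  rewrite ltn_neqAle d0 andbT; apply: contraNneq rb => d1.
  by have := rd b; rewrite -d1 mul1n.
rewrite /dvdn -leqn0 leqNgt; apply/negP => rd0.
have [|b'] := minP (r %% d)%N; first by rewrite rd0 ltn_pmod.
apply/negP/negPn.
have := dvdn_mulr (mup b' h) (dvdnn r); rewrite {2}(divn_eq r d) mulnDl.
by rewrite dvdn_addr // -mulnA dvdn_mull.
Qed.

Section StepanovSum.
Variables (F : finFieldType) (K : closedFieldType) (iota : {rmorphism F -> K}).
Notation q := #|F|.
Notation r := (#|F|.-1).
Variables (z : K) (w : algC).
Hypotheses (prim_z : r.-primitive_root z) (prim_w : r.-primitive_root w).
Notation chi := (chi r z w).
Notation fixs := (fixs F K).

(** The exponent of the norm map [y |-> y^(1 + q + ... + q^(j-1))] from the field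
    with [q^j] elements to the one with [q] elements. *)
Definition norm_exp j := (\sum_(i < j) q ^ i)%N.

Lemma norm_expE j : (r * norm_exp j).+1 = (q ^ j)%N.
Proof. by rewrite -predn_exp prednK // expn_gt0 ltnW // card_gt1. Qed.

Lemma horner_frobenius (h0 : {poly F}) x :
  (map_poly iota h0).[x] ^+ q = (map_poly iota h0).[x ^+ q].
Proof.
have [phi phiE] := frobenius_rmorphism (closure_pnat iota).
rewrite -!phiE -horner_map; congr (_.[_]).
apply/polyP=> i; rewrite !coef_map /= phiE iota_fixed //.
Qed.

Lemma horner_frobeniusX (h0 : {poly F}) j x :
  (map_poly iota h0).[x] ^+ (q ^ j) = (map_poly iota h0).[x ^+ (q ^ j)].
Proof.
elim: j => [|j IH]; first by rewrite !expr1.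
by rewrite expnSr exprM IH horner_frobenius -exprM.
Qed.

(** A monic [n]-th root over the closure is unique, hence fixed by Frobenius, hence
    rational. *)
Lemma monic_root_rational (W : {poly K}) (g0 : {poly F}) n c :
  (0 < n)%N -> W \is monic -> c != 0 -> map_poly iota g0 = c *: W ^+ n ->
  exists W0, W = map_poly iota W0.
Proof.
move=> n0 mW c0 e.
have [phi phiE] := frobenius_rmorphism (closure_pnat iota).
have phig : map_poly phi (map_poly iota g0) = map_poly iota g0.
  by apply/polyP=> i; rewrite !coef_map /= phiE iota_fixed.
have ce : c = lead_coef (map_poly iota g0).
  by rewrite e lead_coefZ (monicP _) ?mulr1 // monic_exp.
have phic : phi c = c by rewrite ce -lead_coef_map phig.
have phiW : map_poly phi W = W.
  apply: (monic_exp_inj n0) => //; first exact: monic_map.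
  apply: (scalerI c0); rewrite -e -[in RHS]phig e map_polyZ /= phic rmorphXn //.
by apply: poly_of_fixed => i; rewrite -phiE -coef_map phiW.
Qed.

(** The [d]-th power of [h] is [l W^r] with [W] rational, and the norm of [W(x)] is
    an [r]-th root of unity. Hence the nonzero norms of [h(x)] have the same [d]-th
    power, so they lie in one coset of the [d]-th roots of unity. The counting bound
    applies to each element of the coset, and the twisted sum of nearly equal counts
    is small. *)
Theorem stepanov_char_sum (h0 : {poly F}) (h := map_poly iota h0) b :
  h0 != 0 -> ~~ (r %| mup b h)%N ->
  exists C : nat, forall nu, (0 < nu)%N ->
    `|\sum_(x <- fixs (nu + nu)) chi (h.[x] ^+ norm_exp (nu + nu))| <= (C * q ^ nu)%:R.
Proof.
move=> h00 rb; have r0 : (0 < r)%N := r_gt0 F.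
have hn0 : h != 0 by rewrite map_poly_eq0.
have [d [d1 dr rd kum]] := kummer_order hn0 r0 rb.
have d0 : (0 < d)%N := ltnW d1.
have /closed_nonrootP[x0 hx0] := hn0.
pose m := size h; pose s := (q * d * (1 + d * m) + 1 + d * m)%N.
pose C0 := (d * s + (1 + 2 * (d * m)) + s)%N.
have [|b'|W mW DhW] := @root_extraction K (h ^+ d) r; first exact: expf_neq0.
  by rewrite mupX.
set l := lead_coef _ in DhW.
have l0 : l != 0 by rewrite lead_coef_eq0 expf_neq0.
have [W0 DW] : exists W0, W = map_poly iota W0.
  by apply: (@monic_root_rational W (h0 ^+ d) r l) => //; rewrite rmorphXn.
exists (2 * C0 + m)%N => nu nu0; set j := (nu + nu)%N; set E := norm_exp j.
have j0 : (0 < j)%N by rewrite addn_gt0 nu0.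
have E0 : (0 < E)%N.
  by rewrite /E /norm_exp -(prednK j0) big_ord_recl /= expn0.
have hfix x : x \in fixs j -> h.[x] ^+ (q ^ j) = h.[x].
  by move=> /(fixsP j0) xj; rewrite horner_frobeniusX xj.
have hE_r x : x \in fixs j -> h.[x] != 0 -> (h.[x] ^+ E) ^+ r = 1.
  move=> /hfix hj hx; rewrite -exprM mulnC; apply: (mulfI hx).
  by rewrite -exprS norm_expE mulr1.
have hE_d x : x \in fixs j -> h.[x] != 0 -> (h.[x] ^+ E) ^+ d = l ^+ E.
  move=> xj hx; rewrite -exprM mulnC exprM -horner_exp DhW hornerZ horner_exp.
  rewrite exprMn -exprM.
  have Wx : W.[x] != 0.
    apply: contraNneq hx => Wx; have := congr1 (horner^~ x) DhW.
    rewrite hornerZ !horner_exp Wx expr0n eqn0Ngt r0 mulr0 => /eqP.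
    by rewrite expf_eq0 => /andP[].
  suff -> : W.[x] ^+ (r * E) = 1 by rewrite mulr1.
  apply: (mulfI Wx); rewrite -exprS norm_expE mulr1 DW horner_frobeniusX.
  by rewrite (fixsP j0 xj).
have [/hasP[x1 x1j hx1] | /hasPn no_x] := boolP (has (fun x => h.[x] != 0) (fixs j)); last first.
  rewrite big1_seq ?normr0 ?ler0n // => x /andP[_ /no_x]; rewrite negbK => /eqP ->.
  by rewrite expr0n eqn0Ngt E0 (chi0 w r0 prim_z).
pose c1 := h.[x1] ^+ E; pose mu := z ^+ (r %/ d).
have c10 : c1 != 0 by rewrite expf_neq0.
have prim_mu : d.-primitive_root mu by exact: dvdn_prim_root.
have mur : mu ^+ r = 1 by rewrite -exprM mulnC exprM (prim_expr_order prim_z) expr1n.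
have c1r : c1 ^+ r = 1 by exact: hE_r.
(* The coset of the [d]-th roots of unity is enumerated by [c1 * mu ^+ i]. *)
pose N i := size [seq x <- fixs j | h.[x] ^+ E == c1 * mu ^+ i].
have Nbound i : (d * N i <= q ^ j + C0 * q ^ nu)%N.
  have := @stepanov_count K h x0 (c1 * mu ^+ i) r d E nu
    [seq x <- fixs j | h.[x] ^+ E == c1 * mu ^+ i].
  rewrite card_r -expnD => H; apply: H => //.
  - exact: closure_pnat iota.
  - by rewrite norm_expE.
  - by rewrite filter_uniq // uniq_fixs.
  by move=> x; rewrite mem_filter => /andP[/eqP xc /(fixsP j0)].
have eqs x : x \in fixs j -> h.[x] != 0 -> exists i : 'I_d, forall k : 'I_d,
    (h.[x] ^+ E == c1 * mu ^+ k) = (k == i).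
  move=> xj hx; have [i Di] : {i : 'I_d | h.[x] ^+ E / c1 = mu ^+ i}.
    apply: (prim_rootP prim_mu); rewrite expr_div_n !hE_d // divff //.
    by rewrite expf_neq0.
  exists i => k; rewrite -(divfK c10 (h.[x] ^+ E)) Di mulrC (inj_eq (mulfI c10)).
  by rewrite (eq_prim_root_expr prim_mu) !modn_small // eq_sym.
have total : (q ^ j <= \sum_(i < d) N i + m)%N.
  rewrite -(@size_fixs F K j j0) -(count_predC (fun x => h.[x] != 0)).
  apply: leq_add.
    have cntE (P : pred K) u : count P u = \sum_(x <- u) (P x : nat).
      by rewrite -sum1_count big_mkcond; apply: eq_bigr => x _; case: (P x).
    rewrite /N; under eq_bigr do rewrite size_filter cntE.
    rewrite cntE exchange_big /= big_seq [leqRHS]big_seq; apply: leq_sum => x xj.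
    have [//|hx] := eqVneq h.[x] 0; have [i Di] := eqs x xj hx.
    by rewrite (bigD1 i) //= Di eqxx.
  rewrite -size_filter ltnW //; apply: max_poly_roots => //.
    by apply/allP => x; rewrite mem_filter /= negbK => /andP[].
  by rewrite filter_uniq // uniq_fixs.
have chiN x : x \in fixs j -> chi (h.[x] ^+ E) =
    \sum_(i < d) chi c1 * (chi mu ^+ i * (h.[x] ^+ E == c1 * mu ^+ i)%:R).
  move=> xj; have [hx|hx] := eqVneq h.[x] 0.
    rewrite hx expr0n eqn0Ngt E0 (chi0 w r0 prim_z) big1 // => i _.
    have mu0 : mu != 0 by rewrite (prim_root_eq0 prim_mu) -lt0n.
    have cmu0 : c1 * mu ^+ i != 0 by apply: mulf_neq0; rewrite // expf_neq0.
    by rewrite eq_sym (negPf cmu0) !mulr0.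
  have [i Di] := eqs x xj hx; rewrite (bigD1 i) //= Di eqxx mulr1 big1 ?addr0.
    have /eqP -> : h.[x] ^+ E == c1 * mu ^+ i by rewrite Di.
    have fx (y : K) : y ^+ r = 1 -> y ^+ r.+1 = y by move=> yr; rewrite exprS yr mulr1.
    have muir : (mu ^+ i) ^+ r = 1 by rewrite -exprM mulnC exprM mur expr1n.
    rewrite (chiM r0 prim_z prim_w (fx _ c1r) (fx _ muir)).
    by rewrite (chiX r0 prim_z prim_w _ (fx _ mur)).
  by move=> k ki; rewrite Di (negPf ki) !mulr0.
rewrite (eq_big_seq _ chiN) exchange_big /=.
under eq_bigr do rewrite -mulr_sumr -mulr_sumr.
rewrite -mulr_sumr normrM (chi_norm r0 prim_z prim_w) // mul1r.
have DN (i : 'I_d) : \sum_(x <- fixs j) (h.[x] ^+ E == c1 * mu ^+ i)%:R = (N i)%:R :> algC.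
  by rewrite -natr_sum /N size_filter -sum1_count [in RHS]big_mkcond; congr (_%:R).
under eq_bigr do rewrite DN.
have := twisted_sum_small (a := (C0 * q ^ nu)%N) (b := m) d1
  (chi_primitive r0 prim_z prim_w prim_mu mur) (fun i : 'I_d => Nbound i) total.
move=> /le_trans; apply; rewrite ler_nat.
by rewrite mulnDl mulnA leq_add2l leq_pmulr // expn_gt0 ltnW // card_gt1.
Qed.

End StepanovSum.

(** * Prime power divisors and Frobenius orbits *)

Lemma count_multiples_upto e m n : (0 < e)%N ->
  (\sum_(j < n) ((e %| j.+1) && (j.+1 %/ e <= m) : nat) = minn m (n %/ e))%N.
Proof.
move=> e0; elim: n => [|n IH]; first by rewrite big_ord0 div0n minn0.
rewrite big_ord_recr /= IH divnS //; case: (e %| n.+1)%N => /=; last by rewrite addn0.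
by move: (n %/ e)%N => k; lia.
Qed.

Lemma sum_count_undup (T : eqType) (s : seq T) :
  (\sum_(x <- undup s) count_mem x s = size s)%N.
Proof.
rewrite -sum1_size -[RHS](big_undup_iterop_count addn).
by apply: eq_bigr => x _; rewrite Monoid.iteropE iter_addn_0 mul1n.
Qed.

Section OrbitPolynomials.
Variables (F : finFieldType) (K : closedFieldType) (iota : {rmorphism F -> K}).
Notation q := #|F|.
Notation fixs := (fixs F K).

(** The characteristic polynomial over the field with [q] elements of an element [x]
    fixed by the [q^j]-power map; it is a power of the minimal polynomial of [x]. *)
Definition orbit_poly j (x : K) : {poly K} := \prod_(i < j) ('X - (x ^+ (q ^ i))%:P).

Lemma frobq_inj i (x y : K) : x ^+ (q ^ i) = y ^+ (q ^ i) -> x = y.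
Proof.
have [phi phiE] := frobenius_rmorphism (closure_pnatX iota i).
by rewrite -!phiE => /fmorph_inj.
Qed.

Lemma dvdp_frobenius (g : {poly F}) (x : K) M i :
  ('X - x%:P) ^+ M %| map_poly iota g -> ('X - (x ^+ (q ^ i))%:P) ^+ M %| map_poly iota g.
Proof.
have [phi phiE] := frobenius_rmorphism (closure_pnatX iota i).
rewrite -(dvdp_map phi) rmorphXn rmorphB /= map_polyX map_polyC /= phiE.
congr (_ %| _); apply/polyP=> k; rewrite !coef_map /= phiE.
by elim: i {phi phiE} => [|i IH]; rewrite ?expr1 // expnS exprM iota_fixed.
Qed.

Lemma orbit_polyD j k (x : K) : x ^+ (q ^ j) = x ->
  orbit_poly (j + k) x = orbit_poly j x * orbit_poly k x.
Proof.
move=> xj; rewrite /orbit_poly big_split_ord; congr (_ * _).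
by apply: eq_bigr => i _ /=; rewrite expnD exprM xj.
Qed.

Section RootOrbit.
Variables (g : {poly F}) (n : nat) (x : K).
Hypotheses (mg : g \is monic) (szg : size g = n.+1) (gx : root (map_poly iota g) x).
Notation G := (map_poly iota g).

(** The conjugates of a root of [g] are roots of [g], so they repeat; the period [e]
    is the degree of the minimal polynomial of [x]. *)
Lemma exists_orbit_period : exists e, [/\ (0 < e)%N,
  forall j, (x ^+ (q ^ j) == x) = (e %| j)%N &
  uniq [seq x ^+ (q ^ i) | i <- index_iota 0 e]].
Proof.
have G0 : G != 0 by rewrite map_poly_eq0 monic_neq0.
have [rs DG] := closed_field_poly_normal G.
have mem_rs i : x ^+ (q ^ i) \in rs.
  rewrite -root_prod_XsubC -dvdp_XsubCl.
  have lG : lead_coef G != 0 by rewrite lead_coef_eq0.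
  have := @dvdp_frobenius g x 1 i; rewrite !expr1 !dvdp_XsubCl => /(_ gx).
  by rewrite -!dvdp_XsubCl [X in _ %| X]DG dvdpZr.
have shift i j : (i <= j)%N -> x ^+ (q ^ i) = x ^+ (q ^ j) -> x ^+ (q ^ (j - i)) = x.
  move=> ij e; apply: (@frobq_inj i); rewrite -exprM -expnD subnK //.
have exP : exists e, (0 < e)%N && (x ^+ (q ^ e) == x).
  have : ~~ uniq [seq x ^+ (q ^ i) | i <- index_iota 0 (size rs).+1].
    apply/negP => /uniq_leq_size us; have := us rs.
    rewrite size_map size_iota ltnn => H; suff : false by [].
    by apply: H => y /mapP[i _ ->].
  case/(uniqPn 0) => i [j [ij]]; rewrite size_map size_iota => js.
  rewrite !(nth_map 0%N) ?size_iota // ?(ltn_trans ij js) //.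
  rewrite !nth_iota // ?(ltn_trans ij js) // !add0n => /(shift _ _ (ltnW ij)) e.
  by exists (j - i)%N; rewrite subn_gt0 ij e eqxx.
case: (ex_minnP exP) => e /andP[e0 /eqP xe] min_e; exists e.
have xke k : x ^+ (q ^ (k * e)) = x.
  by elim: k => [|k IH]; rewrite ?expr1 // mulSn expnD exprM xe.
split=> // [j|].
  apply/eqP/idP => [xj|/dvdnP[k ->]]; last exact: xke.
  rewrite /dvdn -leqn0 leqNgt; apply/negP => m0.
  have xm : x ^+ (q ^ (j %% e)) = x.
    by rewrite -[RHS]xj [in RHS](divn_eq j e) expnD exprM xke.
  by have := min_e (j %% e)%N; rewrite m0 xm eqxx leqNgt ltn_pmod // => /(_ isT).
apply/(uniqPn 0) => -[i [j [ij]]]; rewrite size_map size_iota subn0 => js.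
rewrite !(nth_map 0%N) ?size_iota ?subn0 // ?(ltn_trans ij js) //.
rewrite /index_iota subn0 !nth_iota // ?(ltn_trans ij js) // !add0n.
move=> /(shift _ _ (ltnW ij)) xji.
have := min_e (j - i)%N; rewrite subn_gt0 ij xji eqxx => /(_ isT); lia.
Qed.

(** The orbit polynomial of degree [k e] is the [k]-th power of the minimal
    polynomial of [x], so it divides [g] for exactly the [k] up to the multiplicity
    of the root. *)
Lemma count_orbit_poly_divisors :
  (\sum_(j < n) ((x ^+ (q ^ j.+1) == x)%R && (orbit_poly j.+1 x %| G)%R : nat) = mup x G)%N.
Proof.
have G0 : G != 0 by rewrite map_poly_eq0 monic_neq0.
have [e [e0 xe ue]] := exists_orbit_period.
have dvdM i : ('X - (x ^+ (q ^ i))%:P) ^+ (mup x G) %| G.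
  by apply: dvdp_frobenius; rewrite -mup_geq.
have orbitE : orbit_poly e x = \prod_(y <- [seq x ^+ (q ^ i) | i <- index_iota 0 e]) ('X - y%:P).
  by rewrite big_map big_mkord.
have lt : (mup x G * e <= n)%N.
  have := @size_leq_of_high_multiplicity K (mup x G) _ G G0 ue.
  rewrite size_map size_iota subn0 size_map_poly szg ltnS; apply.
  by move=> y /mapP[i _ ->].
have orbitX k : orbit_poly (k * e) x = orbit_poly e x ^+ k.
  elim: k => [|k IH]; first by rewrite /orbit_poly big_ord0 expr0.
  by rewrite mulSn orbit_polyD ?IH ?exprS //; apply/eqP; rewrite xe.
have e1 : minn (mup x G) (n %/ e) = mup x G by apply/minn_idPl; rewrite leq_divRL.
rewrite -[RHS]e1 -count_multiples_upto //.
apply: eq_bigr => j _; rewrite xe; case: dvdnP => //= -[k ->].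
rewrite mulnK // orbitX; congr nat_of_bool; apply/idP/idP => [dv|km].
  rewrite mup_geq //; apply: dvdp_trans dv; apply: dvdp_exp2r.
  by rewrite /orbit_poly -(prednK e0) big_ord_recl expr1 dvdp_mulr.
rewrite orbitE -prodrXl; apply: dvdp_trans (dvdp_prod_XsubC_exp (M := mup x G) ue _).
  rewrite !prodrXl; exact: dvdp_exp2l.
by move=> y /mapP[i _ ->].
Qed.

End RootOrbit.

(** The analogue for polynomials of writing [log n] as the sum of the von Mangoldt
    function over the divisors of [n]. The degree of an irreducible factor appears as
    the number of its roots [x], so no factorisation into irreducibles is involved. *)
Lemma count_prime_power_factors (g : {poly F}) n : g \is monic -> size g = n.+1 ->
  (\sum_(j < n) \sum_(x <- fixs j.+1) ((orbit_poly j.+1 x %| map_poly iota g)%R : nat) = n)%N.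
Proof.
move=> mg szg; set G := map_poly iota g.
have mG : G \is monic by exact: monic_map.
have [rs] := closed_field_poly_normal G; rewrite (monicP mG) scale1r => DG.
have szrs : size rs = n.
  by have := size_prod_XsubC rs id; rewrite -DG size_map_poly szg => -[].
have inner (j : 'I_n) : (\sum_(x <- fixs j.+1) ((orbit_poly j.+1 x %| G)%R : nat) =
   \sum_(x <- undup rs) ((x ^+ (q ^ j.+1) == x)%R && (orbit_poly j.+1 x %| G)%R : nat))%N.
  rewrite (bigID (fun x => x \in rs)) /= [X in (_ + X)%N]big1 ?addn0; last first.
    move=> x; rewrite -root_prod_XsubC -DG => xG.
    case: (boolP (_ %| _)) => // dv; case/negP: xG.
    rewrite -dvdp_XsubCl; apply: dvdp_trans dv.
    by rewrite /orbit_poly big_ord_recl expr1 dvdp_mulr.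
  transitivity (\sum_(x <- undup rs | x \in fixs j.+1) ((orbit_poly j.+1 x %| G)%R : nat))%N.
    rewrite -big_filter -[RHS]big_filter; apply: perm_big; apply: uniq_perm.
    - by rewrite filter_uniq // (uniq_fixs iota).
    - by rewrite filter_uniq // undup_uniq.
    by move=> x; rewrite !mem_filter mem_undup andbC.
  rewrite big_mkcond; apply: eq_bigr => x _; rewrite mem_fixs //.
  by case: ifP.
rewrite (eq_bigr _ (fun j _ => inner j)) exchange_big /=.
rewrite (eq_big_seq (fun x => count_mem x rs)) => [|x]; last first.
  rewrite mem_undup => xrs.
  rewrite (@count_orbit_poly_divisors g n x) // -/G; last by rewrite DG root_prod_XsubC.
  by rewrite DG mu_prod_XsubC.
by rewrite sum_count_undup.
Qed.

End OrbitPolynomials.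

(** * The L-function of a character *)

Section MonicPolynomials.
Variable F : fieldType.

Definition monic_of n (v : 'rV[F]_n) : {poly F} := 'X^n + rVpoly v.
Definition tail_of n (g : {poly F}) : 'rV[F]_n := poly_rV (g - 'X^n).

Lemma size_monic_of n (v : 'rV[F]_n) : size (monic_of v) = n.+1.
Proof. by rewrite size_polyDl size_polyXn // ltnS size_poly. Qed.

Lemma monic_of_monic n (v : 'rV[F]_n) : monic_of v \is monic.
Proof. by rewrite monicE lead_coefDl ?lead_coefXn // size_polyXn ltnS size_poly. Qed.

Lemma monic_ofK n : cancel (@monic_of n) (tail_of n).
Proof. by move=> v; rewrite /tail_of /monic_of [_ + rVpoly v]addrC addrK rVpolyK. Qed.

Lemma tail_ofK n g : g \is monic -> size g = n.+1 -> monic_of (tail_of n g) = g.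
Proof.
move=> mg szg; rewrite /monic_of /tail_of poly_rV_K; first by rewrite addrC subrK.
apply/leq_sizeP => k nk; rewrite coefB coefXn.
have [->|nk'] := eqVneq k n.
  by have := monicP mg; rewrite lead_coefE szg /= => ->; rewrite subrr.
by rewrite nth_default ?subr0 // szg ltn_neqAle eq_sym nk'.
Qed.

End MonicPolynomials.

Section LFunction.
Variables (F : finFieldType) (K : closedFieldType) (iota : {rmorphism F -> K}).
Notation q := #|F|.
Notation r := (#|F|.-1).
Variables (z : K) (w : algC).
Hypotheses (prim_z : r.-primitive_root z) (prim_w : r.-primitive_root w).
Notation chi := (chi r z w).
Notation fixs := (fixs F K).
Notation "g ^i" := (map_poly iota g) (at level 2, format "g ^i").

Variables (h : {poly F}) (rs : seq K).
Hypothesis h0 : h != 0.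
Hypothesis Dh : h^i = lead_coef h^i *: \prod_(b <- rs) ('X - b%:P).

(** The product of the values of [g] at the roots of [h], that is, up to a constant,
    the resultant of [h] and [g]. It is multiplicative in [g], and for [g = X - x] it
    is the value of [h] at [x] up to a constant, which makes [psi] the Dirichlet
    character attached to the sums of [chi (h x)]. *)
Definition evals (g : {poly K}) : K := \prod_(b <- rs) g.[b].
Definition psi (g : {poly K}) : algC := chi (evals g).

Lemma evalsM g g' : evals (g * g') = evals g * evals g'.
Proof. by rewrite /evals -big_split /=; apply: eq_bigr => b _; rewrite hornerM. Qed.

(** The polynomial [h] has coefficients in the small field, so Frobenius permutes its
    roots with their multiplicities. *)
Lemma perm_frobenius_roots : perm_eq [seq b ^+ q | b <- rs] rs.
Proof.
have [phi phiE] := frobenius_rmorphism (closure_pnat iota).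
have ph : map_poly phi h^i = h^i.
  by apply/polyP=> i; rewrite !coef_map /= phiE iota_fixed.
have l0 : lead_coef h^i != 0 by rewrite lead_coef_eq0 map_poly_eq0.
apply: prod_XsubC_eq; rewrite big_map; apply: (scalerI l0).
rewrite -Dh -[in RHS]ph [in RHS]Dh map_polyZ /= -lead_coef_map ph.
rewrite rmorph_prod /=; congr (_ *: _); apply: eq_bigr => b _.
by rewrite rmorphB /= map_polyX map_polyC /= phiE.
Qed.

Lemma evals_fixed (g : {poly F}) : evals g^i ^+ r.+1 = evals g^i.
Proof.
rewrite card_r /evals -prodrXl -[RHS](perm_big _ perm_frobenius_roots) big_map.
by apply: eq_bigr => b _; rewrite horner_frobenius.
Qed.

Lemma psiM (g g' : {poly F}) : psi (g * g')^i = psi g^i * psi g'^i.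
Proof. by rewrite /psi rmorphM /= evalsM (chiM (r_gt0 F) prim_z prim_w) ?evals_fixed. Qed.

Lemma psi1 : psi 1^i = 1.
Proof.
rewrite /psi rmorph1 /evals big1 => [|b _]; last by rewrite hornerC.
by rewrite (chi1 (r_gt0 F) prim_z prim_w).
Qed.

(** The coefficients of the L-function: the sums of [psi] over the monic polynomials
    of degree [n]. *)
Definition coefL n : algC := \sum_(v : 'rV[F]_n) psi (monic_of v)^i.
(** The sum attached to the extension of degree [j]; by [evals_orbit_poly] below, its
    terms are the values of [chi] at the norms of the values of [h], up to a constant
    factor of [h]. *)
Definition powersum j : algC := \sum_(x <- fixs j) psi (orbit_poly F j x).

Lemma coefL0 : coefL 0 = 1.
Proof.
rewrite /coefL (big_pred1 (0 : 'rV_0)) => [|v]; last by rewrite [v]thinmx0 /= eqxx.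
by rewrite /monic_of linear0 addr0 expr0 psi1.
Qed.

Lemma sum_psi_multiples (c : {poly F}) j n : c \is monic -> size c = j.+1 -> (j <= n)%N ->
  \sum_(v : 'rV[F]_n | c %| monic_of v) psi (monic_of v)^i = psi c^i * coefL (n - j).
Proof.
move=> mc szc jn; rewrite /coefL mulr_sumr.
have szM (u : 'rV[F]_(n - j)) : size (c * monic_of u) = n.+1.
  by rewrite size_monicM ?monic_neq0 ?monic_of_monic // szc size_monic_of addSn addnS subnKC.
have mM (u : 'rV[F]_(n - j)) : c * monic_of u \is monic by rewrite monicMl ?monic_of_monic.
rewrite (reindex_onto (fun u => tail_of n (c * monic_of u))
  (fun v => tail_of (n - j) (monic_of v %/ c))) /=.
  apply: eq_big => u.
    by rewrite tail_ofK // dvdp_mulr // mulKp ?monic_neq0 // monic_ofK eqxx.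
  by rewrite tail_ofK // psiM.
move=> v cv.
have E : c * (monic_of v %/ c) = monic_of v by rewrite mulrC divpK.
have md : monic_of v %/ c \is monic by rewrite -(monicMr _ mc) divpK ?monic_of_monic.
rewrite (tail_ofK md) ?E ?monic_ofK //.
have := size_monicM mc (monic_neq0 md); rewrite E size_monic_of szc addSn /= => e.
by apply/eqP; rewrite -(eqn_add2l j) -e addnS subnKC.
Qed.

Lemma orbit_poly_rational j x : (0 < j)%N -> x \in fixs j ->
  exists c : {poly F}, [/\ orbit_poly F j x = c^i, c \is monic & size c = j.+1].
Proof.
move=> j0 xj.
have [phi phiE] := frobenius_rmorphism (closure_pnat iota).
have mo : orbit_poly F j x \is monic by apply: monic_prod => i _; exact: monicXsubC.
have Po : map_poly phi (orbit_poly F j x) = orbit_poly F j x.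
  rewrite /orbit_poly rmorph_prod /=.
  under eq_bigr do rewrite rmorphB /= map_polyX map_polyC /= phiE -exprM -expnSr.
  case: j j0 xj {mo} => // j _ xj; rewrite big_ord_recr big_ord_recl /= mulrC.
  by rewrite (fixsP _ xj) // expr1.
have [i|c Dc] := @poly_of_fixed F K iota (orbit_poly F j x).
  by rewrite -phiE -coef_map Po.
exists c; split=> //; first by rewrite -(map_monic iota) -Dc.
by rewrite -(size_map_poly iota) -Dc /orbit_poly -big_enum size_prod_XsubC -cardE card_ord.
Qed.

(** The logarithmic derivative of the Euler product, without formal series: both
    sides count, weighted by [psi g], the triples of a monic [g] of degree [n], a
    degree [j] and an element [x] whose orbit polynomial of degree [j] divides [g],
    where [x] is in the field with [q^j] elements. *)
Theorem newton_coefL n :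
  n%:R * coefL n = \sum_(j < n) powersum j.+1 * coefL (n - j.+1).
Proof.
rewrite {1}/coefL mulr_sumr.
under eq_bigr => v _.
  rewrite -[X in X%:R](count_prime_power_factors iota (monic_of_monic v) (size_monic_of v)).
  rewrite natr_sum mulr_suml.
  over.
rewrite exchange_big /=; apply: eq_bigr => j _.
under eq_bigr do rewrite natr_sum mulr_suml.
rewrite exchange_big /powersum mulr_suml /= big_seq [RHS]big_seq; apply: eq_bigr => x xj.
have [c [Dc mc szc]] := orbit_poly_rational (ltn0Sn j) xj.
rewrite Dc -(sum_psi_multiples mc szc (ltn_ord j)) [RHS]big_mkcond /=.
apply: eq_bigr => v _; rewrite dvdp_map.
by case: ifP => _; rewrite ?mul1r ?mul0r.
Qed.

Section Vanishing.
Variable H : {poly F}.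
Hypothesis H0 : H != 0.
Hypothesis rootH : forall b, root H^i b = (b \in rs).

Lemma psi_modp (g g' : {poly F}) : g %% H = g' %% H -> psi g^i = psi g'^i.
Proof.
move=> e; congr chi; rewrite /evals [LHS]big_seq [RHS]big_seq; apply: eq_bigr => b.
rewrite -rootH => /rootP Hb.
rewrite (divp_eq g H) (divp_eq g' H) e !rmorphD !rmorphM /=.
by rewrite !hornerD !hornerM Hb !mulr0.
Qed.

Lemma coprimep_of_psi (u : {poly F}) : psi u^i != 0 -> coprimep H u.
Proof.
move=> pu; rewrite -(coprimep_map iota) /coprimep; apply/negPn/negP.
case/closed_rootP => b; rewrite root_gcd rootH => /andP[brs /rootP ub].
case/eqP: pu; rewrite /psi /evals (perm_big _ (perm_to_rem brs)) big_cons /= ub mul0r.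
exact: chi0 (r_gt0 F) prim_z.
Qed.

(** The value [psi g] depends only on [g] modulo [H]. Multiplying the residue of [g]
    by [u] while keeping the quotient permutes the monic polynomials of degree [n],
    and multiplies the sum by [psi u]; as this is not 1, the sum is zero. *)
Lemma coefL_vanish n (u : {poly F}) : (size H <= n.+1)%N ->
  psi u^i != 0 -> psi u^i != 1 -> coefL n = 0.
Proof.
move=> Hn u0 u1.
(* The quotient by [H] is kept and the residue is multiplied by [u]. *)
pose s (g : {poly F}) := g - g %% H + (u * g) %% H.
have sz_lt (g : {poly F}) : (size (g %% H)%R < n.+1)%N.
  by apply: leq_trans Hn; rewrite ltn_modp.
have sz_s (v : 'rV[F]_n) : size (s (monic_of v)) = n.+1.
  rewrite /s -addrA size_polyDl size_monic_of // (leq_ltn_trans (size_polyD _ _)) //.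
  by rewrite gtn_max size_polyN !sz_lt.
have m_s (v : 'rV[F]_n) : s (monic_of v) \is monic.
  rewrite /s -addrA monicE lead_coefDl ?(monicP (monic_of_monic _)) //.
  by rewrite size_monic_of (leq_ltn_trans (size_polyD _ _)) // gtn_max size_polyN !sz_lt.
have mod_s (g : {poly F}) : s g %% H = (u * g) %% H.
  by rewrite /s !modpD modpN !modp_id subrr add0r.
pose sigma (v : 'rV[F]_n) : 'rV[F]_n := tail_of n (s (monic_of v)).
have sigmaE v : monic_of (sigma v) = s (monic_of v) by rewrite tail_ofK.
have sigma_inj : injective sigma.
  move=> v v' e; have es : s (monic_of v) = s (monic_of v') by rewrite -!sigmaE e.
  have em : monic_of v %% H = monic_of v' %% H.
    apply/eqP; rewrite -subr_eq0 -modpN -modpD.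
    have := Gauss_dvdpr (monic_of v - monic_of v') (coprimep_of_psi u0).
    rewrite /dvdp => <-; rewrite mulrBr modpD modpN.
    by rewrite -!mod_s es subrr.
  apply: (can_inj (@monic_ofK F n)); apply/eqP; rewrite -subr_eq0.
  have := subrr (s (monic_of v)); rewrite {2}es /s.
  have -> : (u * monic_of v) %% H = (u * monic_of v') %% H by rewrite -!mod_s es.
  by rewrite em => /eqP; rewrite opprD addrACA subrr addr0 opprD addrACA subrr addr0.
have e : coefL n = psi u^i * coefL n.
  rewrite {1}/coefL (reindex_inj sigma_inj) /= /coefL mulr_sumr.
  by apply: eq_bigr => v _; rewrite sigmaE -psiM; apply: psi_modp.
apply/eqP; have : (1 - psi u^i) * coefL n == 0 by rewrite mulrBl mul1r -e subrr.
by rewrite mulf_eq0 subr_eq0 eq_sym (negPf u1).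
Qed.

End Vanishing.

End LFunction.

(** * Power sums and the size of the inverse roots *)

Section PowerSums.
Variable R : idomainType.
Implicit Types ws : seq R.

Definition power_sum ws j : R := \sum_(w <- ws) w ^+ j.

(** The identity [L' / L = - \sum_j p_j X^(j-1)] for the power sums [p_j], multiplied
    by [X L] and truncated, proved by adding one factor at a time. *)
Lemma newton_truncated ws N : let L := \prod_(w <- ws) (1 - w *: 'X) in
  exists D : {poly R},
    L * (\sum_(j < N) power_sum ws j.+1 *: 'X^(j.+1)) + 'X * L^`() = 'X^(N.+1) * D.
Proof.
elim: ws => [|w ws [D IH]] /=.
  exists 0; rewrite !big_nil big1 ?mulr0 ?add0r => [|j _].
    by rewrite -polyC1 derivC mulr0.
  by rewrite /power_sum big_nil scale0r.
set L := \prod_(w <- ws) _ in IH *; rewrite big_cons -/L.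
set P := \sum_(j < N) _ in IH; set P' := \sum_(j < N) _.
pose T : {poly R} := \sum_(j < N) w ^+ j.+1 *: 'X^(j.+1).
have -> : P' = T + P.
  rewrite /P' /T /P -big_split /=; apply: eq_bigr => j _.
  by rewrite /power_sum big_cons scalerDl.
have ET : (1 - w *: 'X) * T = w *: 'X - w ^+ N.+1 *: 'X^(N.+1).
  rewrite /T; elim: N {D IH P P' T} => [|N IH]; first by rewrite big_ord0 mulr0 !expr1 subrr.
  rewrite big_ord_recr /= mulrDr IH mulrBl mul1r -scalerAl -scalerAr scalerA -exprS -exprS.
  by ring.
have dL : ((1 - w *: 'X) * L)^`() = - (w *: L) + (1 - w *: 'X) * L^`().
  rewrite derivM derivB -polyC1 derivC derivZ derivX sub0r alg_polyC.
  by rewrite mulNr mul_polyC.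
exists ((1 - w *: 'X) * D - w ^+ N.+1 *: L).
rewrite dL.
have -> : 'X^(N.+1) * ((1 - w *: 'X) * D - w ^+ N.+1 *: L) =
   (1 - w *: 'X) * ('X^(N.+1) * D) - L * (w ^+ N.+1 *: 'X^(N.+1)).
  by rewrite -!mul_polyC; ring.
rewrite -IH.
have -> : (1 - w *: 'X) * L * (T + P) = L * ((1 - w *: 'X) * T) + (1 - w *: 'X) * (L * P) by ring.
rewrite ET -!mul_polyC; ring.
Qed.

Lemma newton_identity ws n : let L := \prod_(w <- ws) (1 - w *: 'X) in
  n%:R * L`_n = - \sum_(j < n) power_sum ws j.+1 * L`_(n - j.+1).
Proof.
move=> L; have [D] := newton_truncated ws n; rewrite -/L => /(congr1 (fun p : {poly R} => p`_n)).
rewrite coefD coefXnM ltnSn coefXM mulr_sumr coef_sum.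
have -> : (if n == 0%N then 0 else (L^`())`_n.-1) = n%:R * L`_n.
  by case: n {D} => [|n]; rewrite ?mul0r // coef_deriv mulr_natl.
move/eqP; rewrite addrC addr_eq0 => /eqP ->; congr (- _); apply: eq_bigr => j _.
by rewrite -scalerAr coefZ coefMXn ltnNge ltn_ord.
Qed.

(** Newton's identities determine the power sums from the coefficients, as the
    coefficient of the top power sum is [a 0 = 1]. *)
Lemma power_sums_unique (a S T : nat -> R) : a 0%N = 1 ->
  (forall n, n%:R * a n = \sum_(j < n) S j.+1 * a (n - j.+1)%N) ->
  (forall n, n%:R * a n = \sum_(j < n) T j.+1 * a (n - j.+1)%N) ->
  forall n, S n.+1 = T n.+1.
Proof.
move=> a0 Sa Ta; elim/ltn_ind => n IH.
have := Sa n.+1; rewrite Ta !big_ord_recr /= subnn a0 !mulr1.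
rewrite (eq_bigr (fun j : 'I_n => S j.+1 * a (n.+1 - j.+1)%N)).
  by move/addrI.
by move=> j _; rewrite IH.
Qed.

End PowerSums.

Lemma factor_reciprocal (K : closedFieldType) (L : {poly K}) : L`_0 = 1 ->
  exists2 ws, L = \prod_(w <- ws) (1 - w *: 'X) & size ws = (size L).-1.
Proof.
move=> L0; have [bs DL] := closed_field_poly_normal L.
have Ln0 : L != 0.
  by apply: contra_eq_neq L0 => ->; rewrite coef0 eq_sym oner_eq0.
have l0 : lead_coef L != 0 by rewrite lead_coef_eq0.
have bs0 b : b \in bs -> b != 0.
  apply: contraTneq => ->; rewrite -root_prod_XsubC -(rootZ _ _ l0) -DL /root.
  by rewrite horner_coef0 L0 oner_eq0.
exists [seq b^-1 | b <- bs]; last first.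
  by rewrite size_map [in RHS]DL size_scale // size_prod_XsubC.
have E : \prod_(b <- bs) ('X - b%:P) =
    (\prod_(b <- bs) (- b)) *: \prod_(w <- [seq b^-1 | b <- bs]) (1 - w *: 'X).
  rewrite big_map -mul_polyC rmorph_prod /= -big_split /= big_seq [RHS]big_seq.
  apply: eq_bigr => b /bs0 b0; rewrite mul_polyC scalerBr scalerA mulNr divff //.
  by rewrite alg_polyC scaleN1r opprK addrC polyCN.
rewrite {1}DL E scalerA.
suff -> : lead_coef L * (\prod_(b <- bs) - b) = 1 by rewrite scale1r.
have := L0; rewrite [in L`_0]DL E scalerA coefZ -horner_coef0 horner_prod.
by rewrite [X in _ * _ * X]big1 ?mulr1 // => w _; rewrite !hornerE ?mulr0 ?subr0.
Qed.

(** Bernoulli's inequality. *)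
Lemma expr_unbounded (t c : algC) : 1 < t -> 0 <= c -> exists nu, c < t ^+ nu.+1.
Proof.
move=> t1 c0; have s0 : 0 < t - 1 by rewrite subr_gt0.
have bern n : 1 + n%:R * (t - 1) <= t ^+ n.
  elim: n => [|n IH]; first by rewrite mul0r addr0 expr0.
  rewrite exprS; apply: le_trans (_ : t * (1 + n%:R * (t - 1)) <= _).
    rewrite -subr_ge0 (_ : _ - _ = n%:R * (t - 1) ^+ 2) ?mulr_ge0 ?ler0n ?exprn_ge0 ?ltW //.
    by rewrite -natr1; ring.
  by rewrite ler_pM2l // (lt_trans ltr01).
have c'0 : 0 <= c / (t - 1) by rewrite divr_ge0 // ltW.
exists (Num.bound (c / (t - 1))).
apply: lt_le_trans (bern _); rewrite -natr1 mulrDl mul1r.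
have := archi_boundP c'0; rewrite ltr_pdivrMr // => lt.
apply: lt_le_trans lt _; rewrite addrCA lerDl addr_ge0 ?ler01 // ltW //.
Qed.

(** A Lagrange polynomial [P] that vanishes at all the other elements but not at [z]
    writes [z^nu] as a fixed linear combination of the shifted power sums, so
    [|z|^nu] is at most a constant times [B^nu]. Letting [nu] grow gives the claim,
    whatever the constant [C]. *)
Lemma power_sums_bound (zs : seq algC) (B C : algC) : 0 < B -> 0 <= C ->
  (forall nu, (0 < nu)%N -> `|power_sum zs nu| <= C * B ^+ nu) ->
  forall z, z \in zs -> `|z| <= B.
Proof.
move=> B0 C0 bound z zzs.
pose P := \prod_(y <- undup zs | y != z) ('X - y%:P).
have Pz : P.[z] != 0.
  rewrite /P horner_prod prodf_seq_neq0; apply/allP => y _; apply/implyP => yz.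
  by rewrite hornerXsubC subr_eq0 eq_sym.
have Py y : y \in zs -> y != z -> P.[y] = 0.
  move=> yzs yz; apply/eqP; rewrite /P horner_prod prodf_seq_eq0; apply/hasP.
  by exists y; rewrite ?mem_undup // yz hornerXsubC subrr eqxx.
pose m := count_mem z zs.
have m0 : (0 < m)%N by rewrite -has_count has_pred1.
have main nu : m%:R * (z ^+ nu * P.[z]) = \sum_(l < size P) P`_l * power_sum zs (nu + l).
  transitivity (\sum_(y <- zs) y ^+ nu * P.[y]).
    rewrite (bigID (pred1 z)) /= [X in _ + X]big1_seq ?addr0 => [|y /andP[yz yzs]].
      rewrite (eq_bigr (fun=> z ^+ nu * P.[z])) => [|y /eqP ->] //.
      by rewrite big_const_seq iter_addr_0 mulr_natl.
    by rewrite Py ?mulr0.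
  under eq_bigr do rewrite horner_coef mulr_sumr.
  rewrite exchange_big /=; apply: eq_bigr => l _.
  by rewrite /power_sum mulr_sumr; apply: eq_bigr => y _; rewrite exprD mulrCA.
pose C' := \sum_(l < size P) `|P`_l| * (C * B ^+ l).
have C'0 : 0 <= C' by apply: sumr_ge0 => l _; rewrite !mulr_ge0 // exprn_ge0 // ltW.
have c0 : 0 < m%:R * `|P.[z]| by rewrite mulr_gt0 ?ltr0n ?normr_gt0.
have est nu : (0 < nu)%N -> (`|z| / B) ^+ nu <= C' / (m%:R * `|P.[z]|).
  move=> nu0; rewrite ler_pdivlMr // expr_div_n mulrAC ler_pdivrMr ?exprn_gt0 //.
  have -> : `|z| ^+ nu * (m%:R * `|P.[z]|) = `|m%:R * (z ^+ nu * P.[z])|.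
    by rewrite !normrM normr_nat normrX mulrCA.
  rewrite main; apply: le_trans (ler_norm_sum _ _ _) _.
  rewrite /C' mulr_suml; apply: ler_sum => l _; rewrite normrM -mulrA ler_wpM2l //.
  by apply: le_trans (bound _ _) _; rewrite ?addn_gt0 ?nu0 // -mulrA -exprD addnC.
have zB : 0 <= `|z| / B by rewrite divr_ge0 // ltW.
suff : `|z| / B <= 1 by rewrite ler_pdivrMr // mul1r.
rewrite real_leNgt ?ger0_real // ?ler01 //; apply/negP => lt1.
have [n0 ltn0] := expr_unbounded lt1 (divr_ge0 C'0 (ltW c0)).
by have := est n0.+1 isT; rewrite lt_geF.
Qed.

(** * Weil's bound *)

Section Weil.
Variables (F : finFieldType) (K : closedFieldType) (iota : {rmorphism F -> K}).
Notation q := #|F|.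
Notation r := (#|F|.-1).
Variables (z : K) (w : algC).
Hypotheses (prim_z : r.-primitive_root z) (prim_w : r.-primitive_root w).
Notation chi := (chi r z w).
Notation fixs := (fixs F K).
Notation "g ^i" := (map_poly iota g) (at level 2, format "g ^i").
Variables (h H : {poly F}) (b0 : K).
Hypotheses (h0 : h != 0) (H0 : H != 0).
Hypothesis rootH : forall b, root H^i b = root h^i b.
Hypothesis hb0 : ~~ (r %| mup b0 h^i)%N.

Let rs : seq K := sval (closed_field_poly_normal h^i).
Let Dh : h^i = lead_coef h^i *: \prod_(b <- rs) ('X - b%:P).
Proof. by rewrite /rs; case: closed_field_poly_normal. Qed.

Let eps : F := (-1) ^+ size rs / lead_coef h.
(** The scalar [eps] is chosen so that the value of [h1] at [x] is exactly the
    product of the [b - x] over the roots [b]. *)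
Let h1 : {poly F} := eps *: h.

Let eps0 : eps != 0.
Proof.
by rewrite /eps mulf_neq0 ?invr_eq0 ?lead_coef_eq0 // expf_neq0 // oppr_eq0 oner_eq0.
Qed.

Let mem_rs b : (b \in rs) = root h^i b.
Proof. by rewrite Dh rootZ ?root_prod_XsubC // lead_coef_eq0 map_poly_eq0. Qed.

Let horner_h1 x : h1^i.[x] = \prod_(b <- rs) (b - x).
Proof.
have l0 : lead_coef h^i != 0 by rewrite lead_coef_eq0 map_poly_eq0.
rewrite map_polyZ /= {1}Dh scalerA hornerZ horner_prod /eps rmorphM fmorphV /=.
rewrite -lead_coef_map divfK // rmorphXn rmorphN rmorph1 /=.
elim: rs => [|b s IH]; first by rewrite !big_nil expr0 mulr1.
by rewrite !big_cons -IH hornerXsubC /= exprS; ring.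
Qed.

Notation psi := (psi F z w rs).
Notation coefL := (coefL iota z w rs).
Notation powersum := (powersum F z w rs).

Lemma evals_orbit_poly j x : evals rs (orbit_poly F j x) = h1^i.[x] ^+ norm_exp F j.
Proof.
rewrite /evals /orbit_poly; under eq_bigr do rewrite horner_prod.
rewrite exchange_big /norm_exp expr_sum /=; apply: eq_bigr => i _.
rewrite horner_frobeniusX horner_h1; apply: eq_bigr => b _.
by rewrite hornerXsubC.
Qed.

Lemma powersumE j : powersum j = \sum_(x <- fixs j) chi (h1^i.[x] ^+ norm_exp F j).
Proof. by apply: eq_bigr => x _; rewrite /psi evals_orbit_poly. Qed.

Lemma powersum_bound : exists C : nat, forall nu, (0 < nu)%N ->
  `|powersum (nu + nu)| <= (C * q ^ nu)%:R.
Proof.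
have h10 : h1 != 0 by rewrite scaler_eq0 negb_or eps0.
have hb1 : ~~ (r %| mup b0 h1^i)%N.
  by rewrite map_polyZ /= mupZ ?fmorph_eq0.
have [C HC] := stepanov_char_sum prim_z prim_w h10 hb1.
by exists C => nu nu0; rewrite powersumE HC.
Qed.

(** If [psi] took only the values 0 and 1 on the orbit polynomials, every term of the
    sum over an extension would be 1 except for the roots of [h], so the sum would be
    about [q^(2 nu)] and contradict the bound of order [q^nu] for large [nu]. *)
Lemma exists_nontrivial_residue : exists u : {poly F}, psi u^i != 0 /\ psi u^i != 1.
Proof.
have [C HC] := powersum_bound.
(* Large enough for [q^nu] to exceed both the constant of the bound and the number of
   roots. *)
pose nu := (C + size rs).+2; set j := (nu + nu)%N.
have j0 : (0 < j)%N by [].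
have [/hasP[x xj /andP[p0 p1]]|/hasPn triv] :=
  boolP (has (fun x => (psi (orbit_poly F j x) != 0) && (psi (orbit_poly F j x) != 1)) (fixs j)).
  have [c [Dc _ _]] := orbit_poly_rational iota j0 xj.
  by exists c; rewrite -Dc.
have S_eq : powersum j = (count (fun x => h1^i.[x] != 0) (fixs j))%:R.
  rewrite powersumE -sum1_count natr_sum [RHS]big_mkcond /= big_seq [RHS]big_seq.
  apply: eq_bigr => x xj; have := triv x xj; rewrite negb_and !negbK /psi evals_orbit_poly.
  have [hx|hx] := eqVneq h1^i.[x] 0.
    rewrite hx expr0n /norm_exp -(prednK j0) big_ord_recl expn0 /=.
    by rewrite (chi0 w (r_gt0 F) prim_z).
  have cr : (h1^i.[x] ^+ norm_exp F j) ^+ r = 1.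
    rewrite -exprM mulnC; apply: (mulfI hx).
    by rewrite -exprS norm_expE mulr1 horner_frobeniusX (fixsP j0 xj).
  have := chi_norm (r_gt0 F) prim_z prim_w cr.
  move=> nrm; case/orP => /eqP E; rewrite E //; move: nrm.
  by rewrite E normr0 => /eqP; rewrite eq_sym oner_eq0.
have cnt : (q ^ j <= count (fun x => h1^i.[x] != 0)%R (fixs j) + size rs)%N.
  rewrite -(@size_fixs F K j j0) -(count_predC (fun x => h1^i.[x] != 0)) leq_add2l.
  rewrite -size_filter; apply: uniq_leq_size; first by rewrite filter_uniq // (uniq_fixs iota).
  move=> x; rewrite mem_filter /= negbK map_polyZ hornerZ mulf_eq0 fmorph_eq0.
  by rewrite (negPf eps0) /= mem_rs => /andP[].
have := HC nu isT; rewrite -/j S_eq normr_nat ler_nat => le.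
have lt : (nu < q ^ nu)%N by apply: ltn_expl; exact: card_gt1.
exfalso; move: le cnt; rewrite /j expnD; move: (count _ _) => c le cnt.
have := leq_trans cnt (leq_add le (leqnn _)).
by move: lt; rewrite /nu; move: (q ^ _)%N => t; nia.
Qed.

(** The L-function is a polynomial of degree less than the size of [H], a polynomial
    that shares the roots of [h] but may have smaller multiplicities; the bound on
    the sums over the extensions of even degree controls the squares of the inverse
    roots. *)
Theorem weil_bound :
  `|\sum_(x : F) chi (iota h.[x])| <= (size H)%:R * sqrtC q%:R.
Proof.
have [u [u0 u1]] := exists_nontrivial_residue.
pose D := size H.
have D0 : (0 < D)%N by rewrite size_poly_gt0.
have van n : (D <= n.+1)%N -> coefL n = 0.
  move=> Dn; apply: (coefL_vanish prim_z prim_w (h := h) (H := H) _ _ _ _ Dn u0 u1) => //.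
  by move=> b; rewrite rootH mem_rs.
pose L := \poly_(i < D) coefL i.
have coefLE n : L`_n = coefL n.
  by rewrite coef_poly; case: ltnP => // Dn; rewrite van // leqW.
have L0 : L`_0 = 1 by rewrite coefLE (coefL0 iota prim_z prim_w).
have [ws DL szws] := factor_reciprocal L0.
have szws_le : (size ws <= D)%N.
  by rewrite szws (leq_trans (leq_pred _)) // size_poly.
have S_ws n : powersum n.+1 = - power_sum ws n.+1.
  apply: (@power_sums_unique _ coefL powersum (fun j => - power_sum ws j)).
  - exact: coefL0.
  - exact: (newton_coefL prim_z prim_w h0 Dh).
  move=> m; rewrite -coefLE DL newton_identity -DL -sumrN; apply: eq_bigr => i _.
  by rewrite coefLE mulNr.
have [C HC] := powersum_bound.
have q0 : 0 < q%:R :> algC by rewrite ltr0n ltnW // card_gt1.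
(* Only even extension degrees are controlled, hence the squares [y ^+ 2]. *)
have ws_bound v : v \in ws -> `|v| <= sqrtC q%:R.
  move=> vws; rewrite -(@ler_pXn2r _ 2) ?nnegrE ?sqrtC_ge0 ?ler0n ?normr_ge0 // sqrtCK.
  rewrite -normrX; apply: (@power_sums_bound [seq y ^+ 2 | y <- ws] q%:R C%:R) => //.
    move=> nu nu0; rewrite -natrX -natrM.
    have -> : power_sum [seq y ^+ 2 | y <- ws] nu = power_sum ws (nu + nu).
      rewrite /power_sum big_map; apply: eq_bigr => y _.
      by rewrite -exprM mul2n addnn.
    have := HC nu nu0; have -> : (nu + nu = (nu + nu).-1.+1)%N by rewrite prednK // addn_gt0 nu0.
    by rewrite S_ws normrN.
  by apply/mapP; exists v.
(* Dividing out the constant [eps] changes the sum by a factor of absolute value 1. *)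
have -> : \sum_(x : F) chi (iota h.[x]) = chi (iota eps^-1) * powersum 1.
  rewrite powersumE mulr_sumr (perm_big _ (perm_fixs1 iota)) big_map /= big_enum /=.
  apply: eq_bigr => x _; rewrite /norm_exp big_ord1 expn0 expr1 horner_map /=.
  have fx (y : F) : iota y ^+ r.+1 = iota y by rewrite card_r iota_fixed.
  rewrite -(chiM (r_gt0 F) prim_z prim_w) ?fx // -rmorphM hornerZ mulKf //.
rewrite normrM (chi_norm (r_gt0 F) prim_z prim_w) ?mul1r; last first.
  rewrite -rmorphXn /=; apply: (mulfI (x := iota eps^-1)); first by rewrite fmorph_eq0 invr_eq0.
  by rewrite mulr1 -rmorphM -exprS card_r expf_card.
rewrite S_ws normrN; apply: le_trans (ler_norm_sum _ _ _) _.
apply: (@le_trans _ _ (\sum_(v <- ws) sqrtC q%:R)).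
  by rewrite big_seq [leRHS]big_seq; apply: ler_sum => v /ws_bound; rewrite expr1.
rewrite big_const_seq iter_addr_0 count_predT -[X in X <= _]mulr_natl.
rewrite ler_wpM2r ?sqrtC_ge0 ?ler0n //.
by rewrite ler_nat.
Qed.

End Weil.

(** * Nondegenerate rational functions *)

Lemma rf_num_neq0 (F : fieldType) (f : {fraction {poly F}}) :
  (0 < rf_deg f)%N -> rf_num f != 0.
Proof.
apply: contraTneq => n0; rewrite /rf_deg n0 size_poly0 /= max0n.
by have := rf_coprime f; rewrite n0 coprime0p => /eqp_size; rewrite size_poly1 => ->.
Qed.

Section PowerForm.
Variables (F : finFieldType) (K : closedFieldType) (iota : {rmorphism F -> K}).
Notation r := (#|F|.-1).
Notation "g ^i" := (map_poly iota g) (at level 2, format "g ^i").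

(** The multiplicity at 0 is unrestricted, which is where the monomial comes from.
    Without its zero at 0, [p] is a constant times a [d]-th power over the closure,
    hence over the small field. *)
Lemma power_times_X (p : {poly F}) d : (0 < d)%N -> p != 0 ->
  (forall b : K, b != 0 -> (d %| mup b p^i)%N) ->
  exists c W j, p = c *: W ^+ d * 'X^j.
Proof.
move=> d0 p0 dp; have [j [p' /implyP/(_ p0) p'0 Dp]] := multiplicity_XsubC p 0.
rewrite subr0 in Dp; have p'n0 : p' != 0 by apply: contraNneq p0 => E; rewrite Dp E mul0r.
have p'i0 : p'^i != 0 by rewrite map_poly_eq0.
have Xj (b : K) : b != 0 -> ~~ root ('X^j : {poly K}) b.
  by move=> b0; rewrite /root hornerXn expf_neq0.
have dp' b : (d %| mup b p'^i)%N.
  have [->|b0] := eqVneq b 0.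
    by rewrite mupNroot // -(rmorph0 iota) fmorph_root.
  have := dp b b0; rewrite Dp rmorphM /= map_polyXn mupMl ?Xj //.
have [W mW DW] := root_extraction p'i0 dp'.
have l0 : lead_coef p'^i != 0 by rewrite lead_coef_eq0.
have [W0 DW0] := monic_root_rational d0 mW l0 DW.
exists (lead_coef p'), W0, j; rewrite [LHS]Dp; congr (_ * _).
apply: (map_poly_inj iota); rewrite [LHS]DW map_polyZ /= rmorphXn /= -DW0.
by rewrite lead_coef_map.
Qed.

(** The numerator and the denominator are coprime, so at each [b] at most one of the
    two multiplicities is nonzero. If [r = q - 1] always divided the combination,
    then [d = r / gcd (t, r)] would divide all multiplicities away from 0, and [f]
    would be of the excluded form with this [d], which is at least 2 because [0 < t <
    r]. *)
Lemma exists_nonmultiple_multiplicity (f : {fraction {poly F}}) (t : nat) :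
  (0 < rf_deg f)%N -> ~ rf_power_form #|F| f -> (0 < t < r)%N ->
  exists2 b, b != 0 &
    ~~ (r %| (t + r) * mup b (rf_num f)^i + (r - t) * mup b (rf_den f)^i)%N.
Proof.
move=> fdeg nondeg /andP[t0 tr].
set n := rf_num f; set m := rf_den f.
have cop : coprimep n m := rf_coprime f.
have m0 : m != 0 := rf_den_neq0 f.
have n0 : n != 0 by exact: rf_num_neq0.
have [rs Drs] := closed_field_poly_normal (n * m)^i.
pose P b := (b != 0) && ~~ (r %| (t + r) * mup b n^i + (r - t) * mup b m^i)%N.
have [/hasP[b _ /andP[b0 Pb]]|/hasPn noP] := boolP (has P rs); first by exists b.
case: nondeg; pose g := gcdn t r; pose d := (r %/ g)%N.
have r0 : (0 < r)%N := r_gt0 F.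
have g0 : (0 < g)%N by rewrite gcdn_gt0 t0.
have gr : (g %| r)%N := dvdn_gcdr t r.
have gt : (g %| t)%N := dvdn_gcdl t r.
have d2 : (2 <= d)%N.
  rewrite /d leq_divRL //; apply: leq_trans (_ : (r %/ g * g <= _)%N); last by rewrite divnK.
  rewrite leq_mul2r leqNgt; apply/orP; right; apply/negP => lt2.
  have := divnK gr; case: (r %/ g)%N lt2 => [|[|]] // _; rewrite ?mul0n ?mul1n => E.
    by rewrite -E in r0.
  by have := dvdn_leq t0 gt; rewrite E leqNgt tr.
have d0 : (0 < d)%N := ltnW d2.
have gauss a : (r %| t * a)%N -> (d %| a)%N.
  move=> rta; have cop' : coprime d (t %/ g).
    by rewrite coprime_sym /coprime -(eqn_pmul2r g0) mul1n muln_gcdl !divnK.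
  rewrite -(Gauss_dvdr _ cop') -(dvdn_pmul2r g0) divnK //.
  by rewrite mulnAC divnK.
have main b : b != 0 -> (d %| mup b n^i)%N /\ (d %| mup b m^i)%N.
  move=> b0; have : (r %| (t + r) * mup b n^i + (r - t) * mup b m^i)%N.
    have [/noP|brs] := boolP (b \in rs); first by rewrite negb_and b0 negbK.
    have : ~~ root (n * m)^i b.
      by rewrite Drs rootZ ?root_prod_XsubC // lead_coef_eq0 map_poly_eq0 mulf_neq0.
    rewrite rmorphM rootM negb_or /= => /andP[nb mb].
    by rewrite !mupNroot // !muln0.
  have : ~~ (root n^i b && root m^i b).
    apply/negP => /andP[nb mb]; have copK : coprimep n^i m^i by rewrite coprimep_map.
    by have := coprimep_root copK nb; rewrite -/(root _ _) mb.
  rewrite negb_and => /orP[nb|mb] dv.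
    rewrite (mupNroot nb) dvdn0; split=> //; apply: gauss.
    move: dv; rewrite (mupNroot nb) muln0 add0n mulnBl => dv.
    rewrite -(dvdn_addr _ dv) subnK ?dvdn_mulr //.
    by rewrite leq_mul2r (ltnW tr) orbT.
  rewrite (mupNroot mb) dvdn0; split=> //; apply: gauss.
  by move: dv; rewrite (mupNroot mb) muln0 addn0 mulnDl (dvdn_addl _ (dvdn_mulr _ (dvdnn r))).
have [c [W [j Dn]]] := power_times_X d0 n0 (fun b b0 => proj1 (main b b0)).
have [c' [W' [j' Dm]]] := power_times_X d0 m0 (fun b b0 => proj2 (main b b0)).
(* The monomials of the numerator and the denominator combine to [X^(j - j')], which
   explains the integer exponent of the excluded form. *)
exists (c / c'), (FracField.tofrac W / FracField.tofrac W'), d, (j%:Z - j'%:Z).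
split=> //; first by rewrite subn1 dvdn_div //.
rewrite (rf_num_den f) -/n -/m Dn Dm.
have c0 : c != 0 by apply: contraNneq n0 => E; rewrite Dn E scale0r mul0r.
have c'0 : c' != 0 by apply: contraNneq m0 => E; rewrite Dm E scale0r mul0r.
have W'0 : W' != 0.
  by apply: contraNneq m0 => E; rewrite Dm E expr0n eqn0Ngt d0 scaler0 mul0r.
have Ecc' : FracField.tofrac (c / c')%:P = FracField.tofrac c%:P / FracField.tofrac c'%:P.
  have c'P0 : FracField.tofrac c'%:P != 0 by rewrite tofrac_eq0 polyC_eq0.
  by apply: (mulIf c'P0); rewrite divfK // -tofracM -polyCM divfK.
have X0 : FracField.tofrac ('X : {poly F}) != 0 by rewrite tofrac_eq0 polyX_eq0.
rewrite -!mul_polyC !tofracM !tofracXn Ecc' expr_div_n expfzDr // -exprnN -!exprnP.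
by rewrite !invfM; ring.
Qed.

End PowerForm.

(** * Character sums twisted by a rational function *)

Lemma exists_primitive_root_finField (F : finFieldType) : exists z : F, #|F|.-1.-primitive_root z.
Proof.
pose us := [seq a <- enum F | a != 0 :> F].
have /hasP[z _ prim_z] : has #|F|.-1.-primitive_root us; last by exists z.
apply: has_prim_root.
- exact: r_gt0.
- apply/allP => a; rewrite mem_filter => /andP[a0 _]; rewrite unity_rootE.
  by apply/eqP; apply: (mulfI a0); rewrite -exprS card_r expf_card mulr1.
- by rewrite filter_uniq // enum_uniq.
rewrite -(cardC1 (0 : F)) cardE /us enumT /enum_mem; exact: eq_leq.
Qed.

(** The sum of [X(x)^s X(f x)^t]. The exponents are shifted by [q - 1] to keep them
    positive: then all factors vanish where they should (at 0, at the zeros and at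
    the poles of [f]), although a power with exponent 0 would be 1 there, and the
    denominator occurs with a nonnegative exponent. *)
Definition twisted_sum (F : finFieldType) (X : F -> algC) (n m : {poly F}) (s t : nat) : algC :=
  \sum_x X x ^+ (s + #|F|.-1) * X n.[x] ^+ (t + #|F|.-1) * X m.[x] ^+ (#|F|.-1 - t).

(** The summand is a character of the value of the polynomial [X^(s+q-1) n^(t+q-1)
    m^(q-1-t)]. For [t <> 0] it has a root of the required multiplicity because [f]
    is nondegenerate; for [t = 0] the root 0 does, because [0 < s < q - 1]. *)
Theorem weil_twisted (F : finFieldType) (f : {fraction {poly F}}) :
  (0 < rf_deg f)%N -> ~ rf_power_form #|F| f ->
  exists X : F -> algC,
    [/\ X 0 = 0, {morph X : x y / x * y}, forall x, x != 0 -> `|X x| = 1,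
        forall x, x != 0 -> X x = 1 -> x = 1 &
        forall s t, (s < #|F|.-1)%N -> (t < #|F|.-1)%N -> (0 < s + t)%N ->
          `|twisted_sum X (rf_num f) (rf_den f) s t| <= (2 * rf_deg f + 2)%:R * sqrtC #|F|%:R].
Proof.
move=> fdeg nondeg; set q := #|F|; set r := q.-1.
have r0 : (0 < r)%N := r_gt0 F.
have [K [iota _]] := countable_algebraic_closure F.
have [z0 prim_z0] := exists_primitive_root_finField F.
pose z : K := iota z0.
have prim_z : r.-primitive_root z by rewrite fmorph_primitive_root.
have [w prim_w] := C_prim_root_exists r0.
have fx (y : F) : iota y ^+ r.+1 = iota y by rewrite card_r iota_fixed.
have fx1 (y : F) : y != 0 -> iota y ^+ r = 1.
  move=> y0; have y0' : iota y != 0 by rewrite fmorph_eq0.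
  by apply: (mulfI y0'); rewrite -exprS fx mulr1.
pose X x := chi r z w (iota x).
have X0 : X 0 = 0 by rewrite /X rmorph0 chi0.
have XM : {morph X : x y / x * y} by move=> x y; rewrite /X rmorphM (chiM r0 prim_z prim_w).
exists X; split=> // [x x0|x x0 Xx|s t sr tr st].
- by rewrite /X (chi_norm r0 prim_z prim_w) ?fx1.
- apply: (fmorph_inj iota); rewrite rmorph1.
  exact: (chi_eq1 r0 prim_z prim_w (fx1 _ x0)).
set n := rf_num f; set m := rf_den f.
have m0 : m != 0 := rf_den_neq0 f.
have n0 : n != 0 := rf_num_neq0 fdeg.
(* All three exponents are positive, so [h] has the same roots as [H]. *)
pose h := 'X ^+ (s + r) * n ^+ (t + r) * m ^+ (r - t).
pose H := 'X * n * m.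
have h0 : h != 0 by rewrite !mulf_neq0 ?expf_neq0 ?polyX_eq0.
have H0 : H != 0 by rewrite !mulf_neq0 ?polyX_eq0.
have XX (x : F) j : (0 < j)%N -> X x ^+ j = X (x ^+ j).
  case: j => // j _; elim: j => [|j IH]; first by rewrite !expr1.
  by rewrite exprS IH -XM -exprS.
have -> : twisted_sum X n m s t = \sum_(x : F) chi r z w (iota h.[x]).
  apply: eq_bigr => x _; rewrite -/(X _) /h !hornerM !horner_exp hornerX !XM.
  by rewrite !XX ?addn_gt0 ?r0 ?orbT ?subn_gt0.
have rtt : (0 < r - t)%N by rewrite subn_gt0.
have rootH b : root (map_poly iota H) b = root (map_poly iota h) b.
  rewrite /H /h !rmorphM !rmorphXn /= map_polyX !rootM.
  have rootE' (p : {poly K}) k : (0 < k)%N -> root (p ^+ k) b = root p b.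
    by move=> k0; rewrite /root horner_exp expf_eq0 k0.
  by rewrite !rootE' ?addn_gt0 ?r0 ?orbT.
have [b hb] : exists b, ~~ (r %| mup b (map_poly iota h))%N.
  have mupE b : mup b (map_poly iota h) = ((s + r) * mup b ('X : {poly K}) +
      ((t + r) * mup b (map_poly iota n) + (r - t) * mup b (map_poly iota m)))%N.
    rewrite /h !rmorphM !rmorphXn /= map_polyX.
    rewrite !mupM ?mulf_neq0 ?expf_neq0 ?polyX_eq0 ?map_poly_eq0 //.
    by rewrite !mupX ?polyX_eq0 ?map_poly_eq0 // addnA.
  have [t0|t0] := posnP t.
    exists 0; rewrite mupE t0 add0n subn0 -mulnDr (dvdn_addl _ (dvdn_mulr _ (dvdnn r))).
    have -> : mup 0 ('X : {poly K}) = 1%N.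
      by have := mup_XsubCX 1 0 (0 : K); rewrite subr0 expr1 eqxx.
    rewrite muln1 dvdn_addl // gtnNdvd //.
    by move: st; rewrite t0 addn0.
  have [b b0 hb] := exists_nonmultiple_multiplicity iota fdeg nondeg (introT andP (conj t0 tr)).
  exists b; rewrite mupE mupNroot ?muln0 //.
  by rewrite rootX.
have := weil_bound prim_z prim_w h0 H0 rootH hb.
move=> /le_trans; apply; rewrite ler_wpM2r ?sqrtC_ge0 ?ler0n // ler_nat.
rewrite /H size_mul ?mulf_neq0 ?polyX_eq0 // size_mul ?polyX_eq0 // size_polyX.
have : ((size n).-1 <= rf_deg f)%N by rewrite leq_maxl.
have : ((size m).-1 <= rf_deg f)%N by rewrite leq_maxr.
by move: (rf_deg f) (size n) (size m) => k a b'; lia.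
Qed.

(** * Bilinear incidences *)

Lemma cauchy_schwarz (R : numDomainType) (I : finType) (a b : I -> R) :
  (forall i, 0 <= a i) -> (forall i, 0 <= b i) ->
  (\sum_i a i * b i) ^+ 2 <= (\sum_i a i ^+ 2) * (\sum_i b i ^+ 2).
Proof.
move=> a0 b0; rewrite -subr_ge0 -(pmulrn_lge0 _ (ltn0Sn 1)).
set SA := \sum_i a i ^+ 2; set SB := \sum_i b i ^+ 2; set SAB := \sum_i a i * b i.
have -> : (SA * SB - SAB ^+ 2) *+ 2 = \sum_i \sum_j (a i * b j - a j * b i) ^+ 2.
  transitivity (\sum_i (a i ^+ 2 * SB + (a i * b i) * (SAB *- 2) + b i ^+ 2 * SA)).
    by rewrite !big_split /= -!mulr_suml -/SA -/SB -/SAB; ring.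
  apply: eq_bigr => i _; rewrite -sumrMnl -sumrN !mulr_sumr -!big_split /=.
  by apply: eq_bigr => j _; ring.
apply: sumr_ge0 => i _; apply: sumr_ge0 => j _; apply: real_exprn_even_ge0 => //.
by rewrite realB // ger0_real // mulr_ge0.
Qed.

(** For nonzero [x], the number of ways to write [x] as a quotient [u / v]. *)
Definition quot_count (F : finFieldType) (U V : {set F}) (x : F) : nat :=
  (\sum_(v in V) (x * v \in U)%R)%N.

(** The number of [y] in [Y] with [f x * y] in [W]; the pole condition is needed
    because the evaluation of [f] at a pole is a division by zero, which returns 0. *)
Definition image_count (F : finFieldType) (f : {fraction {poly F}}) (Y W : {set F}) (x : F) : nat :=
  (\sum_(y in Y) (~~ rf_pole f x && (rf_eval f x * y \in W)%R))%N.

Section Mixing.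
Variables (F : finFieldType) (X : F -> algC).
Notation q := #|F|.
Notation r := (#|F|.-1).
Hypothesis X0 : X 0 = 0.
Hypothesis XM : {morph X : x y / x * y}.
Hypothesis X_norm : forall x, x != 0 -> `|X x| = 1.
Hypothesis X_inj : forall x, x != 0 -> X x = 1 -> x = 1.

Let r0 : (0 < r)%N := r_gt0 F.

Let X1 : X 1 = 1.
Proof.
have n1 : `|X 1| = 1 by rewrite X_norm ?oner_eq0.
have X10 : X 1 != 0 by rewrite -normr_eq0 n1 oner_eq0.
by apply: (mulfI X10); rewrite -XM !mulr1.
Qed.

Let XX x j : X (x ^+ j) = X x ^+ j.
Proof. by elim: j => [|j IH]; rewrite ?expr0 ?X1 // !exprS XM IH. Qed.

Let Xr x : x != 0 -> X x ^+ r = 1.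
Proof.
move=> x0; rewrite -XX -X1; congr X; apply: (mulfI x0).
by rewrite -exprS card_r expf_card mulr1.
Qed.

Let XV x : x != 0 -> X x^-1 = (X x)^*.
Proof.
move=> x0; have Xx0 : X x != 0 by rewrite -normr_eq0 X_norm ?oner_eq0.
by apply: (mulfI Xx0); rewrite -XM divff // X1 -normCK X_norm // expr1n.
Qed.

Lemma orthogonality x : x != 0 -> \sum_(s < r) X x ^+ s = r%:R * (x == 1)%:R.
Proof.
move=> x0; have [->|x1] := eqVneq x 1.
  under eq_bigr do rewrite X1 expr1n.
  by rewrite sumr_const card_ord mulr1.
have Xx1 : X x - 1 != 0 by rewrite subr_eq0; apply: contraNneq x1 => /(X_inj x0) ->.
by rewrite mulr0; apply: (mulfI Xx1); rewrite -subrX1 Xr // subrr mulr0.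
Qed.

Definition char_sum (A : {set F}) s : algC := \sum_(a in A) X a ^+ s.
Definition char_sumV (A : {set F}) s : algC := \sum_(a in A) X a^-1 ^+ s.

Lemma char_sumVE (A : {set F}) s : 0 \notin A -> char_sumV A s = (char_sum A s)^*.
Proof.
move=> A0; rewrite /char_sum rmorph_sum; apply: eq_bigr => a aA.
by rewrite rmorphXn /= XV //; apply: contraNneq A0 => <-.
Qed.

(** Detecting the equation [x b = a] by the [q - 1] powers of the character. *)
Lemma pair_orthogonality x (A B : {set F}) : x != 0 -> 0 \notin A -> 0 \notin B ->
  \sum_(s < r) X x ^+ s * char_sum B s * char_sumV A s =
  r%:R * (\sum_(b in B) (x * b \in A)%R)%:R.
Proof.
move=> x0 A0 B0.
have An0 a : a \in A -> a != 0 by move=> aA; apply: contraNneq A0 => <-.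
have Bn0 b : b \in B -> b != 0 by move=> bB; apply: contraNneq B0 => <-.
under [LHS]eq_bigr => s _.
  rewrite -mulrA /char_sum /char_sumV mulr_suml mulr_sumr.
  under eq_bigr => b _ do rewrite !mulr_sumr.
  over.
rewrite exchange_big /= natr_sum [RHS]mulr_sumr; apply: eq_bigr => b bB.
rewrite exchange_big /=.
transitivity (\sum_(a in A) r%:R * (x * b == a)%:R : algC).
  apply: eq_bigr => a aA; have a0 := An0 a aA.
  rewrite -(_ : (x * b / a == 1) = (x * b == a)); last first.
    by rewrite -(inj_eq (mulIf a0)) divfK // mul1r.
  have b0 := Bn0 b bB.
  have xba0 : x * b / a != 0 by rewrite !mulf_neq0 ?invr_eq0.
  rewrite -(orthogonality xba0) //.
  by apply: eq_bigr => s _; rewrite !XM !exprMn mulrA.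
rewrite -mulr_sumr; congr (_ * _).
case: (boolP (x * b \in A)) => xbA.
  rewrite (bigD1 (x * b)) //= eqxx big1 ?addr0 // => a /andP[_ ab].
  by rewrite eq_sym (negPf ab).
rewrite big1 // => a aA; case: eqP => // E; move: xbA; by rewrite E aA.
Qed.

Lemma parseval (A : {set F}) : 0 \notin A -> \sum_(s < r) `|char_sum A s| ^+ 2 = r%:R * #|A|%:R.
Proof.
move=> A0; transitivity (\sum_(s < r) X 1 ^+ s * char_sum A s * char_sumV A s).
  by apply: eq_bigr => s _; rewrite X1 expr1n mul1r char_sumVE // -normCK.
rewrite (pair_orthogonality (oner_neq0 F) A0 A0) -sum1_card.
by congr (_ * _%:R); apply: eq_bigr => a aA; rewrite mul1r aA.
Qed.

(** Cauchy-Schwarz and Parseval. *)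
Lemma char_sum_pairing (A B : {set F}) : 0 \notin A -> 0 \notin B ->
  \sum_(s < r) `|char_sum B s| * `|char_sumV A s| <= r%:R * sqrtC (#|A| * #|B|)%:R.
Proof.
move=> A0 B0.
under eq_bigr do rewrite char_sumVE // norm_conjC.
have ge0 : 0 <= \sum_(s < r) `|char_sum B s| * `|char_sum A s|.
  by apply: sumr_ge0 => s _; rewrite mulr_ge0.
rewrite -(@ler_pXn2r _ 2) ?nnegrE ?mulr_ge0 ?sqrtC_ge0 ?ler0n //.
rewrite exprMn sqrtCK; apply: le_trans (cauchy_schwarz _ _) _ => //.
rewrite !parseval // natrM; rewrite le_eqVlt; apply/orP; left; apply/eqP; ring.
Qed.

Lemma quot_count_expansion (U V : {set F}) x : 0 \notin U -> 0 \notin V ->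
  \sum_(s < r) X x ^+ (s + r) * (char_sum V s * char_sumV U s) = r%:R * (quot_count U V x)%:R.
Proof.
move=> U0 V0; have [->|x0] := eqVneq x 0.
  rewrite big1 => [|s _]; last by rewrite X0 expr0n addn_eq0 [r == _]eqn0Ngt r0 andbF mul0r.
  by rewrite /quot_count big1 ?mulr0 // => v _; rewrite mul0r (negPf U0).
rewrite -pair_orthogonality //; apply: eq_bigr => s _.
by rewrite exprD Xr // mulr1 mulrA.
Qed.

Lemma image_count_expansion (f : {fraction {poly F}}) (Y W : {set F}) x :
  0 \notin Y -> 0 \notin W ->
  \sum_(t < r) X (rf_num f).[x] ^+ (t + r) * X (rf_den f).[x] ^+ (r - t) *
     (char_sum Y t * char_sumV W t) = r%:R * (image_count f Y W x)%:R.
Proof.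
move=> Y0 W0; rewrite /image_count.
case: (boolP (rf_pole f x)) => px.
  rewrite big1 => [|t _]; last first.
    move/rootP: px => ->; rewrite X0 expr0n subn_eq0 leqNgt ltn_ord /=.
    by rewrite mulr0 mul0r.
  by rewrite big1 ?mulr0.
have m0 : (rf_den f).[x] != 0 by [].
have [n0|n0] := eqVneq (rf_num f).[x] 0.
  rewrite big1 => [|t _]; last first.
    by rewrite n0 X0 expr0n addn_eq0 [r == _]eqn0Ngt r0 andbF !mul0r.
  by rewrite big1 ?mulr0 // => y _; rewrite /rf_eval n0 !mul0r (negPf W0).
rewrite -[RHS]pair_orthogonality ?mulf_neq0 ?invr_eq0 //; apply: eq_bigr => t _.
rewrite mulrA; congr (_ * _ * _); rewrite /rf_eval XM exprMn exprD Xr // mulr1.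
congr (_ * _); have Xm0 : X (rf_den f).[x] != 0 by rewrite -normr_eq0 X_norm ?oner_eq0.
apply: (mulIf (expf_neq0 t Xm0)); rewrite -exprD subnK 1?ltnW // Xr //.
by rewrite -exprMn -XM mulVf // X1 expr1n.
Qed.

Definition incidences f (U V Y W : {set F}) : nat :=
  (\sum_x quot_count U V x * image_count f Y W x)%N.

Lemma incidences_expansion f (U V Y W : {set F}) :
  0 \notin U -> 0 \notin V -> 0 \notin Y -> 0 \notin W ->
  \sum_(s < r) \sum_(t < r) twisted_sum X (rf_num f) (rf_den f) s t *
     ((char_sum V s * char_sumV U s) * (char_sum Y t * char_sumV W t)) =
  r%:R ^+ 2 * (incidences f U V Y W)%:R.
Proof.
move=> U0 V0 Y0 W0; rewrite /incidences natr_sum mulr_sumr.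
transitivity (\sum_x (r%:R * (quot_count U V x)%:R) * (r%:R * (image_count f Y W x)%:R) : algC);
  last by apply: eq_bigr => x _; rewrite natrM; ring.
transitivity (\sum_x \sum_(s < r) \sum_(t < r)
   (X x ^+ (s + r) * (char_sum V s * char_sumV U s)) *
   (X (rf_num f).[x] ^+ (t + r) * X (rf_den f).[x] ^+ (r - t) *
     (char_sum Y t * char_sumV W t))).
  rewrite [RHS]exchange_big; apply: eq_bigr => s _ /=.
  rewrite [RHS]exchange_big; apply: eq_bigr => t _ /=.
  by rewrite /twisted_sum mulr_suml; apply: eq_bigr => x _; ring.
apply: eq_bigr => x _.
by rewrite -big_distrlr /= quot_count_expansion // image_count_expansion.
Qed.

(** The pair of trivial characters contributes at most [q Z], with the trivial bound
    [q] for its twisted sum; Weil's bound applies to all other pairs, and the sum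
    over the pairs factors into two bilinear sums. *)
Lemma incidences_bound f (U V Y W : {set F}) (c : nat) :
  0 \notin U -> 0 \notin V -> 0 \notin Y -> 0 \notin W ->
  (forall s t, (s < r)%N -> (t < r)%N -> (0 < s + t)%N ->
     `|twisted_sum X (rf_num f) (rf_den f) s t| <= c%:R * sqrtC q%:R) ->
  forall Z, Z = (#|U| * #|V| * #|Y| * #|W|)%N ->
  r%:R ^+ 2 * (incidences f U V Y W)%:R <=
    q%:R * Z%:R + c%:R * r%:R ^+ 2 * sqrtC (q * Z)%:R :> algC.
Proof.
move=> U0 V0 Y0 W0 weil Z DZ.
have X_le1 x : `|X x| <= 1.
  by have [->|/X_norm ->] := eqVneq x 0; rewrite ?X0 ?normr0 ?ler01.
have cs_le A s : `|char_sum A s| <= #|A|%:R.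
  apply: le_trans (ler_norm_sum _ _ _) _; rewrite -sum1_card natr_sum; apply: ler_sum => a _.
  by rewrite normrX exprn_ile1.
have csV_le A s : `|char_sumV A s| <= #|A|%:R.
  apply: le_trans (ler_norm_sum _ _ _) _; rewrite -sum1_card natr_sum; apply: ler_sum => a _.
  by rewrite normrX exprn_ile1.
have tw s t : (s < r)%N -> (t < r)%N -> `|twisted_sum X (rf_num f) (rf_den f) s t| <=
    q%:R * ((s == 0)%N && (t == 0)%N)%:R + c%:R * sqrtC q%:R.
  move=> sr tr; have cq : 0 <= c%:R * sqrtC q%:R :> algC by rewrite mulr_ge0 ?sqrtC_ge0 ?ler0n.
  have [/andP[/eqP-> /eqP->]|st] := boolP ((s == 0)%N && (t == 0)%N); last first.
    by rewrite mulr0 add0r weil // addn_gt0 !lt0n -negb_and.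
  rewrite mulr1; apply: (@le_trans _ _ q%:R); last by rewrite lerDl.
  apply: le_trans (ler_norm_sum _ _ _) _.
  rewrite -sum1_card natr_sum; apply: ler_sum => x _.
  by rewrite !normrM !normrX !mulr_ile1 ?mulr_ge0 ?exprn_ge0 ?normr_ge0 ?exprn_ile1.
have -> : r%:R ^+ 2 * (incidences f U V Y W)%:R =
    `|r%:R ^+ 2 * (incidences f U V Y W)%:R| :> algC.
  by rewrite ger0_norm // mulr_ge0 ?exprn_ge0 ?ler0n.
rewrite -incidences_expansion //.
pose a s := `|char_sum V s| * `|char_sumV U s|; pose b t := `|char_sum Y t| * `|char_sumV W t|.
have a0 s : 0 <= a s by rewrite mulr_ge0.
have b0 s : 0 <= b s by rewrite mulr_ge0.
apply: (@le_trans _ _ (\sum_(s < r) \sum_(t < r)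
   (q%:R * ((s == 0 :> nat) && (t == 0 :> nat))%:R + c%:R * sqrtC q%:R) * (a s * b t))).
  apply: le_trans (ler_norm_sum _ _ _) _; apply: ler_sum => s _.
  apply: le_trans (ler_norm_sum _ _ _) _; apply: ler_sum => t _.
  by rewrite normrM !normrM -/(a s) -/(b t) ler_wpM2r ?mulr_ge0 // tw.
under eq_bigr do under eq_bigr do rewrite mulrDl.
under eq_bigr do rewrite big_split /=.
rewrite big_split /=; apply: lerD.
  rewrite (bigD1 (Ordinal r0)) //= [X in _ + X]big1 ?addr0 => [|s s0]; last first.
    rewrite big1 // => t _; have -> : (s == 0 :> nat) = false; last by rewrite mulr0 mul0r.
    by apply: contraNF s0 => /eqP s0; apply/eqP/val_inj.
  rewrite (bigD1 (Ordinal r0)) //= [X in _ + X]big1 ?addr0 => [|t t0]; last first.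
    have -> : (t == 0 :> nat) = false; last by rewrite mulr0 mul0r.
    by apply: contraNF t0 => /eqP t0; apply/eqP/val_inj.
  rewrite mulr1 ler_wpM2l ?ler0n // DZ /a /b !natrM.
  have -> : #|U|%:R * #|V|%:R * #|Y|%:R * #|W|%:R =
    (#|V|%:R * #|U|%:R) * (#|Y|%:R * #|W|%:R) :> algC by ring.
  by rewrite !ler_pM ?mulr_ge0.
under eq_bigr do rewrite -mulr_sumr.
rewrite -mulr_sumr -big_distrlr /=.
have pa := char_sum_pairing U0 V0; have pb := char_sum_pairing W0 Y0.
have sa0 : 0 <= \sum_(s < r) a s by apply: sumr_ge0.
have sb0 : 0 <= \sum_(s < r) b s by apply: sumr_ge0.
apply: (@le_trans _ _ (c%:R * sqrtC q%:R *
    ((r%:R * sqrtC (#|U| * #|V|)%:R) * (r%:R * sqrtC (#|W| * #|Y|)%:R)))).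
  by rewrite ler_wpM2l ?mulr_ge0 ?sqrtC_ge0 ?ler0n // ler_pM.
have -> : (q * Z = q * ((#|U| * #|V|) * (#|W| * #|Y|)))%N by rewrite DZ; ring.
rewrite [(q * _)%:R]natrM [((_ * _) * (_ * _))%:R]natrM !sqrtCM ?nnegrE ?mulr_ge0 ?ler0n //.
by rewrite le_eqVlt; apply/orP; left; apply/eqP; ring.
Qed.

End Mixing.

(** The dichotomy replaces the sum of the main term and the error term by the larger
    of the two, so that the rest of the argument needs no complex numbers. *)
Theorem mixing (F : finFieldType) (f : {fraction {poly F}}) (U V Y W : {set F}) :
  (0 < rf_deg f)%N -> ~ rf_power_form #|F| f ->
  0 \notin U -> 0 \notin V -> 0 \notin Y -> 0 \notin W ->
  let N := incidences f U V Y W in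
  let Z := (#|U| * #|V| * #|Y| * #|W|)%N in
  (#|F| * N <= 8 * Z)%N \/ (N ^ 2 <= 4 * (2 * rf_deg f + 2) ^ 2 * #|F| * Z)%N.
Proof.
move=> fdeg nondeg U0 V0 Y0 W0 N Z.
have [X [X0 XM X_norm X_inj weil]] := weil_twisted fdeg nondeg.
have := incidences_bound X0 XM X_norm X_inj U0 V0 Y0 W0 weil (erefl Z); rewrite -/N.
set c := (2 * rf_deg f + 2)%N; set q := #|F|; set r := q.-1 => main.
have [le|lt] := leqP (q * N) (8 * Z); first by left.
right; have q1 : (1 < q)%N := card_gt1 F; have r0 : (0 < r)%N := r_gt0 F.
have qr : (q ^ 2 <= 4 * r ^ 2)%N by rewrite -[4%N]/(2 ^ 2)%N -expnMn leq_exp2r // /r; lia.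
have Zle : (2 * (q * Z) <= r ^ 2 * N)%N.
  have h1 : (q * (8 * Z) <= q * (q * N))%N by rewrite leq_mul2l (ltnW lt) orbT.
  have h2 : (q ^ 2 * N <= 4 * r ^ 2 * N)%N by rewrite leq_mul2r qr orbT.
  have e1 : (q * (q * N) = q ^ 2 * N)%N by rewrite mulnA mulnn.
  rewrite e1 mulnCA in h1; rewrite -mulnA in h2.
  move: (leq_trans h1 h2).
  move: (q * Z)%N (r ^ 2 * N)%N => u v; lia.
set y := sqrtC (q * Z)%:R in main.
have y0 : 0 <= y by rewrite sqrtC_ge0 ler0n.
have Ny : N%:R <= 2 * c%:R * y :> algC.
  have rr0 : 0 < r%:R ^+ 2 :> algC by rewrite exprn_gt0 // ltr0n.
  rewrite -(ler_pM2l rr0).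
  have Zle' : 2 * (q%:R * Z%:R) <= r%:R ^+ 2 * N%:R :> algC.
    by rewrite -natrX -!natrM ler_nat.
  have main' : r%:R ^+ 2 * N%:R <= q%:R * Z%:R + c%:R * r%:R ^+ 2 * y := main.
  rewrite -(lerD2l (r%:R ^+ 2 * N%:R)).
  have -> : r%:R ^+ 2 * N%:R + r%:R ^+ 2 * (2 * c%:R * y) =
     r%:R ^+ 2 * N%:R + 2 * (c%:R * r%:R ^+ 2 * y) by ring.
  apply: le_trans (lerD main' main') _.
  have -> : q%:R * Z%:R + c%:R * r%:R ^+ 2 * y + (q%:R * Z%:R + c%:R * r%:R ^+ 2 * y) =
    2 * (q%:R * Z%:R) + 2 * (c%:R * r%:R ^+ 2 * y) by ring.
  by rewrite lerD2r.
rewrite -(ler_nat algC) natrX.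
apply: (@le_trans _ _ ((2 * c%:R * y) ^+ 2)).
  by rewrite ler_pXn2r ?nnegrE ?mulr_ge0 ?ler0n.
by rewrite exprMn sqrtCK -natrM -natrX -natrM ler_nat expnMn !mulnA.
Qed.

(** * Popular level sets and multiplicative energy *)

Section WeakType.
Variables (R : realFieldType) (I : finType) (B : {set I}) (rho : I -> nat) (n : nat).

Definition harmonic_sum m : R := \sum_(i < m) (i.+1%:R)^-1.

Definition level (s : nat) : {set I} := [set i in B | (s <= rho i)%N].

Hypothesis rho_le : forall i, i \in B -> (rho i <= n)%N.

(** Summation by parts over the level sets. *)
Lemma layer_cake (g : nat -> nat) :
  (\sum_(i in B) \sum_(s < rho i) g s = \sum_(s < n) g s * #|level s.+1|)%N.
Proof.
transitivity (\sum_(i in B) \sum_(s < n) g s * (s < rho i))%N.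
  apply: eq_bigr => i iB; rewrite (big_ord_widen n (fun s => g s) (rho_le iB)) big_mkcond /=.
  by apply: eq_bigr => s _; case: ifP; rewrite ?muln1 ?muln0.
rewrite exchange_big /=; apply: eq_bigr => s _; rewrite -big_distrr /=; congr (_ * _)%N.
rewrite -sum1_card [RHS](eq_bigl (fun i => (i \in B) && (s < rho i)%N)).
  by rewrite [RHS]big_mkcondr; apply: eq_bigr => i _; case: ifP.
by move=> i; rewrite inE.
Qed.

Lemma max_level (w : nat -> nat) : (0 < n)%N ->
  exists s, [/\ (0 < s)%N, (s <= n)%N &
    forall t, (0 < t <= n)%N -> (w t * #|level t| <= w s * #|level s|)%N].
Proof.
move=> n0; pose i0 : 'I_n := Ordinal n0.
case: (@arg_maxnP _ i0 xpredT (fun i : 'I_n => (w i.+1 * #|level i.+1|)%N) isT) => i _ max_i.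
exists i.+1; split=> // [t /andP[t0 tn]].
have tn' : (t.-1 < n)%N by rewrite prednK.
by have := max_i (Ordinal tn') isT; rewrite /= prednK.
Qed.

Lemma weak_type_linear : (0 < n)%N ->
  exists s, [/\ (0 < s)%N, (s <= n)%N &
    (\sum_(i in B) rho i)%:R <= harmonic_sum n * (s * #|level s|)%:R].
Proof.
move=> n0; have [s [s0 sn smax]] := max_level id n0; exists s; split=> //.
have -> : (\sum_(i in B) rho i = \sum_(i in B) \sum_(s < rho i) 1)%N.
  by apply: eq_bigr => i _; rewrite sum_nat_const card_ord muln1.
rewrite (layer_cake (fun=> 1%N)) natr_sum /harmonic_sum mulr_suml; apply: ler_sum => t _.
rewrite mul1n ler_pdivlMl ?ltr0n // -natrM ler_nat.
by apply: smax; rewrite /= ltn_ord.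
Qed.

(** Choosing the level with the largest weighted size costs a harmonic sum, that is,
    one logarithm; the square [n^2] is decomposed into odd numbers, each at most [2
    t] at the level [t]. *)
Lemma weak_type_square : (0 < n)%N ->
  exists s, [/\ (0 < s)%N, (s <= n)%N &
    (\sum_(i in B) rho i ^ 2)%:R <= 2 * harmonic_sum n * (s ^ 2 * #|level s|)%:R].
Proof.
move=> n0; have [s [s0 sn smax]] := max_level (fun t => t ^ 2)%N n0; exists s; split=> //.
have sq (m : nat) : (m ^ 2 = \sum_(t < m) (2 * t + 1))%N.
  elim: m => [|m IH]; first by rewrite big_ord0.
  by rewrite big_ord_recr -IH /=; ring.
rewrite (eq_bigr (fun i => \sum_(t < rho i) (2 * t + 1))%N) => [|i _]; last exact: sq.
rewrite (layer_cake (fun t => 2 * t + 1)%N) natr_sum /harmonic_sum -mulrA mulr_suml mulr_sumr.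
apply: ler_sum => t _; rewrite mulrCA ler_pdivlMl ?ltr0n // -!natrM ler_nat.
have := smax t.+1; rewrite /= ltn_ord => /(_ isT).
move: (#|_|)%N (s ^ 2 * _)%N => l m le.
apply: leq_trans (_ : 2 * (t.+1 ^ 2 * l) <= _)%N; last by rewrite leq_mul2l le orbT.
rewrite mulnA [leqRHS]mulnA leq_mul2r; apply/orP; right; nia.
Qed.

End WeakType.

Section Energy.
Variable F : finFieldType.
Implicit Types U V : {set F}.

Definition rep U (x : F) : nat := (\sum_(a in U) \sum_(b in U) (a * b == x)%R)%N.

Lemma mul_energyE U : mul_energy U = (\sum_x rep U x ^ 2)%N.
Proof.
rewrite /mul_energy -sum1_card.
rewrite (eq_bigl (fun u => (u \in setX (setX U U) (setX U U)) && (u.1.1 * u.1.2 == u.2.1 * u.2.2)));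
  last by move=> u; rewrite inE.
rewrite big_mkcondr /=.
rewrite (eq_bigl (fun u => (u.1 \in setX U U) && (u.2 \in setX U U))); last first.
  by case=> a b; rewrite in_setX.
rewrite -(pair_big (mem (setX U U)) (mem (setX U U))
   (fun a b => if a.1 * a.2 == b.1 * b.2 then 1%N else 0%N)) /=.
have repE x : rep U x = (\sum_(a in setX U U) (a.1 * a.2 == x)%R)%N.
  rewrite /rep pair_big /=; by apply: eq_bigl => -[a b]; rewrite in_setX.
under [RHS]eq_bigr => x _ do rewrite repE -mulnn big_distrlr /=.
rewrite [RHS]exchange_big /=; apply: eq_bigr => a _.
rewrite [RHS]exchange_big /=; apply: eq_bigr => b _.
rewrite (bigD1 (b.1 * b.2)) //= eqxx muln1 big1 ?addn0; first by case: eqP.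
by move=> x xb; rewrite [b.1 * b.2 == x]eq_sym (negPf xb) muln0.
Qed.

Lemma rep_le U x : (0 \notin U) -> (rep U x <= #|U|)%N.
Proof.
move=> U0; rewrite /rep -sum1_card; apply: leq_sum => a aU.
have a0 : a != 0 by apply: contraNneq U0 => <-.
rewrite (eq_bigr (fun b => (b == x / a) : nat)) => [|b _]; last first.
  by rewrite -[b == _](inj_eq (mulIf a0)) divfK // mulrC.
apply: leq_trans (_ : \sum_b (b == x / a) <= _)%N.
  by rewrite [leqLHS]big_mkcond; apply: leq_sum => b _; case: ifP.
by rewrite (bigD1 (x / a)) //= eqxx big1 // => b /negPf ->.
Qed.

Lemma rep0 U : 0 \notin U -> rep U 0 = 0%N.
Proof.
move=> U0; rewrite /rep big1 // => a aU; rewrite big1 // => b bU.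
rewrite mulf_eq0; case: eqP => [a0|_]; first by rewrite -a0 aU in U0.
by case: eqP => // b0; rewrite -b0 bU in U0.
Qed.

(** Grouping the representations of the elements of [P] by the first factor. *)
Lemma sum_rep U (P : {set F}) :
  (\sum_(x in P) rep U x = \sum_(a in U) quot_count P U a)%N.
Proof.
rewrite /rep exchange_big /=; apply: eq_bigr => a _.
rewrite exchange_big /quot_count /=; apply: eq_bigr => b _.
case: (boolP (a * b \in P)) => abP.
  by rewrite (bigD1 (a * b)) //= eqxx big1 // => x /andP[_]; rewrite eq_sym => /negPf ->.
by rewrite big1 // => x xP; case: eqP => // E; rewrite E xP in abP.
Qed.

Lemma sum_rep_le U (P : {set F}) : (\sum_(x in P) rep U x <= #|U| ^ 2)%N.
Proof.
rewrite sum_rep -mulnn -sum_nat_const; apply: leq_sum => a _.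
by rewrite /quot_count -sum1_card; apply: leq_sum => b _; case: (_ \in _).
Qed.

(** The representations of the product 0 need a separate, trivial bound: one of the
    two factors is 0. *)
Lemma mul_energy_setD1 U : (mul_energy U <=
   4 * #|U| ^ 2 + \sum_(x in [set~ 0%R]) rep (U :\ 0%R) x ^ 2)%N.
Proof.
rewrite mul_energyE (bigD1 0) //=; apply: leq_add.
  have -> : (4 * #|U| ^ 2 = (2 * #|U|) ^ 2)%N by rewrite expnMn.
  rewrite leq_exp2r // /rep.
  apply: (@leq_trans (\sum_(a in U) ((a == 0)%R * #|U| + 1))%N).
    apply: leq_sum => a aU; have [->|a0] := eqVneq a 0.
      rewrite mul1n -sum1_card; apply: leq_trans (leq_addr 1 _).
      by apply: leq_sum => b _; case: (_ == _).
    rewrite mul0n add0n; apply: leq_trans (_ : \sum_b (b == 0 :> F)%R <= _)%N.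
      rewrite big_mkcond; apply: leq_sum => b _; case: ifP => // _.
      by rewrite mulf_eq0 (negPf a0).
    by rewrite (bigD1 0) //= eqxx big1 // => b /negPf ->.
  rewrite big_split /= sum1_card mul2n -addnn leq_add2r -big_distrl /=.
  rewrite -[leqRHS]mul1n leq_mul2r; apply/orP; right.
  apply: leq_trans (_ : \sum_b (b == 0 :> F)%R <= _)%N.
    by rewrite [leqLHS]big_mkcond; apply: leq_sum => b _; case: ifP.
  by rewrite (bigD1 0) //= eqxx big1 // => b /negPf ->.
rewrite [leqRHS](eq_bigl (fun x => x != 0)) => [|x]; last by rewrite !inE.
apply: leq_sum => x x0; rewrite leq_exp2r // /rep.
rewrite [leqLHS]big_mkcond [leqRHS]big_mkcond; apply: leq_sum => a _.
case: ifP => aU //; rewrite in_setD1 aU andbT.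
case: (a =P 0) => [->|a0]; first by rewrite big1 // => b _; rewrite mul0r eq_sym (negPf x0).
rewrite [leqLHS]big_mkcond [leqRHS]big_mkcond; apply: leq_sum => b _.
case: ifP => bU //; rewrite in_setD1 bU andbT.
by case: (b =P 0) => [->|//]; rewrite mulr0 eq_sym (negPf x0).
Qed.

Lemma mul_energy_le U : 0 \notin U -> (mul_energy U <= #|U| ^ 3)%N.
Proof.
move=> U0; rewrite mul_energyE.
apply: (@leq_trans (\sum_x #|U| * rep U x)%N).
  by apply: leq_sum => x _; rewrite -mulnn leq_mul2r rep_le ?orbT.
rewrite -big_distrr /= expnS leq_mul2l; apply/orP; right.
have := sum_rep_le U [set: F]; apply: leq_trans; apply: eq_leq.
by apply: eq_bigl => x; rewrite inE.
Qed.

End Energy.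

(** * The decomposition *)

Section Decomposition.
Variables (R : rcfType) (F : finFieldType) (f : {fraction {poly F}}) (A : {set F}).
Variables (kap H : R) (c : nat).
Notation q := (#|F|%:R : R).
Notation a := (#|A|%:R : R).
Hypotheses (A0 : 0 \notin A) (Apos : (0 < #|A|)%N) (kap0 : 0 < kap).
Hypothesis HA : harmonic_sum R #|A| <= H.
Hypothesis mix : forall U V Y W : {set F},
  0 \notin U -> 0 \notin V -> 0 \notin Y -> 0 \notin W ->
  let N := incidences f U V Y W in
  let Z := (#|U| * #|V| * #|Y| * #|W|)%N in
  (#|F| * N <= c * Z)%N \/ (N ^ 2 <= c * #|F| * Z)%N.

Let q0 : 0 < q.
Proof. by rewrite ltr0n ltnW // card_gt1. Qed.

Let a0 : 0 < a.
Proof. by rewrite ltr0n. Qed.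

Let H0 : 0 < H.
Proof.
apply: lt_le_trans HA; rewrite /harmonic_sum -(prednK Apos) big_ord_recl /=.
rewrite ltr_pwDl ?invr_gt0 ?ltr0n //; apply: sumr_ge0 => i _.
by rewrite invr_ge0 ler0n.
Qed.

(** The density of the main term in the equidistribution of a piece. *)
Definition alpha : R := 2 * c%:R * H ^+ 2 * kap / q.
(** The square of the size of the error term: equidistribution with a square root
    error reflects the second alternative of [mix]. *)
Definition beta2 : R := 2 * c%:R * q * H ^+ 3 * kap / a ^+ 2.

(** Normalised by the size of [T], so that the inequality adds up over disjoint
    pieces. *)
Definition equidistributed (T : {set F}) := forall Y W : {set F},
  0 \notin Y -> 0 \notin W ->
  (\sum_(x in T) image_count f Y W x)%:R <=
    #|T|%:R * (alpha * (#|Y| * #|W|)%:R + Num.sqrt (beta2 * (#|Y| * #|W|)%:R)).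

Lemma equidistributedU (T1 T2 : {set F}) : [disjoint T1 & T2] ->
  equidistributed T1 -> equidistributed T2 -> equidistributed (T1 :|: T2).
Proof.
move=> dT e1 e2 Y W Y0 W0.
have -> : #|T1 :|: T2| = (#|T1| + #|T2|)%N.
  have dI : T1 :&: T2 = set0 by apply/eqP; rewrite setI_eq0.
  by rewrite cardsU dI cards0 subn0.
rewrite (eq_bigl (fun x => x \in [predU mem T1 & mem T2])); last by move=> x; rewrite !inE.
rewrite bigU //= !natrD mulrDl; apply: lerD; [exact: e1 | exact: e2].
Qed.

(** The heart of the proof. Pigeonholing the energy gives the level [D] and the set
    [P] of products with at least [D] representations; pigeonholing the count of
    these representations by their first factor gives the level [s] and the set [A']
    of elements that are quotients of [P] by [B] in at least [s] ways. Then [s] times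
    the incidences of [A'] with [Y] and [W] are among the incidences of [P], [B], [Y]
    and [W]. *)
Lemma exists_equidistributed_piece (B : {set F}) : B \subset A ->
  a ^+ 3 / kap < (mul_energy B)%:R ->
  exists A' : {set F}, [/\ A' \subset B, A' != set0 & equidistributed A'].
Proof.
move=> BA EB.
have B0 : 0 \notin B by apply: contra A0; apply: (subsetP BA).
have bA : (#|B| <= #|A|)%N := subset_leq_card BA.
have [] := @weak_type_square R F [set: F] (rep B) #|A| _ Apos.
  by move=> x _; apply: leq_trans (rep_le _ B0) bA.
move=> D [D0 DA].
have -> : (\sum_(i in [set: F]) rep B i ^ 2 = mul_energy B)%N.
  by rewrite mul_energyE; apply: eq_bigl => x; rewrite inE.
set P := level _ _ _; set p := #|P| => ED.
have P0 : 0 \notin P by rewrite inE rep0 // leqNgt D0 andbF.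
have Dp : (D * p <= \sum_(x in B) quot_count P B x)%N.
  rewrite -sum_rep mulnC -sum_nat_const; apply: leq_sum => x.
  by rewrite inE => /andP[].
have Dp2 : (D * p <= #|A| ^ 2)%N.
  apply: leq_trans Dp _; rewrite -sum_rep; apply: leq_trans (sum_rep_le _ _) _.
  by rewrite leq_exp2r.
have qc_le x : x \in B -> (quot_count P B x <= #|A|)%N.
  move=> _; apply: leq_trans bA; rewrite /quot_count -sum1_card.
  by apply: leq_sum => v _; case: (_ \in _).
have [s [s0 sA]] := @weak_type_linear R F B (quot_count P B) #|A| qc_le Apos.
set A' := level _ _ _; set a' := #|A'| => Es.
have Ha : a ^+ 3 <= 2 * H * kap * D%:R ^+ 2 * p%:R.
  have : a ^+ 3 / kap <= 2 * H * (D ^ 2 * p)%:R.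
    apply: le_trans (ltW EB) _; apply: le_trans ED _.
    by rewrite ler_wpM2r ?ler0n // ler_wpM2l.
  rewrite ler_pdivrMr // natrM natrX => /le_trans; apply.
  by rewrite le_eqVlt; apply/orP; left; apply/eqP; ring.
have Hs : D%:R * p%:R <= H * (s%:R * a'%:R).
  rewrite -!natrM; apply: le_trans (_ : harmonic_sum R #|A| * (s * a')%:R <= _).
    by apply: le_trans Es; rewrite ler_nat.
  by rewrite ler_wpM2r ?ler0n.
have Dr0 : 0 < D%:R :> R by rewrite ltr0n.
have p0 : 0 < p%:R :> R.
  rewrite lt0r ler0n andbT; apply: contraTneq Ha => ->.
  by rewrite mulr0 -ltNge exprn_gt0.
have Dp2r : D%:R * p%:R <= a ^+ 2 by rewrite -natrM -natrX ler_nat.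
(* The number of representations of the products in [P] is at most [a^2], so the
   level [D] is high. *)
have aD : a <= 2 * H * kap * D%:R.
  rewrite -(ler_pM2r (exprn_gt0 2 a0)) -exprS; apply: le_trans Ha _.
  have -> : 2 * H * kap * D%:R ^+ 2 * p%:R = 2 * H * kap * D%:R * (D%:R * p%:R) by ring.
  by apply: ler_wpM2l Dp2r; rewrite !mulr_ge0 ?ler0n ?ltW.
have sr0 : 0 < s%:R :> R by rewrite ltr0n.
exists A'; split.
- by apply/subsetP => x; rewrite inE => /andP[].
- apply: contraTneq Hs => E; rewrite /a' E cards0 !mulr0 -ltNge.
  by rewrite mulr_gt0.
move=> Y W Y0 W0; set g := (\sum_(x in A') _)%N; set y := (#|Y| * #|W|)%:R.
set N := incidences f P B Y W.
have sg : (s * g <= N)%N.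
  rewrite /g big_distrr /N /incidences [leqRHS](bigID (mem A')) /=.
  apply: leq_trans (leq_addr _ _); apply: leq_sum => x; rewrite inE => /andP[_ sx].
  by rewrite leq_mul2r sx orbT.
pose sa := s%:R * a'%:R : R.
have sa0 : 0 <= sa by rewrite mulr_ge0 ?ler0n.
have y0 : 0 <= y by rewrite ler0n.
have br : (#|B|%:R : R) <= a by rewrite ler_nat.
have b0 : 0 <= (#|B|%:R : R) by rewrite ler0n.
have c0 : 0 <= c%:R :> R by rewrite ler0n.
have alpha0 : 0 <= alpha by rewrite /alpha !mulr_ge0 ?invr_ge0 ?ler0n ?exprn_ge0 ?ltW.
have beta0 : 0 <= beta2 by rewrite /beta2 !mulr_ge0 ?invr_ge0 ?ler0n ?exprn_ge0 ?ltW.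
have sb0 := sqrtr_ge0 (beta2 * y).
rewrite -(ler_pM2l sr0) mulrA -/sa; apply: (@le_trans _ _ N%:R); first by rewrite -natrM ler_nat.
rewrite mulrDr.
have ZE : (#|P| * #|B| * #|Y| * #|W|)%:R = p%:R * #|B|%:R * y.
  by rewrite /y -mulnA natrM natrM.
have [|] := mix P0 B0 Y0 W0; rewrite -/N -(ler_nat R).
  rewrite !(natrM R #|F|, natrM R c) ZE => main.
  apply: ler_wpDr; first by rewrite mulr_ge0.
  rewrite -(ler_pM2l q0); apply: le_trans main _.
  have -> : q * (sa * (alpha * y)) = c%:R * (2 * H ^+ 2 * kap * sa * y).
    by rewrite /alpha; field; rewrite lt0r_neq0.
  rewrite ler_wpM2l // ler_wpM2r //.
  apply: le_trans (_ : p%:R * (2 * H * kap * D%:R) <= _).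
    by rewrite ler_wpM2l ?ler0n // (le_trans br).
  have -> : p%:R * (2 * H * kap * D%:R) = 2 * H * kap * (D%:R * p%:R) by ring.
  have -> : 2 * H ^+ 2 * kap * sa = 2 * H * kap * (H * sa) by ring.
  by rewrite ler_wpM2l ?mulr_ge0 // ltW.
rewrite natrX [(c * _ * _)%:R]natrM natrM ZE => main.
apply: ler_wpDl; first exact: mulr_ge0 sa0 (mulr_ge0 alpha0 y0).
rewrite -(@ler_pXn2r _ 2) ?nnegrE ?ler0n //; last exact: mulr_ge0.
rewrite exprMn sqr_sqrtr; last exact: mulr_ge0.
apply: le_trans main _.
have -> : sa ^+ 2 * (beta2 * y) = c%:R * q * (2 * H ^+ 3 * kap * sa ^+ 2 / a ^+ 2 * y).
  by rewrite /beta2; ring.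
rewrite ler_wpM2l ?mulr_ge0 ?(ltW q0) // ler_wpM2r //.
rewrite ler_pdivlMr ?exprn_gt0 //.
apply: le_trans (_ : p%:R * a ^+ 3 <= _).
  rewrite -mulrA ler_wpM2l ?ler0n // [a ^+ 3]exprS; apply: ler_wpM2r => //.
  by rewrite exprn_ge0 // ltW.
apply: le_trans (_ : p%:R * (2 * H * kap * D%:R ^+ 2 * p%:R) <= _).
  by rewrite ler_wpM2l ?ler0n.
have -> : p%:R * (2 * H * kap * D%:R ^+ 2 * p%:R) = 2 * H * kap * (D%:R * p%:R) ^+ 2 by ring.
have -> : 2 * H ^+ 3 * kap * sa ^+ 2 = 2 * H * kap * (H * sa) ^+ 2 by ring.
have [H0' kap0'] := (ltW H0, ltW kap0).
apply: ler_wpM2l; first by rewrite !mulr_ge0.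
by rewrite ler_pXn2r ?nnegrE ?mulr_ge0 ?ler0n.
Qed.

(** Removing equidistributed pieces one after another; each is nonempty, so this
    stops, and their union is equidistributed. *)
Lemma equidistributed_decomposition (B : {set F}) : B \subset A ->
  exists S T : {set F}, [/\ [disjoint S & T], B = S :|: T,
    (mul_energy S)%:R <= a ^+ 3 / kap & equidistributed T].
Proof.
elim: {B}_.+1 {-2}B (ltnSn #|B|) => // n IH B; rewrite ltnS => Bn BA.
have [le|lt] := lerP (mul_energy B)%:R (a ^+ 3 / kap).
  exists B, set0; split=> //; [by rewrite -setI_eq0 setI0 | by rewrite setU0 |].
  by move=> Y W _ _; rewrite big_set0 cards0 mul0r.
have [A' [A'B A'0 eA']] := exists_equidistributed_piece BA lt.
have cB : (#|B :\: A'| < n)%N.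
  apply: leq_trans Bn; rewrite cardsD (setIidPr A'B) -[ltnRHS]subn0.
  by rewrite ltn_sub2l // card_gt0 // -card_gt0 (leq_trans _ (subset_leq_card A'B)) ?card_gt0.
have [S [T [dST BST ES eT]]] := IH (B :\: A') cB (subset_trans (subsetDl _ _) BA).
have T_sub : T \subset B :\: A' by rewrite BST subsetUr.
have S_sub : S \subset B :\: A' by rewrite BST subsetUl.
have dis (Z : {set F}) : Z \subset B :\: A' -> [disjoint Z & A'].
  move=> ZB; rewrite -setI_eq0 -subset0; apply/subsetP => x; rewrite !inE.
  by case/andP => /(subsetP ZB); rewrite !inE => /andP[/negPf ->].
exists S, (T :|: A'); split=> //.
- by rewrite -setI_eq0 setIUr setU_eq0 !setI_eq0 dST dis.
- apply/setP => x; rewrite setUA -BST !inE.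
  by case: (boolP (x \in A')) => [/(subsetP A'B) ->|_]; rewrite ?orbT ?orbF.
by apply: equidistributedU => //; exact: dis.
Qed.

Lemma card_rf_image (T : {set F}) : (#|rf_image f T| <= #|T|)%N.
Proof.
apply: leq_trans (leq_imset_card _ _) _; apply: subset_leq_card.
by apply/subsetP => t; rewrite inE => /andP[].
Qed.

(** Choosing for each [y] in the image a point above it. *)
Lemma sum_rf_image_leq (T Y : {set F}) (g : F -> nat) : Y \subset rf_image f T ->
  (\sum_(y in Y) g y <= \sum_(t in T) ~~ rf_pole f t * g (rf_eval f t))%N.
Proof.
move=> YT; pose D := [set t in T | ~~ rf_pole f t].
have DE : rf_image f T = rf_eval f @: D.
  by apply/setP => y; apply/imsetP/imsetP => -[t tD ->]; exists t => //; move: tD; rewrite !inE.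
apply: (@leq_trans (\sum_(y in rf_image f T) g y)%N).
  rewrite [leqRHS](bigID (mem Y)) /=; apply: leq_trans (leq_addr _ _).
  by apply: eq_leq; apply: eq_bigl => y; case: (boolP (y \in Y)) => yY;
    rewrite ?andbF // (subsetP YT).
apply: (@leq_trans (\sum_(t in D) g (rf_eval f t))%N).
  rewrite [leqRHS](partition_big_imset (rf_eval f)) -DE /=; apply: leq_sum => y.
  rewrite DE => /imsetP[t tD ->]; rewrite (bigD1 t) ?tD ?eqxx //= leq_addr //.
rewrite (eq_bigl (fun t => (t \in T) && ~~ rf_pole f t)) => [|t]; last by rewrite inE.
rewrite big_mkcondr; apply: leq_sum => t _.
by case: ifP => _; rewrite ?mul1n.
Qed.

(** Each product in the popular level set [W] of [Y] has at least [s] representations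
    [f t * y], so [s |W|] is at most the incidence count of [T] with [Y] and [W].
    Equidistribution turns this into a bound on [s^2 |W|], which up to a logarithm is
    the energy; the two terms of the bound correspond to the main term or the error
    term being larger. *)
Lemma mul_energy_rf_image (T : {set F}) : T \subset A -> equidistributed T ->
  (mul_energy (rf_image f T))%:R <=
    4 * a ^+ 2 + (8 * c%:R * H ^+ 3 * kap * a ^+ 4 / q + 16 * c%:R * H ^+ 4 * kap * q * a).
Proof.
move=> TA eT; set U := rf_image f T; set Y := U :\ 0.
have UA : (#|U| <= #|A|)%N := leq_trans (card_rf_image T) (subset_leq_card TA).
have YU : Y \subset U := subD1set _ _.
have YA : (#|Y| <= #|A|)%N := leq_trans (subset_leq_card YU) UA.
have Y0 : 0 \notin Y by rewrite in_setD1 eqxx.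
set E := (\sum_(x in [set~ 0%R]) rep Y x ^ 2)%N.
apply: (@le_trans _ _ (4 * a ^+ 2 + E%:R)).
  rewrite -natrX -natrM -natrD ler_nat; apply: leq_trans (mul_energy_setD1 U) _.
  by rewrite leq_add2r leq_mul2l leq_exp2r.
rewrite lerD2l.
have [] := @weak_type_square R F [set~ 0] (rep Y) #|A| _ Apos.
  by move=> x _; apply: leq_trans (rep_le _ Y0) YA.
move=> s [s0 sA]; rewrite -/E; set W := level _ _ _ => EW.
have W0 : 0 \notin W by rewrite !inE eqxx.
have sW : (s * #|W| <= \sum_(x in W) rep Y x)%N.
  rewrite mulnC -sum_nat_const; apply: leq_sum => x.
  by rewrite inE => /andP[].
have sWA : (s * #|W| <= #|A| ^ 2)%N.
  apply: leq_trans sW _; apply: leq_trans (sum_rep_le _ _) _.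
  by rewrite leq_exp2r.
have sWT : (s * #|W| <= \sum_(t in T) image_count f Y W t)%N.
  apply: leq_trans sW _; rewrite sum_rep.
  apply: leq_trans (sum_rf_image_leq _ YU) _; apply: leq_sum => t _.
  rewrite /quot_count /image_count big_distrr /=; apply: leq_sum => y _.
  by case: (~~ _); rewrite ?mul1n.
have c0 : 0 <= c%:R :> R by rewrite ler0n.
have H0' := ltW H0; have a0' := ltW a0; have kap0' := ltW kap0; have q0' := ltW q0.
have alpha0 : 0 <= alpha by rewrite /alpha !mulr_ge0 ?invr_ge0 ?exprn_ge0.
have beta0 : 0 <= beta2 by rewrite /beta2 !mulr_ge0 ?invr_ge0 ?exprn_ge0.
set w : R := #|W|%:R; have w0 : 0 <= w by rewrite ler0n.
(* Both sides are increasing in the sizes of [T] and [Y], which are at most [a]. *)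
have sw : s%:R * w <= a * (alpha * (a * w) + Num.sqrt (beta2 * (a * w))).
  apply: le_trans (_ : (\sum_(t in T) image_count f Y W t)%:R <= _).
    by rewrite /w -natrM ler_nat.
  apply: le_trans (eT Y W Y0 W0) _.
  have Yw : (#|Y| * #|W|)%:R <= a * w by rewrite /w -natrM ler_nat leq_mul2r YA orbT.
  apply: ler_pM; first exact: ler0n.
  - by apply: addr_ge0 (sqrtr_ge0 _); apply: mulr_ge0 => //; exact: ler0n.
  - by rewrite ler_nat subset_leq_card.
  by apply: lerD; [exact: ler_wpM2l | apply: ler_wsqrtr; exact: ler_wpM2l].
have sw2 : s%:R * w <= a ^+ 2 by rewrite /w -natrM -natrX ler_nat.
have {}EW : E%:R <= 2 * H * (s%:R ^+ 2 * w).
  apply: le_trans EW _; rewrite natrM natrX -/w; apply: ler_wpM2r.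
    by rewrite mulr_ge0 ?exprn_ge0.
  by apply: ler_wpM2l.
have s0' : 0 <= s%:R :> R by rewrite ler0n.
have t1 : 0 <= 8 * c%:R * H ^+ 3 * kap * a ^+ 4 / q.
  by rewrite !mulr_ge0 ?invr_ge0 ?exprn_ge0.
have t2 : 0 <= 16 * c%:R * H ^+ 4 * kap * q * a by rewrite !mulr_ge0 ?exprn_ge0.
have [w_eq0|w_neq0] := eqVneq w 0.
  by apply: le_trans EW _; rewrite w_eq0 !mulr0 addr_ge0.
have wpos : 0 < w by rewrite lt0r w_neq0.
apply: le_trans EW _; have aw0 : 0 <= a * w by exact: mulr_ge0.
have [le|lt] := lerP (Num.sqrt (beta2 * (a * w))) (alpha * (a * w)).
  apply: ler_wpDr => //.
  have s_le : s%:R <= 2 * alpha * a ^+ 2.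
    rewrite -(ler_pM2r wpos); apply: le_trans sw _.
    have -> : 2 * alpha * a ^+ 2 * w = a * (alpha * (a * w) + alpha * (a * w)) by ring.
    by apply: ler_wpM2l => //; rewrite lerD2l.
  have -> : 8 * c%:R * H ^+ 3 * kap * a ^+ 4 / q = 2 * H * ((2 * alpha * a ^+ 2) * a ^+ 2).
    by rewrite /alpha; field; rewrite lt0r_neq0.
  apply: ler_wpM2l; first exact: mulr_ge0.
  by rewrite expr2 -mulrA; apply: ler_pM => //; exact: mulr_ge0.
apply: ler_wpDl => //.
have -> : 16 * c%:R * H ^+ 4 * kap * q * a = 2 * H * (4 * beta2 * a ^+ 3).
  by rewrite /beta2; field; rewrite lt0r_neq0.
apply: ler_wpM2l; first exact: mulr_ge0.
rewrite -(ler_pM2r wpos).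
have -> : s%:R ^+ 2 * w * w = (s%:R * w) ^+ 2 by ring.
have -> : 4 * beta2 * a ^+ 3 * w = (2 * a * Num.sqrt (beta2 * (a * w))) ^+ 2.
  by rewrite exprMn sqr_sqrtr; [ring | exact: mulr_ge0].
rewrite ler_pXn2r ?nnegrE //; [|exact: mulr_ge0|by rewrite !mulr_ge0 ?sqrtr_ge0].
apply: le_trans sw _; set S := Num.sqrt _ in lt *.
have -> : 2 * a * S = a * (S + S) by ring.
by apply: ler_wpM2l => //; rewrite lerD2r ltW.
Qed.

End Decomposition.

(** * The threshold M *)

(** Induction, by [ln (1 - 1/n) <= - 1/n]. *)
Lemma harmonic_sum_ln (R : realType) n : (0 < n)%N -> harmonic_sum R n <= 1 + ln n%:R.
Proof.
case: n => // n _; elim: n => [|n IH].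
  by rewrite /harmonic_sum big_ord1 invr1 ln1 addr0.
rewrite /harmonic_sum big_ord_recr /= -/(harmonic_sum R n.+1).
have n1 : 0 < n.+1%:R :> R by rewrite ltr0n.
have n2 : 0 < n.+2%:R :> R by rewrite ltr0n.
have step : ln n.+1%:R + n.+2%:R^-1 <= ln n.+2%:R :> R.
  have := @le_ln1Dx R (- n.+2%:R^-1); rewrite ltrN2 invf_lt1 // ltr1n => /(_ isT).
  have -> : 1 - n.+2%:R^-1 = n.+1%:R / n.+2%:R :> R.
    apply: (mulIf (lt0r_neq0 n2)).
    by rewrite mulrBl mulVf ?lt0r_neq0 // divfK ?lt0r_neq0 // mul1r -natr1 addrK.
  by rewrite ln_div ?posrE // lerBlDr addrC -lerBrDr.
by apply: le_trans (lerD IH (lexx _)) _; rewrite -addrA lerD2l.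
Qed.

Lemma ln2_gt0 (R : realType) : 0 < ln 2 :> R.
Proof. by apply: ln_gt0; rewrite ltr1n. Qed.

Lemma inv_ln2_ge1 (R : realType) : 1 <= (ln 2)^-1 :> R.
Proof.
rewrite invf_ge1 ?ln2_gt0 //; have := @le_ln1Dx R 1; rewrite -[1 + 1]/(2 : R); apply.
by rewrite (lt_trans _ ltr01) // ltrN10.
Qed.

Section RealBounds.
Variable R : realType.
Implicit Types x L a q : R.

Lemma sqr_powR x e : 0 <= x -> (x `^ e) ^+ 2 = x `^ (e * 2).
Proof. by move=> x0; rewrite -powR_mulrn ?powR_ge0 // -powRrM. Qed.

Let one_powR e : 1 `^ e = 1 :> R. Proof. by rewrite powR1. Qed.

Let powR_mono x y e : 0 <= e -> 0 <= x -> x <= y -> x `^ e <= y `^ e.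
Proof.
by move=> e0 x0 xy; apply: ge0_ler_powR; rewrite ?nnegrE // (le_trans x0).
Qed.

Let K0 : R := (ln 2)^-1.

Let ln2_pos : 0 < ln 2 :> R. Proof. exact: ln2_gt0. Qed.

Let K0_ge1 : 1 <= K0. Proof. exact: inv_ln2_ge1. Qed.

(** Since [L >= ln 2], a negative power of the logarithm is bounded. This lets
    integer powers absorb the fractional exponents in the definition of M. *)
Lemma inv_powR_ln L (e : R) (n : nat) : ln 2 <= L -> 0 <= e -> e <= n%:R ->
  (L `^ e)^-1 <= K0 ^+ n.
Proof.
move=> lL e0 en; have L0 : 0 < L := lt_le_trans ln2_pos lL.
have K00 : 0 <= K0 by apply: le_trans K0_ge1.
apply: le_trans (_ : K0 `^ e <= _); last first.
  by rewrite -powR_mulrn // ler_powR.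
rewrite -[X in X <= _]mul1r ler_pdivrMr ?powR_gt0 // -powRM // ?(ltW L0) //.
rewrite -[X in X <= _](one_powR e); apply: powR_mono => //.
by rewrite /K0 mulrC ler_pdivlMr // mul1r.
Qed.

Variables (a q : R) (L : R).
Hypotheses (a0 : 0 < a) (q1 : 1 <= q) (lL : ln 2 <= L) (a1 : 1 <= a).

Let q0 : 0 < q. Proof. exact: lt_le_trans ltr01 q1. Qed.
Let L0 : 0 < L. Proof. exact: lt_le_trans ln2_pos lL. Qed.

(** The two terms of the minimum that defines M, with [L] for the logarithm of [a]. *)
Definition M1 : R := q `^ (1 / 2) / (a `^ (1 / 2) * L `^ (11 / 4)).
Definition M2 : R := a `^ (4 / 5) / (q `^ (2 / 5) * L `^ (31 / 10)).

Lemma M1_gt0 : 0 < M1. Proof. by rewrite divr_gt0 ?mulr_gt0 ?powR_gt0. Qed.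
Lemma M2_gt0 : 0 < M2. Proof. by rewrite divr_gt0 ?mulr_gt0 ?powR_gt0. Qed.

Let K00 : 0 <= K0. Proof. exact: le_trans ler01 K0_ge1. Qed.

Lemma M2E : M2 = (a ^+ 2 / q) `^ (2 / 5) * (L `^ (31 / 10))^-1.
Proof.
rewrite powRM ?exprn_ge0 ?invr_ge0 ?(ltW a0) ?(ltW q0) // /M2 invfM mulrA.
congr (_ * _ * _).
  by rewrite -powR_mulrn ?(ltW a0) // -powRrM; congr (_ `^ _); lra.
by rewrite -powRN -(powR_inv1 (ltW q0)) -powRrM; congr (_ `^ _); lra.
Qed.

(** In this range the theorem holds for trivial reasons. *)
Lemma M2_trivial : a ^+ 2 <= q -> M2 <= K0 ^+ 4.
Proof.
move=> aq; rewrite M2E -[leRHS]mul1r; apply: ler_pM; rewrite ?powR_ge0 ?invr_ge0 ?powR_ge0 //.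
  rewrite -[leRHS](one_powR (2 / 5)); apply: powR_mono; first by lra.
    by rewrite divr_ge0 ?exprn_ge0 ?(ltW a0) ?(ltW q0).
  by rewrite ler_pdivrMr // mul1r.
by apply: inv_powR_ln => //; lra.
Qed.

(** This absorbs the contribution of the element 0 to the energy of the image. *)
Lemma M2_le : M2 <= a * K0 ^+ 4.
Proof.
rewrite /M2 invfM; apply: ler_pM; rewrite ?powR_ge0 ?mulr_ge0 ?invr_ge0 ?powR_ge0 //.
  by rewrite ler1_powR //; lra.
rewrite -[leRHS]mul1r; apply: ler_pM; rewrite ?invr_ge0 ?powR_ge0 //.
  rewrite invf_le1 ?powR_gt0 //; rewrite -[leLHS](one_powR (2 / 5)).
  by apply: powR_mono => //; lra.
by apply: inv_powR_ln => //; lra.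
Qed.

Let a0' : 0 <= a. Proof. exact: ltW. Qed.
Let q0' : 0 <= q. Proof. exact: ltW. Qed.
Let L0' : 0 <= L. Proof. exact: ltW. Qed.

(** This is what the main term of the equidistribution requires of M. The exponent
    [11/4] of the logarithm leaves a factor [L^(5/2)] to spare over the three
    logarithms that are lost. *)
Lemma M1_sqr : M1 ^+ 2 * a * (2 * K0 * L) ^+ 3 <= q * (8 * K0 ^+ 6).
Proof.
rewrite /M1 expr_div_n exprMn !sqr_powR //.
have -> : (1 / 2 * 2 : R) = 1 by field.
rewrite !powRr1 //.
have -> : q / (a * L `^ (11 / 4 * 2)) * a * (2 * K0 * L) ^+ 3 =
   q * (8 * K0 ^+ 3 * (L ^+ 3 / L `^ (11 / 4 * 2))).
  by field; rewrite !lt0r_neq0 ?powR_gt0.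
apply: ler_wpM2l; first by [].
have -> : 8 * K0 ^+ 6 = 8 * K0 ^+ 3 * K0 ^+ 3 by ring.
apply: ler_wpM2l; first by rewrite mulr_ge0 ?exprn_ge0.
have -> : L `^ (11 / 4 * 2) = L ^+ 3 * L `^ (5 / 2).
  by rewrite -powR_mulrn // -powRD ?lt0r_neq0 ?implybT //; congr (_ `^ _); field.
rewrite invfM mulrA divff ?mul1r ?expf_neq0 ?lt0r_neq0 //.
by apply: inv_powR_ln => //; lra.
Qed.

(** This is what the error term of the equidistribution requires of M; again more
    logarithms are gained than the four that are lost. *)
Lemma M2_sqr : q <= a ^+ 2 -> M2 ^+ 2 * q * (2 * K0 * L) ^+ 4 <= a ^+ 2 * (16 * K0 ^+ 7).
Proof.
move=> qa; rewrite M2E exprMn exprVn !sqr_powR ?divr_ge0 ?exprn_ge0 //.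
have aq1 : 1 <= a ^+ 2 / q by rewrite ler_pdivlMr // mul1r.
apply: le_trans (_ : (a ^+ 2 / q) * (L `^ (31 / 10 * 2))^-1 * q * (2 * K0 * L) ^+ 4 <= _).
  have E (t u v w : R) : t * u * v * w = t * (u * v * w) by ring.
  rewrite [leLHS]E [leRHS]E; apply: ler_wpM2r.
    apply: mulr_ge0; first by apply: mulr_ge0 => //; rewrite invr_ge0 powR_ge0.
    by apply: exprn_ge0; apply: mulr_ge0 => //; apply: mulr_ge0.
  by rewrite ler1_powR //; lra.
have -> : a ^+ 2 / q * (L `^ (31 / 10 * 2))^-1 * q * (2 * K0 * L) ^+ 4 =
   a ^+ 2 * (16 * K0 ^+ 4 * (L ^+ 4 / L `^ (31 / 10 * 2))).
  by field; rewrite !lt0r_neq0 ?powR_gt0.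
apply: ler_wpM2l; first by rewrite exprn_ge0.
have -> : 16 * K0 ^+ 7 = 16 * K0 ^+ 4 * K0 ^+ 3 by ring.
apply: ler_wpM2l; first by rewrite mulr_ge0 ?exprn_ge0.
have -> : L `^ (31 / 10 * 2) = L ^+ 4 * L `^ (11 / 5).
  by rewrite -powR_mulrn // -powRD ?lt0r_neq0 ?implybT //; congr (_ `^ _); field.
rewrite invfM mulrA divff ?mul1r ?expf_neq0 ?lt0r_neq0 //.
by apply: inv_powR_ln => //; lra.
Qed.

End RealBounds.

(** * The theorem *)

Theorem theorem1p1 (R : realType) (k : nat) (hk : (0 < k)%N) :
  exists C : R, 0 < C /\
    forall (F : finFieldType) (A : {set F}) (f : {fraction {poly F}}),
      0 \notin A ->
      (2 <= #|A|)%N ->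
      rf_deg f = k ->
      ~ rf_power_form #|F| f ->
      exists S T : {set F},
        [/\ [disjoint S & T], A = S :|: T &
            Num.max (mul_energy S)%:R (mul_energy (rf_image f T))%:R
              <= C * (#|A|%:R ^+ 3 / bound_M R A)].
Proof.
(* The number [c] majorises the constants of both alternatives of [mixing]; [K0]
   bounds the negative powers of the logarithm of [a], which is at least [ln 2]. *)
pose K0 : R := (ln 2)^-1; pose c := (8 + 4 * (2 * k + 2) ^ 2)%N.
have ln2_pos : 0 < ln 2 :> R by exact: ln2_gt0.
have K01 : 1 <= K0 by exact: inv_ln2_ge1.
have K00 : 0 < K0 by rewrite invr_gt0.
have c0 : 0 <= c%:R :> R by rewrite ler0n.
(* Constants for the element 0, the main term and the error term in the energy of the
   image. *)
pose C1 : R := 4 * K0 ^+ 4; pose C2 : R := 64 * c%:R * K0 ^+ 6.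
pose C3 : R := 256 * c%:R * K0 ^+ 7.
have [C10 C20 C30] : [/\ 0 <= C1, 0 <= C2 & 0 <= C3].
  have e n : 0 <= K0 ^+ n by rewrite exprn_ge0 // ltW.
  by split; apply: mulr_ge0 (e _); rewrite ?mulr_ge0 ?ler0n.
exists (1 + (C1 + (C2 + C3))); split.
  by rewrite ltr_pwDl ?addr_ge0.
move=> F A f A0 A2 fk nondeg.
set a : R := #|A|%:R; set q : R := #|F|%:R; set L := ln a; set M := bound_M R A.
have a2 : 2 <= a by rewrite ler_nat.
have a1 : 1 <= a by apply: le_trans a2; rewrite ler1n.
have a0 : 0 < a by apply: lt_le_trans a1.
have q1 : 1 <= q by rewrite ler1n ltnW // card_gt1.
have q0 : 0 < q by apply: lt_le_trans q1.
have lL : ln 2 <= L by rewrite ler_ln ?posrE.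
have L0 : 0 < L by apply: lt_le_trans lL.
have M_le1 : M <= M1 a q L by rewrite /M /bound_M ge_min lexx.
have M_le2 : M <= M2 a q L by rewrite /M /bound_M ge_min lexx orbT.
have Mpos : 0 < M by rewrite /M /bound_M lt_min M1_gt0 // M2_gt0.
have aM0 : 0 <= a ^+ 3 / M by rewrite divr_ge0 ?exprn_ge0 ?(ltW a0) ?(ltW Mpos).
have C_le : forall x y : R, 0 <= x -> x <= 1 + (C1 + (C2 + C3)) ->
  y <= x * (a ^+ 3 / M) -> y <= (1 + (C1 + (C2 + C3))) * (a ^+ 3 / M).
  move=> x y x0 xC /le_trans; apply; exact: ler_wpM2r.
(* For small sets M is bounded, so the trivial decomposition works. *)
have [aq | qa] := leP (a ^+ 2) q.
  exists A, set0; split; [by rewrite -setI_eq0 setI0 | by rewrite setU0 |].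
  have img0 : rf_image f set0 = set0.
    by apply/setP => y; rewrite inE; apply/imsetP => -[t]; rewrite !inE.
  have E0 : mul_energy (set0 : {set F}) = 0%N.
    by apply/eqP; rewrite -leqn0 (leq_trans (mul_energy_le _)) ?inE // cards0.
  rewrite img0 E0 ge_max; apply/andP; split; last first.
    by apply: mulr_ge0 aM0; rewrite !addr_ge0.
  apply: (C_le C1) => //; first by rewrite addrCA lerDl !addr_ge0.
  apply: le_trans (_ : a ^+ 3 <= _); first by rewrite -natrX ler_nat mul_energy_le.
  rewrite mulrA ler_pdivlMr // mulrC ler_wpM2r ?exprn_ge0 ?(ltW a0) //.
  apply: le_trans M_le2 _; apply: le_trans (M2_trivial a0 q1 lL aq) _.
  by rewrite /C1 ler_peMl ?exprn_ge0 ?(ltW K00) // ler1n.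
(* At least [1 + L], since [K0 * L >= 1]; the purely multiplicative form is easier to
   compare with powers of [L]. *)
pose H : R := 2 * K0 * L.
have HA : harmonic_sum R #|A| <= H.
  apply: le_trans (@harmonic_sum_ln R #|A| (ltnW A2)) _; rewrite -/a -/L.
  have KL : 1 <= K0 * L by rewrite /K0 mulrC ler_pdivlMr // mul1r.
  have LK : L <= K0 * L by rewrite ler_peMl // ltW.
  by rewrite /H; lra.
have mix : forall U V Y W : {set F},
  0 \notin U -> 0 \notin V -> 0 \notin Y -> 0 \notin W ->
  let N := incidences f U V Y W in
  let Z := (#|U| * #|V| * #|Y| * #|W|)%N in
  (#|F| * N <= c * Z)%N \/ (N ^ 2 <= c * #|F| * Z)%N.
  move=> U V Y W U0 V0 Y0 W0 N Z.
  have fdeg : (0 < rf_deg f)%N by rewrite fk.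
  have [le|le] := mixing fdeg nondeg U0 V0 Y0 W0; [left | right].
    by apply: leq_trans le _; rewrite leq_mul2r leq_addr orbT.
  apply: leq_trans le _; rewrite !leq_mul2r /c fk leq_addl !orbT //.
have Apos : (0 < #|A|)%N := ltnW A2.
have [S [T [dST AST ES eT]]] :=
  @equidistributed_decomposition R F f A M H c A0 Apos Mpos HA mix A (subxx A).
exists S, T; split=> //; rewrite ge_max; apply/andP; split.
  by apply: (C_le 1) => //; rewrite ?mul1r // lerDl !addr_ge0.
have TA : T \subset A by rewrite AST subsetUr.
have := @mul_energy_rf_image R F f A M H c Apos Mpos HA T TA eT.
move=> /le_trans; apply; apply: (C_le (C1 + (C2 + C3))); rewrite ?addr_ge0 ?lerDr //.
rewrite [leRHS]mulrDl [X in _ <= _ + X]mulrDl -/a -/q; have M2' : 0 <= M by exact: ltW.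
have Hge0 : 0 <= H by rewrite /H !mulr_ge0 // ltW.
apply: lerD; last apply: lerD.
- rewrite [leRHS]mulrA ler_pdivlMr //.
  have -> : C1 * a ^+ 3 = 4 * a ^+ 2 * (a * K0 ^+ 4) by rewrite /C1; ring.
  apply: ler_wpM2l; first by rewrite mulr_ge0 ?exprn_ge0 // ltW.
  exact: le_trans M_le2 (M2_le q1 lL a1).
- rewrite [leRHS]mulrA ler_pdivlMr // mulrAC ler_pdivrMr //.
  have -> : 8 * c%:R * H ^+ 3 * M * a ^+ 4 * M = 8 * c%:R * a ^+ 3 * (M ^+ 2 * a * H ^+ 3) by ring.
  have -> : C2 * a ^+ 3 * q = 8 * c%:R * a ^+ 3 * (q * (8 * K0 ^+ 6)) by rewrite /C2; ring.
  apply: ler_wpM2l; first by rewrite !mulr_ge0 ?exprn_ge0 // ltW.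
  apply: le_trans (M1_sqr a0 q1 lL); rewrite -/K0 -/H.
  apply: ler_wpM2r; first exact: exprn_ge0.
  apply: ler_wpM2r; first exact: ltW.
  by rewrite ler_pXn2r ?nnegrE // ltW // M1_gt0.
rewrite [leRHS]mulrA ler_pdivlMr //.
have -> : 16 * c%:R * H ^+ 4 * M * q * a * M = 16 * c%:R * a * (M ^+ 2 * q * H ^+ 4) by ring.
have -> : C3 * a ^+ 3 = 16 * c%:R * a * (a ^+ 2 * (16 * K0 ^+ 7)) by rewrite /C3; ring.
apply: ler_wpM2l; first by rewrite !mulr_ge0 // ltW.
apply: le_trans (M2_sqr a0 q1 lL (ltW qa)); rewrite -/K0 -/H.
apply: ler_wpM2r; first exact: exprn_ge0.
apply: ler_wpM2r; first exact: ltW.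
by rewrite ler_pXn2r ?nnegrE // ltW // M2_gt0.
Qed.
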